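(* Let $0<R_0\leq \infty$. A function $f$ is semiregular on $B(0,R_0)$ if, and only if, $f|_{B(0,R)} \in \mathcal{L}_R$ for all $R<R_0$.
   Context: $\mathbb{H}$ is the skew field of real quaternions, $\mathbb{S} = \{q \in \mathbb{H} : q^2=-1\}$, $L_I = \mathbb{R} + I\mathbb{R}$ for $I\in\mathbb{S}$, $B(0,R)=\{q\in\mathbb{H}:|q|<R\}$. For a domain $\Omega\subseteq\mathbb{H}$ set $\Omega_I=\Omega\cap L_I$ and, for $f:\Omega\to\mathbb{H}$, $f_I=f|_{\Omega_I}$. A real differentiable $f:\Omega\to\mathbb{H}$ is regular if for every $I\in\mathbb{S}$ the function $\frac12\left(\frac{\partial}{\partial x}+I\frac{\partial}{\partial y}\right)f_I(x+Iy)$ vanishes identically on $\Omega_I$. Regular functions on $B(0,R)$ are exactly the sums of power series $\sum_{n\ge0}q^na_n$, $a_n\in\mathbb{H}$, converging in $B(0,R)$; their set is $\mathcal{D}_R$. Poles: if a regular $f$ is defined on an annulus $\{z\in L_I: R_1<|z-p|<R_2\}$ in a complex line $L_I$ through $p$ (for an isolated singularity in $L_I$, $R_1=0$), write $f_I(z)=\sum_{n\in\mathbb{Z}}(z-p)^na_n$ there, $a_n\in\mathbb{H}$ (for real $p$ the $a_n$ do not depend on $I$). The point $p$ is a pole if there is $n\in\mathbb{N}$ (possibly $0$) with $a_{-m}=0$ for all $m>n$; otherwise $p$ is an essential singularity. Semiregular: let $\mathcal{S}\subseteq\Omega$ be such that $\mathcal{S}\cap L_I$ is a discrete subset of $\Omega_I$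 for all $I\in\mathbb{S}$; a regular function $f:\Omega\setminus\mathcal{S}\to\mathbb{H}$ is semiregular on $\Omega$ if $\mathcal{S}$ contains no essential singularities for $f$. Regular operations: for $f=\sum q^na_n$, $g=\sum q^nb_n$ in $\mathcal{D}_R$, $f*g(q)=\sum_n q^n\sum_{k=0}^na_kb_{n-k}$, $f^c(q)=\sum_n q^n\bar a_n$, $f^s=f*f^c$. The left regular quotient is $f^{-*}*g(q)=\frac{1}{f^s(q)}\,f^c*g(q)$ on $B(0,R)$ minus the zero set of $f^s$, and $\mathcal{L}_R=\{f^{-*}*g: f,g\in\mathcal{D}_R,\ f\not\equiv0\}$. If $\Omega$ is the domain on which $f$ is regular, $f|_{B(0,R)}$ denotes $f|_{\Omega\cap B(0,R)}$; equality of semiregular functions means equality at the points where both are defined. *)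

(* Defs.v *)
From Stdlib Require Import Reals ZArith.
From Coquelicot Require Import Coquelicot.

Open Scope R_scope.

(* (a, b, c, d) stands for a + b i + c j + d k.  The norm that Coquelicot puts on
   a product is sqrt (|x|^2 + |y|^2), so [norm] on [quat] is the usual Euclidean
   modulus, and [locally], [open], [is_series] refer to the usual topology of
   R^4. *)
Definition quat : NormedModule R_AbsRing :=
  prod_NormedModule R_AbsRing
    (prod_NormedModule R_AbsRing
      (prod_NormedModule R_AbsRing R_NormedModule R_NormedModule)
      R_NormedModule)
    R_NormedModule.

Definition qreal (x : R) : quat := (x, 0, 0, 0).

Definition qmul (p q : quat) : quat :=
  let '(a, b, c, d) := p in
  let '(a', b', c', d') := q in
  (a * a' - b * b' - c * c' - d * d',
   a * b' + b * a' + c * d' - d * c',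
   a * c' - b * d' + c * a' + d * b',
   a * d' + b * c' - c * b' + d * a').

Definition qconj (q : quat) : quat := let '(a, b, c, d) := q in (a, - b, - c, - d).

Definition qinv (q : quat) : quat := scal (/ (norm q) ^ 2) (qconj q).

Fixpoint qpow (q : quat) (n : nat) : quat :=
  match n with O => qreal 1 | S m => qmul q (qpow q m) end.

Definition qzpow (q : quat) (n : Z) : quat :=
  match n with
  | Z0 => qreal 1
  | Zpos m => qpow q (Pos.to_nat m)
  | Zneg m => qpow (qinv q) (Pos.to_nat m)
  end.

Definition imag_unit (I : quat) : Prop := qmul I I = opp (qreal 1).

Definition slice_pt (I : quat) (x y : R) : quat := plus (qreal x) (scal y I).

Definition slice (I : quat) (q : quat) : Prop := exists x y : R, q = slice_pt I x y.

Definition qball (r : Rbar) (q : quat) : Prop := Rbar_lt (norm q) r.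

Definition connected (U : quat -> Prop) : Prop :=
  forall V W : quat -> Prop, open V -> open W ->
    (forall q, U q -> V q \/ W q) ->
    (exists q, U q /\ V q) -> (exists q, U q /\ W q) ->
    exists q, U q /\ V q /\ W q.

Definition domain (U : quat -> Prop) : Prop :=
  (exists q, U q) /\ open U /\ connected U.

(* A function defined on a subset of the quaternions; the values of [fn] off
   [dom] carry no meaning. *)
Record pfun := Pfun { dom : quat -> Prop; fn :> quat -> quat }.

Definition restrict (f : pfun) (A : quat -> Prop) : pfun :=
  Pfun (fun q => dom f q /\ A q) f.

Definition regular (f : pfun) : Prop :=
  domain (dom f) /\
  (forall q, dom f q -> ex_filterdiff f (locally q)) /\
  (forall I x y, imag_unit I -> dom f (slice_pt I x y) ->
     exists dx dy : quat,
       @is_derive R_AbsRing quat (fun t => f (slice_pt I t y)) x dx /\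
       @is_derive R_AbsRing quat (fun t => f (slice_pt I x t)) y dy /\
       scal (/ 2) (plus dx (qmul I dy)) = zero).

(* [f] is the sum of the Laurent series with coefficients [a] on a punctured disc
   around [p] in the complex line of [I]; both halves of the two-sided series are
   required to converge. *)
Definition laurent_expansion (f : pfun) (I p : quat) (a : Z -> quat) : Prop :=
  exists r : R, 0 < r /\
    forall z, slice I z -> 0 < norm (minus z p) < r ->
      dom f z /\
      exists u v : quat,
        is_series (fun n : nat =>
          qmul (qzpow (minus z p) (Z.of_nat n)) (a (Z.of_nat n))) u /\
        is_series (fun n : nat =>
          qmul (qzpow (minus z p) (- Z.of_nat (S n))) (a (- Z.of_nat (S n))%Z)) v /\
        f z = plus u v.

(* A nonreal [p] lies in a single complex line; for a real [p] the coefficients do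
   not depend on the line, so any [I] can be used. *)
Definition pole (f : pfun) (p : quat) : Prop :=
  exists (I : quat) (a : Z -> quat),
    imag_unit I /\ slice I p /\ laurent_expansion f I p a /\
    exists n : nat, forall m : nat, (n < m)%nat -> a (- Z.of_nat m)%Z = zero.

Definition essential_singularity (f : pfun) (p : quat) : Prop := ~ pole f p.

Definition slice_discrete (E : quat -> Prop) : Prop :=
  forall I p, imag_unit I -> slice I p -> E p ->
    exists eps : R, 0 < eps /\
      forall z, slice I z -> E z -> norm (minus z p) < eps -> z = p.

(* The domain of [f] is [A] minus [E], where [E] meets each complex line in a
   discrete set.  If the domain of [f] and [A] are open, [E] is moreover closed
   in [A]. *)
Definition defined_off (A E : quat -> Prop) (f : pfun) : Prop :=
  (forall q, E q -> A q) /\ slice_discrete E /\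
  (forall q, dom f q <-> A q /\ ~ E q).

Definition semiregular (A : quat -> Prop) (f : pfun) : Prop :=
  exists E : quat -> Prop,
    defined_off A E f /\ regular f /\
    forall p, E p -> ~ essential_singularity f p.

(* Regular functions on a ball centred at 0 are represented by the coefficients
   of their power series. *)
Definition pterm (a : nat -> quat) (q : quat) (n : nat) : quat := qmul (qpow q n) (a n).

Definition qSeries (u : nat -> quat) : quat :=
  (Series (fun n => fst (fst (fst (u n)))), Series (fun n => snd (fst (fst (u n)))),
   Series (fun n => snd (fst (u n))), Series (fun n => snd (u n))).

Definition psum (a : nat -> quat) (q : quat) : quat := qSeries (pterm a q).

Definition in_D (r : R) (a : nat -> quat) : Prop :=
  forall q, qball r q -> ex_series (pterm a q).

Definition star (a b : nat -> quat) (n : nat) : quat :=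
  sum_n (fun k => qmul (a k) (b (n - k)%nat)) n.

Definition reg_conj (a : nat -> quat) (n : nat) : quat := qconj (a n).

Definition symmetrization (a : nat -> quat) : nat -> quat := star a (reg_conj a).

Definition left_quotient (r : R) (a b : nat -> quat) : pfun :=
  Pfun (fun q => qball r q /\ psum (symmetrization a) q <> zero)
       (fun q => qmul (qinv (psum (symmetrization a) q)) (psum (star (reg_conj a) b) q)).

(* Equality is meant as for semiregular functions on the ball: both functions are
   defined off sets that are discrete in each complex line, and they agree where
   both are defined.  For the quotient, the zero set of the symmetrization always
   has this form. *)
Definition in_L (r : R) (f : pfun) : Prop :=
  (exists E, defined_off (qball r) E f) /\
  exists a b : nat -> quat,
    in_D r a /\ in_D r b /\
    (exists q, qball r q /\ psum a q <> zero) /\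
    forall q, dom f q -> dom (left_quotient r a b) q -> f q = left_quotient r a b q.

(* Main.v *)
Require Import Defs.
From Stdlib Require Import Reals ZArith Lra Lia ClassicalEpsilon FunctionalExtensionality List.
From Coquelicot Require Import Coquelicot.
Open Scope R_scope.

(** On a slice [R + J R] a regular function is a holomorphic function with values in
    the quaternions, seen as a complex vector space by left multiplication by [J].
    Everything below is done on slices with one-variable complex analysis, developed
    here from pointwise differentiability: Goursat's lemma for closed forms on a
    rectangle ([closed_form_boundary_integral]), Cauchy's formula by contracting a
    circle to a point ([cauchy_formula]), Taylor expansions ([taylor],
    [slice_taylor]), and the identity theorem on a disc minus a closed discrete set
    ([identity_theorem], [slice_identity]).

    From quotients to semiregular functions.  Near a point [p] of a slice the numerator
    of [f^{-*} * g] is bounded.  Its denominator, the symmetrization, has a nonzero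
    coefficient, so it does not vanish identically on the slice and is at least a
    constant times [|z - p|^k] near [p] ([quotient_polynomial_bound]).  Hence
    [(z - p)^(k+2) f] extends by 0 across [p] to a holomorphic function, whose Taylor
    series is a Laurent series of [f] with finitely many negative terms
    ([pole_of_polynomial_bound]).  The domain of [f] in the ball is connected since each
    slice is and all slices share real points ([domain_complement]).

    From semiregular functions to quotients.  Fix the slice of [i].  The poles it
    contains in a closed disc of radius [r1 > r] are finite in number, and a product
    [P] of factors [(z - c)(z - conj c)], with enough multiplicity, makes [P f] vanish
    to second order at each of them ([clear_poles]).  So [P f] extends to a holomorphic
    function on the disc, and is the sum of a power series with coefficients [b] in the
    disc of radius [r].  The coefficients of [P] are real: if [a] denotes them, the
    left quotient of [b] by [a] is [P^{-2} (P (P f))] at the real points.  The identity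
    theorem extends its equality with [f] to every slice ([regular_left_quotient]).  A real pole may be described on another slice than that
    of [i]; the identity theorem also transfers the corresponding growth bound
    ([pole_bounded_on_slice]). *)

(** * Goursat's lemma for differential forms on a rectangle *)

Lemma nested_intervals (x h : nat -> R) :
  (forall n, x n <= x (S n)) -> (forall n, x (S n) + h (S n) <= x n + h n) ->
  (forall n, 0 <= h n) -> exists l, forall n, x n <= l <= x n + h n.
Proof.
  intros Hx Hh H0.
  assert (mono : forall n k, x n <= x (n + k)%nat).
  { intros n k; induction k as [|k IH]; [rewrite Nat.add_0_r; lra|].
    rewrite Nat.add_succ_r; specialize (Hx (n + k)%nat); lra. }
  assert (anti : forall n k, x (n + k)%nat + h (n + k)%nat <= x n + h n).
  { intros n k; induction k as [|k IH]; [rewrite Nat.add_0_r; lra|].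
    rewrite Nat.add_succ_r; specialize (Hh (n + k)%nat); lra. }
  assert (cross : forall n m, x n <= x m + h m).
  { intros n m; destruct (Nat.le_ge_cases n m) as [Hl|Hl].
    - specialize (mono n (m - n)%nat); replace (n + (m - n))%nat with m in mono by lia.
      specialize (H0 m); lra.
    - specialize (anti m (n - m)%nat); replace (m + (n - m))%nat with n in anti by lia.
      specialize (H0 n); lra. }
  destruct (completeness (fun r => exists n, r = x n)) as [l [Hub Hlub]].
  - exists (x O + h O); intros r [n ->]; apply cross.
  - exists (x O), O; reflexivity.
  - exists l; intros n; split.
    + apply Hub; exists n; reflexivity.
    + apply Hlub; intros r [k ->]; apply cross.
Qed.

(** A Lebesgue-number style induction on squares: if a property is inherited from the
    four quarters of a square and fails on the whole, it fails on a nested sequence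
    of quarters, and hence near their common point.  It serves for Goursat's lemma,
    for propagating a property along a segment, and for the compactness argument
    that clears all poles of a disc at once. *)
Lemma bisection_principle (T : R -> R -> R -> Prop) (x0 y0 h0 : R) :
  0 < h0 ->
  (forall x y h, 0 < h -> T x y (h / 2) -> T (x + h / 2) y (h / 2) ->
     T x (y + h / 2) (h / 2) -> T (x + h / 2) (y + h / 2) (h / 2) -> T x y h) ->
  (forall x y, x0 <= x <= x0 + h0 -> y0 <= y <= y0 + h0 ->
     exists d, 0 < d /\ forall x' y' h, 0 < h < d ->
       x' <= x <= x' + h -> y' <= y <= y' + h -> T x' y' h) ->
  T x0 y0 h0.
Proof.
  intros Hh0 Hsplit Hloc.
  apply NNPP; intros HT.
  set (step := fun (p : R * R) (h : R) =>
    if excluded_middle_informative (T (fst p) (snd p) (h / 2)) then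
      if excluded_middle_informative (T (fst p + h / 2) (snd p) (h / 2)) then
        if excluded_middle_informative (T (fst p) (snd p + h / 2) (h / 2)) then
          (fst p + h / 2, snd p + h / 2)
        else (fst p, snd p + h / 2)
      else (fst p + h / 2, snd p)
    else p).
  assert (Hstep : forall p h, 0 < h -> ~ T (fst p) (snd p) h ->
    ~ T (fst (step p h)) (snd (step p h)) (h / 2) /\
    (fst p <= fst (step p h) <= fst p + h / 2) /\
    (snd p <= snd (step p h) <= snd p + h / 2)).
  { intros p h Hh Hn; unfold step.
    destruct (excluded_middle_informative (T (fst p) (snd p) (h / 2))) as [H1|H1];
      [|split; [exact H1|lra]].
    destruct (excluded_middle_informative (T (fst p + h / 2) (snd p) (h / 2))) as [H2|H2];
      [|split; [exact H2|simpl; lra]].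
    destruct (excluded_middle_informative (T (fst p) (snd p + h / 2) (h / 2))) as [H3|H3];
      [|split; [exact H3|simpl; lra]].
    split; [|simpl; lra]; simpl; intros H4; apply Hn, Hsplit; assumption. }
  set (s := fix s n := match n with O => (x0, y0) | S m => step (s m) (h0 / 2 ^ m) end).
  set (h := fun n => h0 / 2 ^ n).
  assert (Hpos : forall n, 0 < h n).
  { intros n; unfold h; apply Rdiv_lt_0_compat; [lra|apply pow_lt; lra]. }
  assert (HS : forall n, h (S n) = h n / 2).
  { intros n; unfold h; simpl; field; apply pow_nonzero; lra. }
  assert (Hs : forall n, ~ T (fst (s n)) (snd (s n)) (h n)).
  { induction n as [|n IH].
    - unfold h; simpl; replace (h0 / 1) with h0 by field; exact HT.
    - rewrite HS; exact (proj1 (Hstep (s n) (h n) (Hpos n) IH)). }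
  assert (Hm : forall n, (fst (s n) <= fst (s (S n)) <= fst (s n) + h n / 2) /\
                         (snd (s n) <= snd (s (S n)) <= snd (s n) + h n / 2)).
  { intros n; exact (proj2 (Hstep (s n) (h n) (Hpos n) (Hs n))). }
  destruct (nested_intervals (fun n => fst (s n)) h) as [x Hx].
  { intros n; apply Hm. }
  { intros n; rewrite HS; destruct (Hm n); lra. }
  { intros n; left; apply Hpos. }
  destruct (nested_intervals (fun n => snd (s n)) h) as [y Hy].
  { intros n; apply Hm. }
  { intros n; rewrite HS; destruct (Hm n); lra. }
  { intros n; left; apply Hpos. }
  assert (E0 : h O = h0) by (unfold h; simpl; field).
  destruct (Hloc x y) as [d [Hd Hd']].
  { rewrite <- E0; apply (Hx O). }
  { rewrite <- E0; apply (Hy O). }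
  assert (Hn : exists n, h n < d).
  { destruct (pow_lt_1_zero (/ 2)) with (y := d / h0) as [N HN].
    - rewrite Rabs_pos_eq; lra.
    - apply Rdiv_lt_0_compat; lra.
    - exists N; specialize (HN N (Nat.le_refl _)).
      rewrite Rabs_pos_eq in HN by (apply pow_le; lra).
      apply (Rmult_lt_compat_l h0) in HN; [|lra].
      replace (h0 * (d / h0)) with d in HN by (field; lra).
      unfold h, Rdiv; rewrite <- pow_inv; exact HN. }
  destruct Hn as [n Hn].
  apply (Hs n), Hd'; [split; [apply Hpos|exact Hn]|apply Hx|apply Hy].
Qed.

Lemma eq_of_arbitrarily_close (x y : R) : (forall eps, 0 < eps -> Rabs (x - y) <= eps) -> x = y.
Proof.
  intros H. apply cond_eq. intros eps Heps. specialize (H (eps / 2)). lra.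
Qed.

Lemma differentiable_pt_lim_continuous_l (P : R -> R -> R) x y lx ly :
  differentiable_pt_lim P x y lx ly -> continuous (fun s => P s y) x.
Proof.
  intros H.
  assert (C : continuity_2d_pt P x y).
  { apply differentiable_continuity_pt; exists lx, ly; exact H. }
  apply continuity_2d_pt_filterlim in C.
  apply (filterlim_comp _ _ _ (fun s => (s, y)) (fun z => P (fst z) (snd z)) _ (locally (x, y)));
    [|exact C].
  apply (continuous_comp_2 (fun s : R => s) (fun _ : R => y) (fun s t => (s, t))).
  - apply continuous_id.
  - apply continuous_const.
  - intros Q [e He]; exists e; intros [u v] Huv; exact (He (u, v) Huv).
Qed.

Lemma differentiable_pt_lim_continuous_r (P : R -> R -> R) x y lx ly :
  differentiable_pt_lim P x y lx ly -> continuous (fun t => P x t) y.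
Proof.
  intros H.
  assert (C : continuity_2d_pt P x y).
  { apply differentiable_continuity_pt; exists lx, ly; exact H. }
  apply continuity_2d_pt_filterlim in C.
  apply (filterlim_comp _ _ _ (fun t => (x, t)) (fun z => P (fst z) (snd z)) _ (locally (x, y)));
    [|exact C].
  apply (continuous_comp_2 (fun _ : R => x) (fun t : R => t) (fun s t => (s, t))).
  - apply continuous_const.
  - apply continuous_id.
  - intros Q [e He]; exists e; intros [u v] Huv; exact (He (u, v) Huv).
Qed.

Lemma abs_RInt_minus_const_le (f : R -> R) a b m M :
  a <= b -> ex_RInt f a b -> (forall t, a <= t <= b -> Rabs (f t - m) <= M) ->
  Rabs (RInt f a b - (b - a) * m) <= (b - a) * M.
Proof.
  intros Hab Hf HM.
  assert (Hc : ex_RInt (fun _ : R => m) a b) by apply ex_RInt_const.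
  replace (RInt f a b - (b - a) * m) with (RInt (fun t => f t - m) a b).
  - apply abs_RInt_le_const; [exact Hab| |exact HM].
    apply (ex_RInt_minus (V := R_NormedModule) f (fun _ => m)); assumption.
  - rewrite (RInt_minus (V := R_CompleteNormedModule) f (fun _ => m)); [|assumption..].
    rewrite RInt_const; reflexivity.
Qed.

Definition boundary_integral (P Q : R -> R -> R) a b c d :=
  RInt (fun s => P s c - P s d) a b + RInt (fun t => Q b t - Q a t) c d.

(** Goursat's argument for the form [P ds + Q dt]: no continuity of the partial
    derivatives is available, so Green's formula cannot be used.  The boundary
    integral is additive under subdivision, and near a point where [P] and [Q] are
    differentiable with equal cross derivatives the affine parts cancel, so it is
    [o(h^2)] on squares of side [h]; bisection turns this into a global bound. *)
Theorem closed_form_boundary_integral (P Q : R -> R -> R) (a b c d : R) :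
  a < b -> c < d ->
  (forall s t, a <= s <= b -> c <= t <= d -> exists px m qy,
     differentiable_pt_lim P s t px m /\ differentiable_pt_lim Q s t m qy) ->
  boundary_integral P Q a b c d = 0.
Proof.
  intros Hab Hcd HD.
  assert (iPP : forall t t' a' b', c <= t <= d -> c <= t' <= d ->
            a <= a' -> a' <= b' -> b' <= b -> ex_RInt (fun s => P s t - P s t') a' b').
  { intros; apply (ex_RInt_continuous (V := R_CompleteNormedModule)).
    intros z Hz; rewrite Rmin_left, Rmax_right in Hz by lra.
    destruct (HD z t) as (px & m & qy & h & _); [lra|lra|].
    destruct (HD z t') as (px' & m' & qy' & h' & _); [lra|lra|].
    apply (continuous_minus (V := R_NormedModule));
      eapply differentiable_pt_lim_continuous_l; eassumption. }
  assert (iQQ : forall s s' c' d', a <= s <= b -> a <= s' <= b ->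
            c <= c' -> c' <= d' -> d' <= d -> ex_RInt (fun t => Q s t - Q s' t) c' d').
  { intros; apply (ex_RInt_continuous (V := R_CompleteNormedModule)).
    intros z Hz; rewrite Rmin_left, Rmax_right in Hz by lra.
    destruct (HD s z) as (px & m & qy & _ & h); [lra|lra|].
    destruct (HD s' z) as (px' & m' & qy' & _ & h'); [lra|lra|].
    apply (continuous_minus (V := R_NormedModule));
      eapply differentiable_pt_lim_continuous_r; eassumption. }
  set (W := boundary_integral P Q).
  assert (splitx : forall a' m b' c' d', a <= a' -> a' <= m -> m <= b' -> b' <= b ->
     c <= c' -> c' <= d' -> d' <= d -> W a' b' c' d' = W a' m c' d' + W m b' c' d').
  { intros a' m b' c' d' *; intros; unfold W, boundary_integral.
    rewrite <- (RInt_Chasles (V := R_CompleteNormedModule) _ a' m b') by (apply iPP; lra).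
    rewrite (RInt_ext (fun t => Q b' t - Q a' t)
      (fun t => plus (Q m t - Q a' t) (Q b' t - Q m t)))
      by (intros; unfold plus; simpl; ring).
    rewrite (RInt_plus (V := R_CompleteNormedModule)) by (apply iQQ; lra).
    unfold plus; simpl; ring. }
  assert (splity : forall a' b' c' m d', a <= a' -> a' <= b' -> b' <= b ->
     c <= c' -> c' <= m -> m <= d' -> d' <= d -> W a' b' c' d' = W a' b' c' m + W a' b' m d').
  { intros a' b' c' m d' *; intros; unfold W, boundary_integral.
    rewrite <- (RInt_Chasles (V := R_CompleteNormedModule) _ c' m d') by (apply iQQ; lra).
    rewrite (RInt_ext (fun s => P s c' - P s d')
      (fun s => plus (P s c' - P s m) (P s m - P s d')))
      by (intros; unfold plus; simpl; ring).
    rewrite (RInt_plus (V := R_CompleteNormedModule)) by (apply iPP; lra).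
    unfold plus; simpl; ring. }
  set (A := b - a). set (B := d - c).
  assert (HA : 0 < A) by (unfold A; lra). assert (HB : 0 < B) by (unfold B; lra).
  assert (key : forall eps, 0 < eps -> Rabs (W a b c d) <= eps).
  { intros eps Heps.
    (* The rectangle is parametrized by the unit square, so that quarters stay similar to it. *)
    set (T := fun x y h => 0 <= x -> 0 <= y -> x + h <= 1 -> y + h <= 1 ->
      Rabs (W (a + x * A) (a + (x + h) * A) (c + y * B) (c + (y + h) * B)) <= eps * h ^ 2).
    assert (HT : T 0 0 1).
    { apply bisection_principle; [lra| |].
      - intros x y h Hh T1 T2 T3 T4 Hx Hy Hx' Hy'.
        assert (EA : b = a + 1 * A) by (unfold A; ring).
        assert (EB : d = c + 1 * B) by (unfold B; ring).
        rewrite (splitx _ (a + (x + h / 2) * A)) by (try rewrite EA; try rewrite EB; nra).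
        rewrite (splity (a + x * A) _ _ (c + (y + h / 2) * B))
          by (try rewrite EA; try rewrite EB; nra).
        rewrite (splity (a + (x + h / 2) * A) _ _ (c + (y + h / 2) * B))
          by (try rewrite EA; try rewrite EB; nra).
        specialize (T1 ltac:(lra) ltac:(lra) ltac:(lra) ltac:(lra)).
        specialize (T2 ltac:(lra) ltac:(lra) ltac:(lra) ltac:(lra)).
        specialize (T3 ltac:(lra) ltac:(lra) ltac:(lra) ltac:(lra)).
        specialize (T4 ltac:(lra) ltac:(lra) ltac:(lra) ltac:(lra)).
        replace (x + h / 2 + h / 2) with (x + h) in * by field.
        replace (y + h / 2 + h / 2) with (y + h) in * by field.
        replace (eps * h ^ 2) with (eps * (h / 2) ^ 2 + eps * (h / 2) ^ 2 +
          (eps * (h / 2) ^ 2 + eps * (h / 2) ^ 2)) by field.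
        eapply Rle_trans; [apply Rabs_triang|].
        apply Rplus_le_compat; (eapply Rle_trans; [apply Rabs_triang|]); lra.
      - intros x y Hx Hy.
        destruct (HD (a + x * A) (c + y * B)) as (px & m & qy & DP & DQ).
        { unfold A in *; nra. } { unfold B in *; nra. }
        (* Both sides contribute at most [2 e (A + B) h] per unit length, on a length of [(A + B) h]. *)
        set (e := eps / (4 * (A + B) ^ 2)).
        assert (He : 0 < e).
        { unfold e; apply Rdiv_lt_0_compat; [lra|]; nra. }
        destruct (DP (mkposreal e He)) as [d1 H1].
        destruct (DQ (mkposreal e He)) as [d2 H2]; simpl in H1, H2.
        assert (Hdd : 0 < Rmin d1 d2) by (apply Rmin_pos; [apply d1|apply d2]).
        exists (Rmin d1 d2 / (A + B)); split; [apply Rdiv_lt_0_compat; lra|].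
        intros x' y' h [Hh Hh'] Hx' Hy' G1 G2 G3 G4.
        assert (Hsm : h * (A + B) < Rmin d1 d2).
        { apply (Rmult_lt_compat_r (A + B)) in Hh'; [|lra].
          unfold Rdiv in Hh'; rewrite Rmult_assoc, Rinv_l, Rmult_1_r in Hh' by lra; exact Hh'. }
        assert (Hd1 := Rmin_l d1 d2). assert (Hd2 := Rmin_r d1 d2).
        set (u := a + x * A) in *. set (v := c + y * B) in *.
        set (a1 := a + x' * A). set (b1 := a + (x' + h) * A).
        set (c1 := c + y' * B). set (e1 := c + (y' + h) * B).
        assert (near : forall s t, a1 <= s <= b1 -> c1 <= t <= e1 ->
          Rabs (P s t - P u v - (px * (s - u) + m * (t - v))) <= e * (h * (A + B)) /\
          Rabs (Q s t - Q u v - (m * (s - u) + qy * (t - v))) <= e * (h * (A + B))).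
        { intros s t Hs Ht.
          assert (Hs' : Rabs (s - u) <= h * A).
          { apply Rabs_le; unfold a1, b1, u in *; nra. }
          assert (Ht' : Rabs (t - v) <= h * B).
          { apply Rabs_le; unfold c1, e1, v in *; nra. }
          assert (Hm : Rmax (Rabs (s - u)) (Rabs (t - v)) <= h * (A + B)).
          { apply Rmax_lub; nra. }
          assert (Hs2 : Rabs (s - u) < Rmin d1 d2) by nra.
          assert (Ht2 : Rabs (t - v) < Rmin d1 d2) by nra.
          split.
          - eapply Rle_trans; [apply H1; lra|]. apply Rmult_le_compat_l; lra.
          - eapply Rle_trans; [apply H2; lra|]. apply Rmult_le_compat_l; lra. }
        assert (ab1 : a <= a1 /\ a1 <= b1 /\ b1 <= b).
        { unfold a1, b1, A in *; repeat split; nra. }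
        assert (ce1 : c <= c1 /\ c1 <= e1 /\ e1 <= d).
        { unfold c1, e1, B in *; repeat split; nra. }
        unfold W, boundary_integral.
        assert (I1 := abs_RInt_minus_const_le (fun s => P s c1 - P s e1) a1 b1
          (m * (c1 - e1)) (2 * (e * (h * (A + B))))).
        assert (I2 := abs_RInt_minus_const_le (fun t => Q b1 t - Q a1 t) c1 e1
          (m * (b1 - a1)) (2 * (e * (h * (A + B))))).
        specialize (I1 ltac:(lra) ltac:(apply iPP; lra)).
        specialize (I2 ltac:(lra) ltac:(apply iQQ; lra)).
        assert (I1' : Rabs (RInt (fun s => P s c1 - P s e1) a1 b1 - (b1 - a1) * (m * (c1 - e1))) <= (b1 - a1) * (2 * (e * (h * (A + B))))).
        { apply I1; intros s Hs.
          destruct (near s c1) as [N1 _]; [lra|lra|].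
          destruct (near s e1) as [N2 _]; [lra|lra|].
          apply Rabs_le_between in N1; apply Rabs_le_between in N2; apply Rabs_le; split; lra. }
        assert (I2' : Rabs (RInt (fun t => Q b1 t - Q a1 t) c1 e1 - (e1 - c1) * (m * (b1 - a1))) <= (e1 - c1) * (2 * (e * (h * (A + B))))).
        { apply I2; intros t Ht.
          destruct (near a1 t) as [_ N1]; [lra|lra|].
          destruct (near b1 t) as [_ N2]; [lra|lra|].
          apply Rabs_le_between in N1; apply Rabs_le_between in N2; apply Rabs_le; split; lra. }
        assert (Eab : b1 - a1 = h * A) by (unfold a1, b1; ring).
        assert (Ece : e1 - c1 = h * B) by (unfold c1, e1; ring).
        set (J1 := RInt _ a1 b1) in *. set (J2 := RInt _ c1 e1) in *.
        replace (J1 + J2) with ((J1 - (b1 - a1) * (m * (c1 - e1))) + (J2 - (e1 - c1) * (m * (b1 - a1)))) by ring.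
        eapply Rle_trans; [apply Rabs_triang|].
        eapply Rle_trans; [apply Rplus_le_compat; eassumption|].
        rewrite Eab, Ece.
        replace (h * A * (2 * (e * (h * (A + B)))) + h * B * (2 * (e * (h * (A + B)))))
          with (2 * (e * (A + B) ^ 2) * h ^ 2) by ring.
        replace (e * (A + B) ^ 2) with (eps / 4) by (unfold e; field; lra).
        assert (0 < h ^ 2) by (apply pow_lt; lra). nra. }
    specialize (HT ltac:(lra) ltac:(lra) ltac:(lra) ltac:(lra)).
    replace (a + 0 * A) with a in HT by ring.
    replace (a + (0 + 1) * A) with b in HT by (unfold A; ring).
    replace (c + 0 * B) with c in HT by ring.
    replace (c + (0 + 1) * B) with d in HT by (unfold B; ring).
    lra. }
  fold W. apply eq_of_arbitrarily_close. intros eps Heps. rewrite Rminus_0_r. apply key, Heps.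
Qed.

(** * Complex differentiability and Cauchy's formula on a circle *)

Ltac change_eq_R := match goal with |- ?x = ?y => change (@eq R x y) end.

Ltac pose_Rmin :=
  repeat match goal with
  | H : context [Rmin ?a ?b] |- _ =>
      lazymatch goal with
      | _ : Rmin a b <= a |- _ => fail
      | _ => pose proof (Rmin_l a b); pose proof (Rmin_r a b)
      end
  end.

(** Pointwise complex differentiability with explicit remainder: regular functions are
    differentiable, but not assumed to be of class [C^1]. *)
Definition is_cderiv (phi : C -> C) (w d : C) : Prop :=
  forall eps, 0 < eps -> exists del, 0 < del /\
    forall z : C, Cmod (z - w) < del ->
      Cmod (phi z - phi w - d * (z - w)) <= eps * Cmod (z - w).

Definition hol (phi : C -> C) (w : C) : Prop := exists d, is_cderiv phi w d.

Lemma Re_Cmult (a b : C) : Re (a * b) = Re a * Re b - Im a * Im b.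
Proof. reflexivity. Qed.

Lemma Im_Cmult (a b : C) : Im (a * b) = Re a * Im b + Im a * Re b.
Proof. reflexivity. Qed.

Lemma Im_le_Cmod (c : C) : Rabs (Im c) <= Cmod c.
Proof. eapply Rle_trans; [apply Rmax_r|apply Rmax_Cmod]. Qed.

Lemma Cmod_le_Re_Im (c : C) : Cmod c <= Rabs (Re c) + Rabs (Im c).
Proof.
  destruct c as [a b]; replace ((a, b) : C) with (RtoC a + RtoC b * Ci)%C.
  - eapply Rle_trans; [apply Cmod_triangle|].
    rewrite Cmod_mult, Cmod_Ci, !Cmod_R; simpl.
    replace (a + (b * 0 - 0 * 1)) with a by ring.
    replace (0 + (b * 1 + 0 * 0)) with b by ring. lra.
  - unfold RtoC, Ci, Cplus, Cmult; simpl; f_equal; ring.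
Qed.

Lemma Cmod_minus_sym (a b : C) : Cmod (a - b) = Cmod (b - a).
Proof. replace (a - b)%C with (- (b - a))%C by ring; apply Cmod_opp. Qed.

Lemma Cmod_minus_self (a : C) : Cmod (a - a) = 0.
Proof. replace (a - a)%C with (RtoC 0) by ring; apply Cmod_0. Qed.

Lemma Cmod_minus_pos (a b : C) : a <> b -> 0 < Cmod (a - b).
Proof.
  intros H; apply Cmod_gt_0; intros E; apply H.
  replace a with (a - b + b)%C by ring; rewrite E; ring.
Qed.

Lemma Cmod_triangle_minus (a b c : C) : Cmod (a - c) <= Cmod (a - b) + Cmod (b - c).
Proof. replace (a - c)%C with ((a - b) + (b - c))%C by ring; apply Cmod_triangle. Qed.

Lemma Cmod_minus_ge (a b : C) : Cmod a - Cmod b <= Cmod (a - b).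
Proof.
  assert (H := Cmod_triangle (a - b) b).
  replace (a - b + b)%C with a in H by ring. lra.
Qed.

Lemma is_cderiv_lipschitz phi w d : is_cderiv phi w d ->
  exists K del, 0 < K /\ 0 < del /\ forall z, Cmod (z - w) < del ->
    Cmod (phi z - phi w) <= K * Cmod (z - w).
Proof.
  intros H. destruct (H 1 Rlt_0_1) as (del & Hdel & Hz).
  assert (Hd := Cmod_ge_0 d).
  exists (1 + Cmod d), del; repeat split; [lra|exact Hdel|]. intros z Hzw.
  specialize (Hz z Hzw).
  replace (phi z - phi w)%C with ((phi z - phi w - d * (z - w)) + d * (z - w))%C by ring.
  eapply Rle_trans; [apply Cmod_triangle|]. rewrite Cmod_mult. lra.
Qed.

Lemma is_cderiv_continuous phi w d : is_cderiv phi w d ->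
  forall eps, 0 < eps -> exists del, 0 < del /\
    forall z, Cmod (z - w) < del -> Cmod (phi z - phi w) < eps.
Proof.
  intros H eps Heps. destruct (is_cderiv_lipschitz phi w d H) as (K & del & HK & Hdel & L).
  exists (Rmin del (eps / K)); split.
  { apply Rmin_pos; [exact Hdel|apply Rdiv_lt_0_compat; lra]. }
  intros z Hz. pose_Rmin.
  eapply Rle_lt_trans; [apply L; lra|].
  replace eps with (K * (eps / K)) by (field; lra). apply Rmult_lt_compat_l; lra.
Qed.

Lemma is_cderiv_scal phi w d c : is_cderiv phi w d -> is_cderiv (fun z => c * phi z)%C w (c * d)%C.
Proof.
  intros H eps Heps.
  assert (Hc := Cmod_ge_0 c).
  destruct (H (eps / (1 + Cmod c))) as (del & Hdel & Hz).
  { apply Rdiv_lt_0_compat; lra. }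
  exists del; split; [exact Hdel|]; intros z Hzw; specialize (Hz z Hzw).
  replace (c * phi z - c * phi w - c * d * (z - w))%C
    with (c * (phi z - phi w - d * (z - w)))%C by ring.
  rewrite Cmod_mult.
  replace (eps * Cmod (z - w)) with ((1 + Cmod c) * (eps / (1 + Cmod c) * Cmod (z - w)))
    by (field; lra).
  assert (H0 := Cmod_ge_0 (phi z - phi w - d * (z - w))).
  nra.
Qed.

Lemma hol_scal phi w c : hol phi w -> hol (fun z => c * phi z)%C w.
Proof. intros [d Hd]; eexists; apply is_cderiv_scal; exact Hd. Qed.

Lemma is_cderiv_differentiable_Re phi w d : is_cderiv phi w d ->
  differentiable_pt_lim (fun x y => Re (phi (x, y))) (Re w) (Im w) (Re d) (- Im d).
Proof.
  intros H eps.
  destruct (H (eps / 2)) as (del & Hdel & Hz); [apply is_pos_div_2|].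
  assert (Hd2 : 0 < del / 2) by lra.
  exists (mkposreal _ Hd2); simpl; intros u v Hu Hv.
  assert (M := Cmod_le_Re_Im ((u, v) - w)).
  assert (Hre : Re ((u, v) - w) = u - Re w) by reflexivity.
  assert (Him : Im ((u, v) - w) = v - Im w) by reflexivity.
  rewrite Hre, Him in M.
  specialize (Hz (u, v) ltac:(lra)).
  eapply Rle_trans; [|eapply Rle_trans; [eapply Rle_trans; [apply re_le_Cmod|exact Hz]|]].
  - right; f_equal; destruct w, d; simpl; unfold Re; simpl; ring.
  - assert (X1 := Rmax_l (Rabs (u - Re w)) (Rabs (v - Im w))).
    assert (X2 := Rmax_r (Rabs (u - Re w)) (Rabs (v - Im w))).
    assert (He := cond_pos eps). nra.
Qed.

Lemma is_cderiv_differentiable_Im phi w d : is_cderiv phi w d ->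
  differentiable_pt_lim (fun x y => Im (phi (x, y))) (Re w) (Im w) (Im d) (Re d).
Proof.
  intros H. apply (is_cderiv_scal _ _ _ (- Ci)%C), is_cderiv_differentiable_Re in H.
  destruct d as [d1 d2].
  replace (Re (- Ci * (d1, d2))) with (Im (d1, d2)) in H by (simpl; ring).
  replace (- Im (- Ci * (d1, d2))) with (Re (d1, d2)) in H by (simpl; ring).
  revert H; apply differentiable_pt_lim_ext.
  exists (mkposreal 1 Rlt_0_1); intros u v _ _; simpl; unfold Im; ring.
Qed.

Lemma differentiable_pt_lim_mult_id x y :
  differentiable_pt_lim (fun u v => u * v) x y y x.
Proof.
  intros eps; exists eps; intros u v Hu Hv.
  replace (u * v - x * y - (y * (u - x) + x * (v - y))) with ((u - x) * (v - y)) by ring.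
  rewrite Rabs_mult. apply Rmult_le_compat; try apply Rabs_pos; [lra|apply Rmax_r].
Qed.

Lemma differentiable_pt_lim_mult f g x y fx fy gx gy :
  differentiable_pt_lim f x y fx fy -> differentiable_pt_lim g x y gx gy ->
  differentiable_pt_lim (fun u v => f u v * g u v) x y
    (g x y * fx + f x y * gx) (g x y * fy + f x y * gy).
Proof.
  intros Hf Hg.
  exact (differentiable_pt_lim_comp (fun u v => u * v) f g x y _ _ _ _ _ _
           (differentiable_pt_lim_mult_id _ _) Hf Hg).
Qed.

Lemma differentiable_pt_lim_affine a b x y :
  differentiable_pt_lim (fun u v => a * u + b * v) x y a b.
Proof.
  intros eps; exists eps; intros u v Hu Hv.
  replace (a * u + b * v - (a * x + b * y) - (a * (u - x) + b * (v - y))) with 0 by ring.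
  rewrite Rabs_R0; apply Rmult_le_pos; [left; apply eps|].
  eapply Rle_trans; [apply Rabs_pos|apply Rmax_l].
Qed.

Lemma differentiable_pt_lim_lin f g a b x y fx fy gx gy :
  differentiable_pt_lim f x y fx fy -> differentiable_pt_lim g x y gx gy ->
  differentiable_pt_lim (fun u v => a * f u v + b * g u v) x y
    (a * fx + b * gx) (a * fy + b * gy).
Proof.
  intros Hf Hg.
  exact (differentiable_pt_lim_comp (fun u v => a * u + b * v) f g x y _ _ _ _ _ _
           (differentiable_pt_lim_affine _ _ _ _) Hf Hg).
Qed.

Lemma differentiable_pt_lim_snd (f : R -> R) x y l :
  derivable_pt_lim f y l -> differentiable_pt_lim (fun _ v => f v) x y 0 l.
Proof.
  intros H eps.
  destruct (differentiable_pt_lim_proj1_0 f y x l H eps) as [d Hd].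
  exists d; intros u v Hu Hv. specialize (Hd v u Hv Hu).
  rewrite Rmax_comm. eapply Rle_trans; [|exact Hd]. right; f_equal; ring.
Qed.

Lemma differentiable_pt_lim_homothety (g : R -> R) c l t g' : derivable_pt_lim g t g' ->
  differentiable_pt_lim (fun u v => c + u * (g v - c)) l t (g t - c) (l * g').
Proof.
  intros Hg.
  apply (differentiable_pt_lim_ext (fun u v => 1 * (u * (g v - c)) + 1 * c)).
  { exists (mkposreal 1 Rlt_0_1); intros; ring. }
  replace (g t - c) with (1 * ((g t - c) * 1 + l * 0) + 1 * 0) at 1 by ring.
  replace (l * g') with (1 * ((g t - c) * 0 + l * g') + 1 * 0) by ring.
  apply (differentiable_pt_lim_lin (fun u v => u * (g v - c)) (fun _ _ => c)).
  - apply (differentiable_pt_lim_mult (fun u _ => u) (fun _ v => g v - c)).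
    + apply (differentiable_pt_lim_proj1_0 (fun u => u)), derivable_pt_lim_id.
    + apply differentiable_pt_lim_snd. rewrite <- (Rminus_0_r g').
      apply derivable_pt_lim_minus; [exact Hg|apply derivable_pt_lim_const].
  - apply (differentiable_pt_lim_proj1_0 (fun _ => c)), derivable_pt_lim_const.
Qed.

Definition cis (t : R) : C := (cos t, sin t).

Lemma Cmod_cis t : Cmod (cis t) = 1.
Proof.
  assert (H := Cmod_ge_0 (cis t)). assert (H2 := Cmod2_alt (cis t)).
  assert (H3 := sin2_cos2 t). unfold Rsqr in H3. simpl in H2.
  assert (Cmod (cis t) * Cmod (cis t) = 1) by lra. nra.
Qed.

Lemma homotopy_inside (r eps : R) (z : C) t : 0 <= eps <= 1 -> 0 < r -> Cmod z < r ->
  Cmod (z + eps * (r * cis t - z)) <= r.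
Proof.
  intros He Hr Hz.
  replace (z + eps * (r * cis t - z))%C with (RtoC (1 - eps) * z + RtoC eps * (r * cis t))%C
    by (rewrite RtoC_minus; ring).
  eapply Rle_trans; [apply Cmod_triangle|].
  rewrite !Cmod_mult, Cmod_cis, !Cmod_R, !Rabs_pos_eq by lra.
  assert (H0 := Cmod_ge_0 z). nra.
Qed.

(** The circle of radius [r] about 0 is contracted towards [z] by
    [G l t = z + l (r e^(it) - z)].  With [k = r e^(it) / (r e^(it) - z)] the real
    part of [phi(G) (k dt - i dl / l)] is a form whose cross derivatives agree, both
    being the real part of [phi'(G) r e^(it)]; its integral over the sides [t = 0]
    and [t = 2 pi] cancels by periodicity.  Goursat's lemma is applied on
    [eps <= l <= 1], away from the singularity at [l = 0]. *)
Lemma circle_homotopy (phi : C -> C) (rho r : R) (z : C) (k : R -> C) (eps : R) :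
  (forall w, Cmod w < rho -> hol phi w) -> 0 < r < rho -> Cmod z < r ->
  (forall t, (k t * (r * cis t - z) = r * cis t)%C) ->
  (forall t, ex_derive (fun s => Re (k s)) t /\ ex_derive (fun s => Im (k s)) t) ->
  0 < eps < 1 ->
  RInt (fun t => Re (phi (r * cis t)%C * k t)%C) 0 (2 * PI) =
  RInt (fun t => Re (phi (z + eps * (r * cis t - z))%C * k t)%C) 0 (2 * PI).
Proof.
  intros Hphi Hr Hz Hk Hdk Heps.
  set (G1 := fun l t => Re z + l * (r * cos t - Re z)).
  set (G2 := fun l t => Im z + l * (r * sin t - Im z)).
  assert (HG : forall l t : R, ((z + l * (r * cis t - z))%C = (G1 l t, G2 l t))).
  { intros l t; destruct z as [z1 z2]; unfold G1, G2, cis; simpl.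
    unfold RtoC, Cplus, Cminus, Cmult, Copp, Re, Im; simpl; f_equal; ring. }
  set (P := fun l t => Im (phi (G1 l t, G2 l t)) * / l).
  set (Q := fun l t => 1 * (Re (phi (G1 l t, G2 l t)) * Re (k t))
                       + (-1) * (Im (phi (G1 l t, G2 l t)) * Im (k t))).
  assert (DD : forall l t, eps <= l <= 1 -> exists px m qy,
     differentiable_pt_lim P l t px m /\ differentiable_pt_lim Q l t m qy).
  { intros l t Hl.
    assert (Hin : Cmod (G1 l t, G2 l t) < rho).
    { rewrite <- HG. assert (H0 := homotopy_inside r l z t ltac:(lra) (proj1 Hr) Hz). lra. }
    destruct (Hphi _ Hin) as [d Hd].
    assert (DR := is_cderiv_differentiable_Re _ _ _ Hd).
    assert (DI := is_cderiv_differentiable_Im _ _ _ Hd).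
    cbn [Re Im fst snd] in DR, DI.
    destruct (Hdk t) as [[k1 Hk1] [k2 Hk2]].
    apply is_derive_Reals in Hk1. apply is_derive_Reals in Hk2.
    assert (D1 : differentiable_pt_lim G1 l t (r * cos t - Re z) (l * - (r * sin t))).
    { apply (differentiable_pt_lim_homothety (fun v => r * cos v)), is_derive_Reals.
      auto_derive; [exact I|ring]. }
    assert (D2 : differentiable_pt_lim G2 l t (r * sin t - Im z) (l * (r * cos t))).
    { apply (differentiable_pt_lim_homothety (fun v => r * sin v)), is_derive_Reals.
      auto_derive; [exact I|ring]. }
    assert (CR := differentiable_pt_lim_comp _ _ _ _ _ _ _ _ _ _ _ DR D1 D2).
    assert (CI := differentiable_pt_lim_comp _ _ _ _ _ _ _ _ _ _ _ DI D1 D2).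
    cbv beta in CR, CI.
    assert (Dinv : differentiable_pt_lim (fun u _ => / u) l t (- / (l * l)) 0).
    { apply (differentiable_pt_lim_proj1_0 (fun u => / u)), is_derive_Reals.
      auto_derive; [lra|field; lra]. }
    assert (DP := differentiable_pt_lim_mult _ _ _ _ _ _ _ _ CI Dinv).
    assert (DQ := differentiable_pt_lim_lin _ _ 1 (-1) _ _ _ _ _ _
      (differentiable_pt_lim_mult _ _ _ _ _ _ _ _ CR (differentiable_pt_lim_snd _ l _ _ Hk1))
      (differentiable_pt_lim_mult _ _ _ _ _ _ _ _ CI (differentiable_pt_lim_snd _ l _ _ Hk2))).
    cbv beta in DP, DQ.
    eexists _, _, _; split; [exact DP|].
    match type of DQ with differentiable_pt_lim _ _ _ ?a _ =>
      match goal with |- differentiable_pt_lim _ _ _ ?b _ => replace b with a; [exact DQ|] end end.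
    specialize (Hk t). destruct z as [z1 z2]. destruct (k t) as [K1 K2].
    destruct d as [e1 e2].
    unfold cis, RtoC, Cplus, Cminus, Cmult, Copp, Re, Im in *; simpl in *.
    injection Hk; intros E2 E1.
    transitivity (e1 * (r * cos t) - e2 * (r * sin t)); [|field; lra].
    match type of E1 with ?A1 = _ => match type of E2 with ?A2 = _ =>
      transitivity (e1 * A1 - e2 * A2); [|rewrite E1, E2; ring] end end.
    ring. }
  assert (HB : boundary_integral P Q eps 1 0 (2 * PI) = 0).
  { apply closed_form_boundary_integral; [lra|assert (H := PI_RGT_0); lra|].
    intros l t Hl _; apply DD, Hl. }
  unfold boundary_integral in HB.
  rewrite (RInt_ext _ (fun _ => 0)) in HB.
  2:{ intros s _; unfold P, G1, G2. rewrite cos_2PI, sin_2PI, cos_0, sin_0. change_eq_R. ring. }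
  rewrite RInt_const in HB. unfold scal in HB; simpl in HB; unfold mult in HB; simpl in HB.
  assert (cont : forall l, eps <= l <= 1 -> forall t, continuous (fun t => Q l t) t).
  { intros l Hl t. destruct (DD l t Hl) as (px & m & qy & _ & DQ).
    exact (differentiable_pt_lim_continuous_r Q l t _ _ DQ). }
  assert (HRR : RInt (fun t => Q 1 t) 0 (2 * PI) = RInt (fun t => Q eps t) 0 (2 * PI)).
  { rewrite (RInt_minus (V := R_CompleteNormedModule) (fun t => Q 1 t) (fun t => Q eps t)) in HB.
    - unfold minus, plus, opp in HB; simpl in HB; lra.
    - apply (ex_RInt_continuous (V := R_CompleteNormedModule)); intros; apply cont; lra.
    - apply (ex_RInt_continuous (V := R_CompleteNormedModule)); intros; apply cont; lra. }
  rewrite (RInt_ext (fun t => Re (phi (r * cis t)%C * k t)%C) (fun t => Q 1 t)).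
  2:{ intros t _; unfold Q. rewrite <- HG.
      replace (z + 1 * (r * cis t - z))%C with (r * cis t)%C by ring.
      rewrite Re_Cmult; change_eq_R; ring. }
  rewrite HRR. apply RInt_ext; intros t _. unfold Q; rewrite <- HG.
  rewrite Re_Cmult; change_eq_R; ring.
Qed.

Definition ccont (f : R -> C) : Prop :=
  forall t, continuous (fun s => Re (f s)) t /\ continuous (fun s => Im (f s)) t.

(** The integral over [0, 2 pi], taken on real and imaginary parts separately so that
    only real Riemann integrals are involved. *)
Definition circle_int (f : R -> C) : C :=
  (RInt (fun t => Re (f t)) 0 (2 * PI), RInt (fun t => Im (f t)) 0 (2 * PI)).

Lemma ccont_const c : ccont (fun _ => c).
Proof. intros t; split; apply continuous_const. Qed.

Lemma ccont_plus f g : ccont f -> ccont g -> ccont (fun t => f t + g t)%C.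
Proof.
  intros Hf Hg t; destruct (Hf t), (Hg t); split;
    apply (continuous_plus (V := R_NormedModule)); assumption.
Qed.

Lemma ccont_mult f g : ccont f -> ccont g -> ccont (fun t => f t * g t)%C.
Proof.
  intros Hf Hg t; destruct (Hf t), (Hg t); split.
  - apply (continuous_minus (V := R_NormedModule)
      (fun t => Re (f t) * Re (g t)) (fun t => Im (f t) * Im (g t)));
      apply (continuous_mult (K := R_AbsRing)); assumption.
  - apply (continuous_plus (V := R_NormedModule)
      (fun t => Re (f t) * Im (g t)) (fun t => Im (f t) * Re (g t)));
      apply (continuous_mult (K := R_AbsRing)); assumption.
Qed.

Lemma ccont_pow f n : ccont f -> ccont (fun t => f t ^ n)%C.
Proof.
  intros Hf; induction n as [|n IH]; simpl; [apply ccont_const|].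
  apply ccont_mult; assumption.
Qed.

Lemma ccont_cis : ccont cis.
Proof.
  intros t; split; apply (ex_derive_continuous (V := R_NormedModule)); unfold cis; simpl;
    auto_derive; exact I.
Qed.

Lemma ccont_comp (phi : C -> C) f :
  ccont f -> (forall t, hol phi (f t)) -> ccont (fun t => phi (f t)).
Proof.
  intros Hf Hphi t.
  destruct (Hphi t) as [d Hd].
  assert (K : forall eps : posreal, locally t (fun s => Cmod (phi (f s) - phi (f t)) < eps)).
  { intros eps.
    destruct (is_cderiv_continuous _ _ _ Hd eps (cond_pos eps)) as (del & Hdel & Hz).
    destruct (Hf t) as [H1 H2].
    assert (Hd2 : 0 < del / 2) by lra.
    generalize (filter_and _ _
      (proj1 (filterlim_locally _ _) H1 (mkposreal _ Hd2))
      (proj1 (filterlim_locally _ _) H2 (mkposreal _ Hd2))).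
    apply filter_imp; intros s [B1 B2]; apply Hz.
    eapply Rle_lt_trans; [apply Cmod_le_Re_Im|].
    unfold ball in B1, B2; simpl in B1, B2; unfold AbsRing_ball, abs, minus, plus, opp in B1, B2;
      simpl in B1, B2.
    unfold Cminus, Cplus, Copp; cbn [Re Im fst snd]; unfold Re, Im in *; simpl. lra. }
  split; apply filterlim_locally; intros eps; generalize (K eps); apply filter_imp; intros s Hs;
    unfold ball; simpl; unfold AbsRing_ball, abs, minus, plus, opp; simpl.
  - eapply Rle_lt_trans; [|exact Hs]; apply (re_le_Cmod (phi (f s) - phi (f t))).
  - eapply Rle_lt_trans; [|exact Hs]; apply (Im_le_Cmod (phi (f s) - phi (f t))).
Qed.

Lemma ex_RInt_Re f a b : ccont f -> ex_RInt (fun t => Re (f t)) a b.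
Proof.
  intros H; apply (ex_RInt_continuous (V := R_CompleteNormedModule)); intros t _; apply H.
Qed.

Lemma ex_RInt_Im f a b : ccont f -> ex_RInt (fun t => Im (f t)) a b.
Proof.
  intros H; apply (ex_RInt_continuous (V := R_CompleteNormedModule)); intros t _; apply H.
Qed.

Lemma circle_int_ext f g : (forall t, f t = g t) -> circle_int f = circle_int g.
Proof.
  intros H; unfold circle_int; f_equal; apply RInt_ext; intros; rewrite H; reflexivity.
Qed.

Lemma circle_int_plus f g : ccont f -> ccont g -> circle_int (fun t => f t + g t)%C = (circle_int f + circle_int g)%C.
Proof.
  intros Hf Hg; unfold circle_int, Cplus; simpl; f_equal.
  - apply (RInt_plus (V := R_CompleteNormedModule) (fun t => Re (f t)) (fun t => Re (g t)));
      apply ex_RInt_Re; assumption.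
  - apply (RInt_plus (V := R_CompleteNormedModule) (fun t => Im (f t)) (fun t => Im (g t)));
      apply ex_RInt_Im; assumption.
Qed.

Lemma RInt_lincomb (u v : R -> R) a b x y : ex_RInt u a b -> ex_RInt v a b ->
  RInt (fun t => x * u t + y * v t) a b = x * RInt u a b + y * RInt v a b.
Proof.
  intros Hu Hv.
  rewrite (RInt_plus (V := R_CompleteNormedModule) (fun t => x * u t) (fun t => y * v t)).
  - apply f_equal2; [exact (RInt_scal (V := R_CompleteNormedModule) u a b x Hu)|].
    exact (RInt_scal (V := R_CompleteNormedModule) v a b y Hv).
  - apply (ex_RInt_scal (V := R_NormedModule)); exact Hu.
  - apply (ex_RInt_scal (V := R_NormedModule)); exact Hv.
Qed.

Lemma circle_int_scal c f : ccont f -> circle_int (fun t => c * f t)%C = (c * circle_int f)%C.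
Proof.
  intros Hf; unfold circle_int, Cmult at 3; cbn [fst snd]; f_equal.
  - rewrite (RInt_ext _ (fun t => fst c * Re (f t) + (- snd c) * Im (f t))).
    + rewrite RInt_lincomb; [change_eq_R; ring|apply ex_RInt_Re|apply ex_RInt_Im]; assumption.
    + intros t _; rewrite Re_Cmult; unfold Re, Im; change_eq_R; ring.
  - rewrite (RInt_ext _ (fun t => snd c * Re (f t) + fst c * Im (f t))).
    + rewrite RInt_lincomb; [change_eq_R; ring|apply ex_RInt_Re|apply ex_RInt_Im]; assumption.
    + intros t _; rewrite Im_Cmult; unfold Re, Im; change_eq_R; ring.
Qed.

Lemma circle_int_bound f M : ccont f -> (forall t, 0 <= t <= 2 * PI -> Cmod (f t) <= M) ->
  Cmod (circle_int f) <= 4 * PI * M.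
Proof.
  intros Hf HM. assert (HP := PI_RGT_0).
  eapply Rle_trans; [apply Cmod_le_Re_Im|].
  assert (A1 : Rabs (RInt (fun t => Re (f t)) 0 (2 * PI)) <= (2 * PI - 0) * M).
  { apply abs_RInt_le_const; [lra|apply ex_RInt_Re; exact Hf|].
    intros t Ht; eapply Rle_trans; [apply re_le_Cmod|apply HM, Ht]. }
  assert (A2 : Rabs (RInt (fun t => Im (f t)) 0 (2 * PI)) <= (2 * PI - 0) * M).
  { apply abs_RInt_le_const; [lra|apply ex_RInt_Im; exact Hf|].
    intros t Ht; eapply Rle_trans; [apply Im_le_Cmod|apply HM, Ht]. }
  unfold circle_int; simpl. lra.
Qed.

Definition cauchy_kernel (r : R) (z : C) (t : R) : C := (r * cis t / (r * cis t - z))%C.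

Lemma circle_minus_ge r z t : 0 < r -> r - Cmod z <= Cmod (r * cis t - z).
Proof.
  intros Hr; assert (H := Cmod_minus_ge (r * cis t) z).
  rewrite Cmod_mult, Cmod_cis, Cmod_R, Rabs_pos_eq in H by lra. lra.
Qed.

Lemma circle_minus_neq r z t : 0 < r -> Cmod z < r -> (r * cis t - z)%C <> 0%C.
Proof.
  intros Hr Hz E; assert (H := circle_minus_ge r z t Hr). rewrite E, Cmod_0 in H. lra.
Qed.

Lemma cauchy_kernel_bound r z t : 0 < r -> Cmod z < r ->
  Cmod (cauchy_kernel r z t) <= r / (r - Cmod z).
Proof.
  intros Hr Hz; unfold cauchy_kernel.
  rewrite Cmod_div by (apply circle_minus_neq; assumption).
  rewrite Cmod_mult, Cmod_cis, Cmod_R, Rabs_pos_eq, Rmult_1_r by lra.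
  apply Rmult_le_compat_l; [lra|].
  apply Rinv_le_contravar; [lra|apply circle_minus_ge; exact Hr].
Qed.

Lemma cauchy_kernel_ex_derive r z t : 0 < r -> Cmod z < r ->
  ex_derive (fun s => Re (cauchy_kernel r z s)) t /\
  ex_derive (fun s => Im (cauchy_kernel r z s)) t.
Proof.
  intros Hr Hz.
  assert (Hn : (r * cos t - Re z) * (r * cos t - Re z)
               + (r * sin t - Im z) * (r * sin t - Im z) <> 0).
  { intros E. apply (circle_minus_neq r z t Hr Hz).
    destruct z as [z1 z2]; cbn [Re Im fst snd] in E.
    destruct (Rplus_sqr_eq_0 _ _ E) as [E1 E2].
    unfold cis; apply injective_projections; simpl; lra. }
  set (D := fun s => (r * cos s - Re z) * (r * cos s - Re z)
                     + (r * sin s - Im z) * (r * sin s - Im z)) in *.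
  split.
  - apply (ex_derive_ext (fun s => (r * cos s * (r * cos s - Re z)
       + r * sin s * (r * sin s - Im z)) / D s)).
    + intros s; unfold cauchy_kernel, Cdiv, Cinv, Cmult, Cminus, Cplus, Copp, RtoC, cis, D.
      destruct z as [z1 z2]; simpl; change_eq_R; unfold Rdiv.
      ring_simplify ((r * cos s - 0 * sin s + - z1) * ((r * cos s - 0 * sin s + - z1) * 1)
        + (r * sin s + 0 * cos s + - z2) * ((r * sin s + 0 * cos s + - z2) * 1)).
      ring_simplify ((r * cos s - z1) * (r * cos s - z1) + (r * sin s - z2) * (r * sin s - z2)).
      ring.
    + unfold D; auto_derive; exact Hn.
  - apply (ex_derive_ext (fun s => (r * sin s * (r * cos s - Re z)
       - r * cos s * (r * sin s - Im z)) / D s)).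
    + intros s; unfold cauchy_kernel, Cdiv, Cinv, Cmult, Cminus, Cplus, Copp, RtoC, cis, D.
      destruct z as [z1 z2]; simpl; change_eq_R; unfold Rdiv.
      ring_simplify ((r * cos s - 0 * sin s + - z1) * ((r * cos s - 0 * sin s + - z1) * 1)
        + (r * sin s + 0 * cos s + - z2) * ((r * sin s + 0 * cos s + - z2) * 1)).
      ring_simplify ((r * cos s - z1) * (r * cos s - z1) + (r * sin s - z2) * (r * sin s - z2)).
      ring.
    + unfold D; auto_derive; exact Hn.
Qed.

Lemma ccont_cauchy_kernel r z : 0 < r -> Cmod z < r -> ccont (cauchy_kernel r z).
Proof.
  intros Hr Hz t; destruct (cauchy_kernel_ex_derive r z t Hr Hz).
  split; apply (ex_derive_continuous (V := R_NormedModule)); assumption.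
Qed.

(** Let [l] tend to 0 in the contraction of the circle: the integrand converges
    uniformly to [phi z * k t] because [phi] is continuous at [z]. *)
Lemma cauchy_formula_Re phi rho r z :
  (forall w, Cmod w < rho -> hol phi w) -> 0 < r < rho -> Cmod z < r ->
  Re (circle_int (fun t => phi (r * cis t) * cauchy_kernel r z t)%C) =
  Re (phi z * circle_int (cauchy_kernel r z))%C.
Proof.
  intros Hphi Hr Hz.
  assert (Hck := ccont_cauchy_kernel r z (proj1 Hr) Hz).
  rewrite <- circle_int_scal by exact Hck.
  unfold circle_int; cbn [Re fst].
  set (X := RInt (fun t => Re (phi (r * cis t)%C * cauchy_kernel r z t)%C) 0 (2 * PI)).
  set (Y := RInt (fun t => Re (phi z * cauchy_kernel r z t)%C) 0 (2 * PI)).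
  change (X = Y).
  set (K := r / (r - Cmod z)).
  assert (HP := PI_RGT_0).
  assert (HK : 0 < K) by (apply Rdiv_lt_0_compat; lra).
  apply eq_of_arbitrarily_close. intros eta Heta.
  destruct (Hphi z) as [d Hd]; [lra|].
  destruct (is_cderiv_continuous _ _ _ Hd (eta / (2 * PI * K))) as (del & Hdel & Hc).
  { apply Rdiv_lt_0_compat; [lra|]. apply Rmult_lt_0_compat; lra. }
  (* The contracted circle stays within [2 r eps] of [z]. *)
  set (eps := Rmin (1 / 2) (del / (4 * r))).
  assert (He1 : 0 < eps).
  { apply Rmin_pos; [lra|apply Rdiv_lt_0_compat; lra]. }
  assert (He2 : eps <= 1 / 2) by apply Rmin_l.
  assert (He3 : eps <= del / (4 * r)) by apply Rmin_r.
  assert (Hcc : ccont (fun t => phi (z + eps * (r * cis t - z)) * cauchy_kernel r z t)%C).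
  { apply ccont_mult; [|exact Hck].
    apply (ccont_comp phi (fun t => z + eps * (r * cis t - z))%C).
    - apply ccont_plus; [apply ccont_const|].
      apply ccont_mult; [apply ccont_const|].
      apply (ccont_plus (fun t => r * cis t)%C (fun t => - z)%C); [|apply ccont_const].
      apply ccont_mult; [apply ccont_const|apply ccont_cis].
    - intros t; apply Hphi.
      assert (H := homotopy_inside r eps z t ltac:(lra) (proj1 Hr) Hz). lra. }
  unfold X.
  rewrite (circle_homotopy phi rho r z (cauchy_kernel r z) eps Hphi Hr Hz).
  - unfold Y.
    replace eta with ((2 * PI - 0) * (eta / (2 * PI * K) * K)) by (field; lra).
    assert (Hcc2 : ccont (fun t => phi z * cauchy_kernel r z t)%C).
    { apply ccont_mult; [apply ccont_const|exact Hck]. }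
    assert (EM := RInt_minus (V := R_CompleteNormedModule)
      (fun t => Re (phi (z + eps * (r * cis t - z))%C * cauchy_kernel r z t)%C)
      (fun t => Re (phi z * cauchy_kernel r z t)%C)
      0 (2 * PI) (ex_RInt_Re _ _ _ Hcc) (ex_RInt_Re _ _ _ Hcc2)).
    match type of EM with _ = ?b => match goal with |- Rabs ?a <= _ =>
      change a with b end end.
    rewrite <- EM.
    apply abs_RInt_le_const; [lra| |].
    + apply (ex_RInt_minus (V := R_NormedModule));
        [apply (ex_RInt_Re _ _ _ Hcc)|apply (ex_RInt_Re _ _ _ Hcc2)].
    + intros t _.
      set (w := (z + eps * (r * cis t - z))%C).
      match goal with |- Rabs ?a <= _ =>
        replace a with (Re ((phi w - phi z) * cauchy_kernel r z t)%C) end.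
      2:{ unfold minus, plus, opp; simpl; unfold Re; simpl. change_eq_R; ring. }
      eapply Rle_trans; [apply re_le_Cmod|]. rewrite Cmod_mult.
      apply Rmult_le_compat; try apply Cmod_ge_0.
      * left; apply Hc.
        replace (w - z)%C with (eps * (r * cis t - z))%C by (unfold w; ring).
        rewrite Cmod_mult, Cmod_R, Rabs_pos_eq by lra.
        assert (T := Cmod_triangle (r * cis t) (- z)).
        rewrite Cmod_opp, Cmod_mult, Cmod_cis, Cmod_R, Rabs_pos_eq in T by lra.
        change (r * cis t + - z)%C with (r * cis t - z)%C in T.
        assert (eps * (2 * r) < del).
        { apply Rle_lt_trans with (del / (4 * r) * (2 * r)).
          - apply Rmult_le_compat_r; lra.
          - replace (del / (4 * r) * (2 * r)) with (del / 2) by (field; lra). lra. }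
        nra.
      * apply cauchy_kernel_bound; lra.
  - intros t; unfold cauchy_kernel; field. apply circle_minus_neq; lra.
  - intros t; apply cauchy_kernel_ex_derive; lra.
  - lra.
Qed.

Lemma ccont_circle phi rho r :
  (forall w, Cmod w < rho -> hol phi w) -> 0 < r < rho -> ccont (fun t => phi (r * cis t)%C).
Proof.
  intros Hphi Hr. apply (ccont_comp phi (fun t => r * cis t)%C).
  - apply ccont_mult; [apply ccont_const|apply ccont_cis].
  - intros t; apply Hphi. rewrite Cmod_mult, Cmod_cis, Cmod_R, Rabs_pos_eq; lra.
Qed.

(** The imaginary part is the real part for [- i phi]. *)
Lemma cauchy_formula phi rho r z :
  (forall w, Cmod w < rho -> hol phi w) -> 0 < r < rho -> Cmod z < r ->
  circle_int (fun t => phi (r * cis t) * cauchy_kernel r z t)%C =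
  (phi z * circle_int (cauchy_kernel r z))%C.
Proof.
  intros Hphi Hr Hz.
  assert (A := cauchy_formula_Re phi rho r z Hphi Hr Hz).
  assert (B := cauchy_formula_Re (fun w => - Ci * phi w)%C rho r z
    (fun w Hw => hol_scal _ _ (- Ci)%C (Hphi w Hw)) Hr Hz).
  cbv beta in B.
  rewrite (circle_int_ext _ (fun t => - Ci * (phi (r * cis t) * cauchy_kernel r z t))%C) in B
    by (intros; ring).
  rewrite circle_int_scal in B.
  2:{ apply ccont_mult; [eapply ccont_circle; eassumption|apply ccont_cauchy_kernel; lra]. }
  replace (- Ci * phi z * circle_int (cauchy_kernel r z))%C
    with (- Ci * (phi z * circle_int (cauchy_kernel r z)))%C in B by ring.
  rewrite !Re_Cmult in B.
  replace (Re (- Ci)) with 0 in B by (simpl; ring).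
  replace (Im (- Ci)) with (-1) in B by (simpl; ring).
  match goal with |- ?a = ?b => destruct a, b end. simpl in A, B; f_equal; lra.
Qed.

Lemma cis_mult s t : (cis s * cis t)%C = cis (s + t).
Proof. unfold cis, Cmult; simpl. rewrite cos_plus, sin_plus. f_equal; ring. Qed.

Lemma cis_pow t n : (cis t ^ n)%C = cis (INR n * t).
Proof.
  induction n as [|n IH].
  - simpl. unfold cis. rewrite Rmult_0_l, cos_0, sin_0. reflexivity.
  - change (cis t ^ S n)%C with (cis t * cis t ^ n)%C. rewrite IH, cis_mult, S_INR.
    f_equal; ring.
Qed.

Lemma circle_int_cis_pow n : circle_int (fun t => cis (- t) ^ S n)%C = 0%C.
Proof.
  rewrite (circle_int_ext _ (fun t => cis (- (INR (S n)) * t))) by (intros t; rewrite cis_pow; f_equal; ring).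
  set (m := INR (S n)). assert (Hm : 0 < m) by (apply lt_0_INR; lia).
  assert (E : sin (- m * (2 * PI)) = sin 0 /\ cos (- m * (2 * PI)) = cos 0).
  { split.
    - replace (- m * (2 * PI)) with (- (0 + 2 * m * PI)) by ring.
      rewrite sin_neg; unfold m; rewrite sin_period, sin_0; ring.
    - replace (- m * (2 * PI)) with (- (0 + 2 * m * PI)) by ring.
      rewrite cos_neg; unfold m; apply cos_period. }
  destruct E as [Es Ec].
  unfold circle_int, cis; apply f_equal2; cbn [Re Im fst snd]; apply is_RInt_unique.
  - replace 0 with (minus (sin (- m * (2 * PI)) / - m) (sin (- m * 0) / - m)) at 2.
    + apply (is_RInt_derive (V := R_CompleteNormedModule) (fun t => sin (- m * t) / - m)).
      * intros x _; auto_derive; [lra|field; lra].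
      * intros x _; apply (ex_derive_continuous (V := R_NormedModule)); auto_derive; exact I.
    + rewrite Es, Rmult_0_r; unfold minus, plus, opp; simpl; ring.
  - replace 0 with (minus (cos (- m * (2 * PI)) / m) (cos (- m * 0) / m)) at 2.
    + apply (is_RInt_derive (V := R_CompleteNormedModule) (fun t => cos (- m * t) / m)).
      * intros x _; auto_derive; [lra|field; lra].
      * intros x _; apply (ex_derive_continuous (V := R_NormedModule)); auto_derive; exact I.
    + rewrite Ec, Rmult_0_r; unfold minus, plus, opp; simpl; ring.
Qed.

(** * Taylor expansion of holomorphic functions *)

Definition is_cseries (u : nat -> C) (s : C) : Prop :=
  is_series (fun n => Re (u n)) (Re s) /\ is_series (fun n => Im (u n)) (Im s).

Fixpoint partial_csum (u : nat -> C) (N : nat) : C :=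
  match N with O => 0%C | S n => (partial_csum u n + u n)%C end.

Lemma partial_csum_Re u n : Re (partial_csum u (S n)) = sum_n (fun k => Re (u k)) n.
Proof.
  induction n as [|n IH].
  - rewrite sum_O; simpl; unfold Re; simpl; ring.
  - rewrite sum_Sn, <- IH; reflexivity.
Qed.

Lemma partial_csum_Im u n : Im (partial_csum u (S n)) = sum_n (fun k => Im (u k)) n.
Proof.
  induction n as [|n IH].
  - rewrite sum_O; simpl; unfold Im; simpl; ring.
  - rewrite sum_Sn, <- IH; reflexivity.
Qed.

Lemma is_cseries_of_partial_csum u s :
  (forall eps, 0 < eps -> exists N, forall n, (N <= n)%nat -> Cmod (partial_csum u n - s) < eps) ->
  is_cseries u s.
Proof.
  intros H; split.
  - apply is_series_Reals. intros eps Heps. destruct (H eps Heps) as [N HN].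
    exists N; intros n Hn. rewrite <- sum_n_Reals, <- partial_csum_Re.
    eapply Rle_lt_trans; [|apply (HN (S n)); lia].
    apply (re_le_Cmod (partial_csum u (S n) - s)).
  - apply is_series_Reals. intros eps Heps. destruct (H eps Heps) as [N HN].
    exists N; intros n Hn. rewrite <- sum_n_Reals, <- partial_csum_Im.
    eapply Rle_lt_trans; [|apply (HN (S n)); lia].
    apply (Im_le_Cmod (partial_csum u (S n) - s)).
Qed.

Lemma cauchy_kernel_step r z t : 0 < r -> Cmod z < r ->
  cauchy_kernel r z t = (1 + z / r * (cis (- t) * cauchy_kernel r z t))%C.
Proof.
  intros Hr Hz. unfold cauchy_kernel.
  assert (Hn := circle_minus_neq r z t Hr Hz).
  assert (E : (cis (- t) * cis t)%C = 1%C).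
  { rewrite cis_mult; replace (- t + t) with 0 by ring; unfold cis; rewrite cos_0, sin_0.
    reflexivity. }
  assert (Hr' : RtoC r <> 0%C).
  { intros E'; apply (f_equal Re) in E'; simpl in E'; lra. }
  replace (z / r * (cis (- t) * (r * cis t / (r * cis t - z))))%C
    with (z * (cis (- t) * cis t) / (r * cis t - z))%C by (field; split; assumption).
  rewrite E. field; assumption.
Qed.

(** The finite geometric expansion of the Cauchy kernel, with exact remainder; keeping
    the remainder avoids exchanging an infinite sum and an integral. *)
Lemma kernel_expansion r z psi N : 0 < r -> Cmod z < r -> ccont psi ->
  circle_int (fun t => psi t * cauchy_kernel r z t)%C =
  (partial_csum (fun n => (z / r) ^ n * circle_int (fun t => psi t * cis (- t) ^ n)) N
   + (z / r) ^ N * circle_int (fun t => psi t * cis (- t) ^ N * cauchy_kernel r z t))%C.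
Proof.
  intros Hr Hz Hpsi.
  assert (Hcm : forall n, ccont (fun t => psi t * cis (- t) ^ n)%C).
  { intros n; apply ccont_mult; [exact Hpsi|]. apply (ccont_pow (fun t => cis (- t))).
    intros t; split; apply (ex_derive_continuous (V := R_NormedModule)); unfold cis; simpl;
      auto_derive; exact I. }
  assert (Hk := ccont_cauchy_kernel r z Hr Hz).
  induction N as [|N IH].
  - simpl partial_csum. rewrite (circle_int_ext (fun t => psi t * cis (- t) ^ 0 * cauchy_kernel r z t)%C
      (fun t => psi t * cauchy_kernel r z t)%C) by (intros; simpl; ring).
    simpl; ring.
  - rewrite IH. simpl partial_csum.
    rewrite (circle_int_ext (fun t => psi t * cis (- t) ^ N * cauchy_kernel r z t)%C
      (fun t => psi t * cis (- t) ^ N +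
         (z / r) * (psi t * cis (- t) ^ S N * cauchy_kernel r z t))%C).
    + rewrite circle_int_plus, circle_int_scal.
      * change ((z / r) ^ S N)%C with (z / r * (z / r) ^ N)%C. ring.
      * apply ccont_mult; [apply Hcm|exact Hk].
      * apply Hcm.
      * apply ccont_mult; [apply ccont_const|].
        apply (ccont_mult (fun t => psi t * cis (- t) ^ S N)%C); [apply Hcm|exact Hk].
    + intros t. rewrite (cauchy_kernel_step r z t) at 1 by assumption.
      change (cis (- t) ^ S N)%C with (cis (- t) * cis (- t) ^ N)%C. ring.
Qed.

Lemma circle_int_1 : circle_int (fun _ => 1%C) = (2 * PI, 0).
Proof.
  unfold circle_int; simpl; unfold Re, Im; simpl. rewrite !RInt_const.
  unfold scal; simpl; unfold mult; simpl; f_equal; ring.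
Qed.

Lemma ccont_bounded psi : ccont psi ->
  exists M, 0 < M /\ forall t, 0 <= t <= 2 * PI -> Cmod (psi t) <= M.
Proof.
  intros H.
  destruct (bounded_continuity (V := R_NormedModule) (fun t => Re (psi t)) 0 (2 * PI))
    as [M1 H1]; [intros x _; apply H|].
  destruct (bounded_continuity (V := R_NormedModule) (fun t => Im (psi t)) 0 (2 * PI))
    as [M2 H2]; [intros x _; apply H|].
  exists (1 + Rabs M1 + Rabs M2); split.
  { assert (A := Rabs_pos M1); assert (B := Rabs_pos M2); lra. }
  intros t Ht; specialize (H1 t Ht); specialize (H2 t Ht).
  eapply Rle_trans; [apply Cmod_le_Re_Im|].
  unfold norm in H1, H2; simpl in H1, H2; unfold abs in H1, H2; simpl in H1, H2.
  assert (A := Rle_abs M1); assert (B := Rle_abs M2). lra.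
Qed.

Lemma kernel_remainder r z psi : 0 < r -> Cmod z < r -> ccont psi ->
  exists B, 0 < B /\ forall N,
    Cmod ((z / r) ^ N * circle_int (fun t => psi t * cis (- t) ^ N * cauchy_kernel r z t)%C)
    <= B * (Cmod z / r) ^ N.
Proof.
  intros Hr Hz Hpsi.
  destruct (ccont_bounded psi Hpsi) as (M & HM & Hb).
  assert (HP := PI_RGT_0).
  assert (HK : 0 < r / (r - Cmod z)) by (apply Rdiv_lt_0_compat; lra).
  exists (4 * PI * (M * (r / (r - Cmod z)))); split.
  { repeat (apply Rmult_lt_0_compat; try lra). }
  intros N. rewrite Cmod_mult, Rmult_comm.
  assert (Hr' : RtoC r <> 0%C).
  { intros E'; apply (f_equal Re) in E'; simpl in E'; lra. }
  rewrite Cmod_pow, Cmod_div, Cmod_R, Rabs_pos_eq by (assumption || lra).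
  apply Rmult_le_compat_r.
  { apply pow_le, Rdiv_le_0_compat; [apply Cmod_ge_0|lra]. }
  apply circle_int_bound.
  - apply (ccont_mult (fun t => psi t * cis (- t) ^ N)%C); [|apply ccont_cauchy_kernel; lra].
    apply ccont_mult; [exact Hpsi|]. apply (ccont_pow (fun t => cis (- t))).
    intros t; split; apply (ex_derive_continuous (V := R_NormedModule)); unfold cis; simpl;
      auto_derive; exact I.
  - intros t Ht. rewrite !Cmod_mult, Cmod_pow, Cmod_cis, pow1, Rmult_1_r.
    apply Rmult_le_compat; try apply Cmod_ge_0; [apply Hb, Ht|].
    apply cauchy_kernel_bound; lra.
Qed.

Lemma geometric_small x B eps : 0 <= x < 1 -> 0 < B -> 0 < eps ->
  exists N, forall n, (N <= n)%nat -> B * x ^ n < eps.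
Proof.
  intros Hx HB Heps.
  destruct (pow_lt_1_zero x) with (y := eps / B) as [N HN].
  - rewrite Rabs_pos_eq; lra.
  - apply Rdiv_lt_0_compat; lra.
  - exists N; intros n Hn; specialize (HN n Hn).
    rewrite Rabs_pos_eq in HN by (apply pow_le; lra).
    apply (Rmult_lt_compat_l B) in HN; [|lra].
    replace (B * (eps / B)) with eps in HN by (field; lra). exact HN.
Qed.

(** Only the constant term of the geometric expansion has a nonzero integral. *)
Lemma circle_int_cauchy_kernel r z : 0 < r -> Cmod z < r -> circle_int (cauchy_kernel r z) = (2 * PI, 0).
Proof.
  intros Hr Hz.
  assert (Hx : 0 <= Cmod z / r < 1).
  { split; [apply Rdiv_le_0_compat; [apply Cmod_ge_0|lra]|].
    apply Rlt_div_l; lra. }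
  destruct (kernel_remainder r z (fun _ => 1%C) Hr Hz (ccont_const _)) as (B & HB & Hrem).
  assert (HS : forall N, partial_csum (fun n => (z / r) ^ n * circle_int (fun t => 1 * cis (- t) ^ n))%C (S N)
                         = (2 * PI, 0)).
  { intros N; induction N as [|N IH].
    - cbn [partial_csum]. rewrite (circle_int_ext (fun t => 1 * cis (- t) ^ 0)%C (fun _ => 1%C))
        by (intros; simpl; ring). rewrite circle_int_1. simpl; ring.
    - change (partial_csum ?f (S (S N))) with (partial_csum f (S N) + f (S N))%C. rewrite IH.
      rewrite (circle_int_ext _ (fun t => cis (- t) ^ S N)%C) by (intros; ring).
      rewrite circle_int_cis_pow; ring. }
  assert (small : forall eps, 0 < eps -> Cmod (circle_int (cauchy_kernel r z) - (2 * PI, 0)) < eps).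
  { intros eps Heps.
    destruct (geometric_small _ B eps Hx HB Heps) as [N HN].
    specialize (HN (S N) ltac:(lia)).
    rewrite (circle_int_ext (cauchy_kernel r z) (fun t => 1 * cauchy_kernel r z t)%C) by (intros; ring).
    rewrite (kernel_expansion r z (fun _ => 1%C) (S N) Hr Hz (ccont_const _)), HS.
    eapply Rle_lt_trans; [|exact HN]. eapply Rle_trans; [|apply Hrem]. right; f_equal; ring. }
  set (T := ((2 * PI)%R, 0%R) : C) in *. change (circle_int (cauchy_kernel r z) = T).
  apply NNPP; intros Hne. apply Cmod_minus_pos in Hne. specialize (small _ Hne). lra.
Qed.

(** Insert the geometric expansion of the kernel into Cauchy's formula: the remainder
    is at most a constant times [(|z| / r) ^ n]. *)
Lemma taylor_at_0 phi rho r : (forall w, Cmod w < rho -> hol phi w) -> 0 < r < rho ->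
  exists c, forall z, Cmod z < r -> is_cseries (fun n => c n * z ^ n)%C (phi z).
Proof.
  intros Hphi Hr.
  set (T := ((2 * PI, 0) : C)).
  assert (HP := PI_RGT_0).
  assert (HT : T <> 0%C) by (intros E; apply (f_equal Re) in E; simpl in E; lra).
  assert (Hr' : RtoC r <> 0%C) by (intros E; apply (f_equal Re) in E; simpl in E; lra).
  exists (fun n => / T * (/ r) ^ n * circle_int (fun t => phi (r * cis t) * cis (- t) ^ n))%C.
  intros z Hz.
  assert (Hc := ccont_circle phi rho r Hphi Hr).
  assert (F := cauchy_formula phi rho r z Hphi Hr Hz).
  rewrite circle_int_cauchy_kernel in F by lra. fold T in F.
  destruct (kernel_remainder r z _ (proj1 Hr) Hz Hc) as (B & HB & Hrem).
  assert (Hx : 0 <= Cmod z / r < 1).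
  { split; [apply Rdiv_le_0_compat; [apply Cmod_ge_0|lra]|]. apply Rlt_div_l; lra. }
  assert (HTm : 0 < Cmod (/ T)).
  { rewrite Cmod_inv by exact HT. apply Rinv_0_lt_compat, Cmod_gt_0, HT. }
  apply is_cseries_of_partial_csum; intros eps Heps.
  destruct (geometric_small _ (Cmod (/ T) * B) eps Hx) as [N HN];
    [apply Rmult_lt_0_compat; assumption|exact Heps|].
  exists N; intros n Hn; specialize (HN n Hn).
  eapply Rle_lt_trans; [|exact HN].
  assert (E := kernel_expansion r z _ n (proj1 Hr) Hz Hc).
  cbv beta in E, Hrem. rewrite F in E.
  match goal with |- Cmod (?s - _) <= _ =>
    replace s with (/ T * partial_csum (fun n => (z / r) ^ n *
                 circle_int (fun t => phi (r * cis t) * cis (- t) ^ n)) n)%C end.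
  - specialize (Hrem n). set (rem := ((z / r) ^ n * _)%C) in *.
    match goal with |- Cmod (_ * ?s - _) <= _ => set (S := s) in * end.
    replace (/ T * S - phi z)%C with (/ T * - rem)%C.
    + rewrite Cmod_mult, Cmod_opp, Rmult_assoc. apply Rmult_le_compat_l; lra.
    + replace (phi z) with (/ T * (phi z * T))%C by (field; exact HT). rewrite E; ring.
  - clear E Hn HN. induction n as [|n IH]; [simpl; ring|].
    cbn [partial_csum]. rewrite <- IH. rewrite Cmult_plus_distr_l. f_equal.
    unfold Cdiv. rewrite Cpow_mult_l. ring.
Qed.

Theorem taylor phi z0 rho r : (forall w, Cmod (w - z0) < rho -> hol phi w) -> 0 < r < rho ->
  exists c, forall z, Cmod (z - z0) < r -> is_cseries (fun n => c n * (z - z0) ^ n)%C (phi z).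
Proof.
  intros Hphi Hr.
  destruct (taylor_at_0 (fun w => phi (w + z0)%C) rho r) as [c Hc]; [|exact Hr|].
  - intros w Hw. destruct (Hphi (w + z0)%C) as [d Hd].
    { replace (w + z0 - z0)%C with w by ring; exact Hw. }
    exists d; intros eps Heps; destruct (Hd eps Heps) as (del & Hdel & H).
    exists del; split; [exact Hdel|]; intros z Hz.
    specialize (H (z + z0)%C). replace (z + z0 - (w + z0))%C with (z - w)%C in H by ring.
    apply H, Hz.
  - exists c; intros z Hz. specialize (Hc _ Hz).
    replace (z - z0 + z0)%C with z in Hc by ring. exact Hc.
Qed.

(** * Complex power series *)

Lemma is_cseries_ext u v s : (forall n, u n = v n) -> is_cseries u s -> is_cseries v s.
Proof.
  intros H [A B]; split; [revert A|revert B]; apply is_series_ext; intros n; rewrite H; reflexivity.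
Qed.

Lemma is_cseries_unique u s s' : is_cseries u s -> is_cseries u s' -> s = s'.
Proof.
  intros [A B] [A' B'].
  apply is_series_unique in A, B, A', B'.
  apply injective_projections; change (fst ?a) with (Re a); change (snd ?a) with (Im a);
    congruence.
Qed.

Lemma is_cseries_plus u v s t : is_cseries u s -> is_cseries v t -> is_cseries (fun n => u n + v n)%C (s + t)%C.
Proof.
  intros [A B] [A' B']; split.
  - exact (is_series_plus (V := R_NormedModule) _ _ _ _ A A').
  - exact (is_series_plus (V := R_NormedModule) _ _ _ _ B B').
Qed.

Lemma is_series_lincomb (u v : nat -> R) a b x y :
  is_series u a -> is_series v b -> is_series (fun n => x * u n + y * v n) (x * a + y * b).
Proof.
  intros Hu Hv.
  apply (is_series_plus (V := R_NormedModule) (fun n => x * u n) (fun n => y * v n)).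
  - exact (is_series_scal_l (V := R_NormedModule) x u a Hu).
  - exact (is_series_scal_l (V := R_NormedModule) y v b Hv).
Qed.

Lemma is_cseries_scal c u s : is_cseries u s -> is_cseries (fun n => c * u n)%C (c * s)%C.
Proof.
  intros [A B]; split.
  - rewrite Re_Cmult; unfold Rminus; rewrite Ropp_mult_distr_l.
    apply (is_series_ext (fun n => Re c * Re (u n) + - Im c * Im (u n))).
    { intros n; rewrite Re_Cmult; change_eq_R; ring. }
    apply is_series_lincomb; assumption.
  - rewrite Im_Cmult.
    apply (is_series_ext (fun n => Re c * Im (u n) + Im c * Re (u n))).
    { intros n; rewrite Im_Cmult; change_eq_R; ring. }
    apply is_series_lincomb; assumption.
Qed.

Lemma is_series_tail (u : nat -> R) s :
  is_series u s <-> is_series (fun n => u (S n)) (s - u O).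
Proof.
  split; intros H.
  - apply (is_series_incr_1 (V := R_NormedModule)).
    assert (E : (s - u O) + u O = s) by ring.
    unfold plus; simpl; rewrite E; exact H.
  - apply (is_series_decr_1 (V := R_NormedModule)). exact H.
Qed.

Lemma is_cseries_tail u s : is_cseries u s <-> is_cseries (fun n => u (S n)) (s - u O)%C.
Proof.
  unfold is_cseries; rewrite (is_series_tail (fun n => Re (u n))), (is_series_tail (fun n => Im (u n))).
  reflexivity.
Qed.

Definition Cseries (u : nat -> C) : C :=
  (Series (fun n => Re (u n)), Series (fun n => Im (u n))).

Lemma is_cseries_dominated u (v : nat -> R) V : (forall n, Cmod (u n) <= v n) -> is_series v V ->
  is_cseries u (Cseries u) /\ Cmod (Cseries u) <= 2 * V.
Proof.
  intros Huv HV.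
  assert (A : ex_series (fun n => Rabs (Re (u n)))).
  { apply (ex_series_le (V := R_CompleteNormedModule) _ v); [|exists V; exact HV].
    intros n; unfold norm; simpl; unfold abs; simpl. rewrite Rabs_Rabsolu.
    eapply Rle_trans; [apply re_le_Cmod|apply Huv]. }
  assert (B : ex_series (fun n => Rabs (Im (u n)))).
  { apply (ex_series_le (V := R_CompleteNormedModule) _ v); [|exists V; exact HV].
    intros n; unfold norm; simpl; unfold abs; simpl. rewrite Rabs_Rabsolu.
    eapply Rle_trans; [apply Im_le_Cmod|apply Huv]. }
  split; [split; apply Series_correct, ex_series_Rabs; assumption|].
  apply is_series_unique in HV as HV'.
  assert (A' : Rabs (Series (fun n => Re (u n))) <= V).
  { eapply Rle_trans; [apply Series_Rabs; exact A|]. rewrite <- HV'.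
    apply Series_le; [|exists V; exact HV]. intros n; split; [apply Rabs_pos|].
    eapply Rle_trans; [apply re_le_Cmod|apply Huv]. }
  assert (B' : Rabs (Series (fun n => Im (u n))) <= V).
  { eapply Rle_trans; [apply Series_Rabs; exact B|]. rewrite <- HV'.
    apply Series_le; [|exists V; exact HV]. intros n; split; [apply Rabs_pos|].
    eapply Rle_trans; [apply Im_le_Cmod|apply Huv]. }
  eapply Rle_trans; [apply Cmod_le_Re_Im|]. unfold Cseries; simpl. lra.
Qed.

(** The Cauchy estimates at radius [r], used in place of a radius of convergence. *)
Definition geom_bounded (c : nat -> C) (M r : R) : Prop :=
  forall n, Cmod (c n) * r ^ n <= M.

Lemma ex_series_bounded (u : nat -> R) : ex_series u ->
  exists M, 0 < M /\ forall n, Rabs (u n) <= M.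
Proof.
  intros Hu. apply ex_series_lim_0, is_lim_seq_Reals in Hu.
  destruct (maj_by_pos u (exist _ 0 Hu)) as [M HM]. exists M; exact HM.
Qed.

Lemma is_cseries_geom_bounded c z s : is_cseries (fun n => c n * z ^ n)%C s ->
  exists M, 0 < M /\ geom_bounded c M (Cmod z).
Proof.
  intros [A B].
  destruct (ex_series_bounded _ (ex_intro _ _ A)) as (M1 & P1 & H1).
  destruct (ex_series_bounded _ (ex_intro _ _ B)) as (M2 & P2 & H2).
  exists (M1 + M2); split; [lra|]. intros n. rewrite <- Cmod_pow, <- Cmod_mult.
  eapply Rle_trans; [apply Cmod_le_Re_Im|]. apply Rplus_le_compat; [apply H1|apply H2].
Qed.

Lemma geom_bounded_term c M r (w : C) n : geom_bounded c M r -> 0 < r ->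
  Cmod (c n * w ^ n) <= M * (Cmod w / r) ^ n.
Proof.
  intros H Hr. specialize (H n). rewrite Cmod_mult, Cmod_pow.
  assert (Hp : 0 < r ^ n) by (apply pow_lt; exact Hr).
  unfold Rdiv. rewrite Rpow_mult_distr, pow_inv.
  assert (Hw : 0 <= Cmod w ^ n) by (apply pow_le, Cmod_ge_0).
  apply (Rmult_le_reg_r (r ^ n)); [exact Hp|].
  replace (M * (Cmod w ^ n * / r ^ n) * r ^ n) with (M * Cmod w ^ n) by (field; lra).
  replace (Cmod (c n) * Cmod w ^ n * r ^ n) with (Cmod (c n) * r ^ n * Cmod w ^ n) by ring.
  apply Rmult_le_compat_r; assumption.
Qed.

Lemma is_series_geom_ratio M r x : 0 < r -> 0 <= x < r ->
  is_series (fun n => M * (x / r) ^ n) (M * (r / (r - x))).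
Proof.
  intros Hr Hx.
  apply (is_series_scal_l (V := R_NormedModule) M (fun n => (x / r) ^ n)).
  replace (r / (r - x)) with (/ (1 - x / r)) by (field; lra).
  apply is_series_geom.
  rewrite Rabs_pos_eq by (apply Rdiv_le_0_compat; lra). apply Rlt_div_l; lra.
Qed.

Lemma pseries_converges c M r (w : C) : geom_bounded c M r -> 0 < r -> Cmod w < r ->
  is_cseries (fun n => c n * w ^ n)%C (Cseries (fun n => c n * w ^ n)%C) /\
  Cmod (Cseries (fun n => c n * w ^ n)%C) <= 2 * (M * (r / (r - Cmod w))).
Proof.
  intros H Hr Hw.
  apply (is_cseries_dominated _ (fun n => M * (Cmod w / r) ^ n)).
  - intros n; apply geom_bounded_term; assumption.
  - apply is_series_geom_ratio; [exact Hr|split; [apply Cmod_ge_0|exact Hw]].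
Qed.

Lemma geom_bounded_shift c M r k : geom_bounded c M r -> 0 < r ->
  geom_bounded (fun n => c (k + n)%nat) (M / r ^ k) r.
Proof.
  intros H Hr n. specialize (H (k + n)%nat). rewrite pow_add in H.
  assert (Hp : 0 < r ^ k) by (apply pow_lt; exact Hr).
  apply (Rmult_le_reg_r (r ^ k)); [exact Hp|].
  replace (M / r ^ k * r ^ k) with M by (field; lra). lra.
Qed.

(** For a power series [S] one has [S z - S w = (z - w) D z] where [D] is again a power
    series: its coefficients are the tails [d k = sum_j c (k+1+j) w^j], which satisfy
    [d k = c (k+1) + w d (k+1)].  Continuity and differentiability of power series
    follow without differentiating termwise. *)
Lemma pseries_difference_quotient c M r (w : C) :
  geom_bounded c M r -> 0 < r -> Cmod w < r ->
  exists d M', geom_bounded d M' r /\ forall z s t, Cmod z < r ->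
    is_cseries (fun n => c n * w ^ n)%C s -> is_cseries (fun n => c n * z ^ n)%C t ->
    (t - s = (z - w) * Cseries (fun n => d n * z ^ n))%C.
Proof.
  intros H Hr Hw.
  set (d := fun k => Cseries (fun j => c (S k + j)%nat * w ^ j)%C).
  assert (Hd : forall k, is_cseries (fun j => c (S k + j)%nat * w ^ j)%C (d k) /\
    Cmod (d k) <= 2 * (M / r ^ S k * (r / (r - Cmod w)))).
  { intros k; apply pseries_converges; [|assumption..].
    apply geom_bounded_shift; assumption. }
  assert (rec : forall k, d k = (c (S k) + w * d (S k))%C).
  { intros k.
    destruct (Hd k) as [A _]. apply (proj1 (is_cseries_tail _ _)) in A.
    destruct (Hd (S k)) as [B _]. apply (is_cseries_scal w) in B.
    assert (E : (d k - c (S k + 0)%nat * w ^ 0)%C = (w * d (S k))%C).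
    { eapply is_cseries_unique; [exact A|]. revert B; apply is_cseries_ext; intros j.
      replace (S (S k) + j)%nat with (S k + S j)%nat by lia.
      change (w ^ S j)%C with (w * w ^ j)%C; ring. }
    rewrite <- E, Nat.add_0_r. simpl; ring. }
  assert (bd : geom_bounded d (2 * (M / r * (r / (r - Cmod w)))) r).
  { intros k; destruct (Hd k) as [_ B].
    assert (Hp : 0 < r ^ k) by (apply pow_lt; exact Hr).
    apply (Rmult_le_compat_r (r ^ k)) in B; [|lra].
    eapply Rle_trans; [exact B|]. right; simpl; field. lra. }
  exists d, (2 * (M / r * (r / (r - Cmod w)))); split; [exact bd|].
  intros z s t Hz Hs Ht.
  assert (Es : s = (c O + w * d O)%C).
  { apply (proj1 (is_cseries_tail _ _)) in Hs. destruct (Hd O) as [B _]. apply (is_cseries_scal w) in B.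
    assert (E : (s - c O * w ^ 0)%C = (w * d O)%C).
    { eapply is_cseries_unique; [exact Hs|]. revert B; apply is_cseries_ext; intros j; simpl; ring. }
    rewrite <- E. simpl; ring. }
  destruct (pseries_converges d _ r z bd Hr Hz) as [HT _].
  set (T := Cseries (fun n => d n * z ^ n)%C) in *.
  apply (proj1 (is_cseries_tail _ _)) in Ht.
  assert (E : (t - c O * z ^ 0)%C = (z * T + - w * (T - d O * z ^ 0))%C).
  { eapply is_cseries_unique; [exact Ht|].
    assert (HT2 := proj1 (is_cseries_tail _ _) HT).
    assert (X := is_cseries_plus _ _ _ _ (is_cseries_scal z _ _ HT) (is_cseries_scal (- w)%C _ _ HT2)).
    revert X; apply is_cseries_ext; intros j. cbv beta. rewrite (rec j).
    change (z ^ S j)%C with (z * z ^ j)%C; ring. }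
  rewrite Es. replace t with ((t - c O * z ^ 0) + c O)%C by (simpl; ring).
  rewrite E. simpl; ring.
Qed.

Lemma pseries_lipschitz c M r F (w : C) : geom_bounded c M r -> 0 < r ->
  (forall z, Cmod z < r -> is_cseries (fun n => c n * z ^ n)%C (F z)) -> Cmod w < r ->
  exists K del, 0 < K /\ 0 < del /\ forall z, Cmod (z - w) < del ->
    Cmod z < r /\ Cmod (F z - F w) <= K * Cmod (z - w).
Proof.
  intros H Hr HF Hw.
  destruct (pseries_difference_quotient c M r w H Hr Hw) as (d & M' & Hd & Hq).
  assert (HM' : 0 <= M').
  { eapply Rle_trans; [|apply (Hd O)]. simpl. rewrite Rmult_1_r. apply Cmod_ge_0. }
  exists (4 * (M' + 1) * r / (r - Cmod w)), ((r - Cmod w) / 2).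
  assert (Hw0 := Cmod_ge_0 w).
  split; [apply Rdiv_lt_0_compat; nra|]. split; [lra|]. intros z Hz.
  assert (Hzr : Cmod z < r).
  { assert (T := Cmod_triangle_minus z w 0).
    replace (z - 0)%C with z in T by ring. replace (w - 0)%C with w in T by ring. lra. }
  split; [exact Hzr|].
  rewrite (Hq z (F w) (F z) Hzr (HF w Hw) (HF z Hzr)), Cmod_mult, Rmult_comm.
  apply Rmult_le_compat_r; [apply Cmod_ge_0|].
  eapply Rle_trans; [apply (pseries_converges d M' r z); assumption|].
  assert (T := Cmod_triangle_minus z w 0).
  replace (z - 0)%C with z in T by ring. replace (w - 0)%C with w in T by ring.
  assert (I : / (r - Cmod z) <= 2 * / (r - Cmod w)).
  { replace (2 * / (r - Cmod w)) with (/ ((r - Cmod w) / 2)) by (field; lra).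
    apply Rinv_le_contravar; lra. }
  assert (0 < / (r - Cmod z)) by (apply Rinv_0_lt_compat; lra).
  unfold Rdiv.
  replace (2 * (M' * (r * / (r - Cmod z)))) with ((2 * M' * r) * / (r - Cmod z)) by ring.
  apply Rle_trans with ((2 * M' * r) * (2 * / (r - Cmod w))).
  - apply Rmult_le_compat_l; [nra|exact I].
  - assert (0 < / (r - Cmod w)) by (apply Rinv_0_lt_compat; lra).
    assert (0 < r * / (r - Cmod w)) by (apply Rmult_lt_0_compat; lra). nra.
Qed.

Lemma pseries_hol c M r F (w : C) : geom_bounded c M r -> 0 < r ->
  (forall z, Cmod z < r -> is_cseries (fun n => c n * z ^ n)%C (F z)) -> Cmod w < r -> hol F w.
Proof.
  intros H Hr HF Hw.
  destruct (pseries_difference_quotient c M r w H Hr Hw) as (d & M' & Hd & Hq).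
  set (G := fun z => Cseries (fun n => d n * z ^ n)%C).
  destruct (pseries_lipschitz d M' r G w Hd Hr) as (K & del & HK & Hdel & HG);
    [|exact Hw|].
  { intros z Hz; apply (pseries_converges d M' r z); assumption. }
  exists (G w). intros eps Heps.
  exists (Rmin del (eps / K)); split.
  { apply Rmin_pos; [exact Hdel|apply Rdiv_lt_0_compat; lra]. }
  intros z Hz. pose_Rmin.
  destruct (HG z) as [Hzr HGz]; [lra|].
  rewrite (Hq z (F w) (F z) Hzr (HF w Hw) (HF z Hzr)). fold (G z).
  replace ((z - w) * G z - G w * (z - w))%C with ((G z - G w) * (z - w))%C by ring.
  rewrite Cmod_mult. apply Rmult_le_compat_r; [apply Cmod_ge_0|].
  eapply Rle_trans; [exact HGz|].
  apply Rle_trans with (K * (eps / K)); [apply Rmult_le_compat_l; lra|right; field; lra].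
Qed.

Lemma first_nonzero (T : Type) (z : T) (c : nat -> T) : (forall n, c n = z) \/
  exists k, c k <> z /\ forall n, (n < k)%nat -> c n = z.
Proof.
  destruct (classic (exists k, c k <> z)) as [[k Hk]|Hn].
  - right. revert Hk. induction k as [k IH] using (well_founded_induction Wf_nat.lt_wf). intros Hk.
    destruct (classic (exists m, (m < k)%nat /\ c m <> z)) as [[m [Hm Hc]]|Hm].
    + exact (IH m Hm Hc).
    + exists k; split; [exact Hk|]. intros n Hn. apply NNPP; intros Hne; apply Hm; exists n; auto.
  - left; intros n; apply NNPP; intros Hne; apply Hn; exists n; exact Hne.
Qed.

Lemma is_cseries_drop_zeros (u : nat -> C) s k : (forall n, (n < k)%nat -> u n = 0%C) -> is_cseries u s ->
  is_cseries (fun n => u (k + n)%nat) s.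
Proof.
  intros Hz H. induction k as [|k IH]; [exact H|].
  assert (A : is_cseries (fun n => u (k + n)%nat) s) by (apply IH; intros; apply Hz; lia).
  apply (proj1 (is_cseries_tail _ _)) in A. cbv beta in A. rewrite Nat.add_0_r, Hz in A by lia.
  replace (s - 0)%C with s in A by ring. revert A; apply is_cseries_ext; intros n; cbv beta; replace (k + S n)%nat with (S k + n)%nat by lia; reflexivity.
Qed.

(** Factor out the lowest power of [z]: the cofactor is continuous and nonzero at 0. *)
Lemma pseries_order c M r F : geom_bounded c M r -> 0 < r ->
  (forall z, Cmod z < r -> is_cseries (fun n => c n * z ^ n)%C (F z)) ->
  (forall n, c n = 0%C) \/
  exists k m del, 0 < m /\ 0 < del /\ forall z, Cmod z < del -> m * Cmod z ^ k <= Cmod (F z).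
Proof.
  intros H Hr HF. destruct (first_nonzero C 0%C c) as [Hz|(k & Hk & Hlt)]; [left; exact Hz|right].
  set (e := fun n => c (k + n)%nat).
  assert (He : geom_bounded e (M / r ^ k) r) by (apply geom_bounded_shift; assumption).
  set (G := fun z => Cseries (fun n => e n * z ^ n)%C).
  assert (HG : forall z, Cmod z < r -> is_cseries (fun n => e n * z ^ n)%C (G z)).
  { intros z Hzr; apply (pseries_converges e (M / r ^ k) r z); assumption. }
  assert (EF : forall z, Cmod z < r -> F z = (z ^ k * G z)%C).
  { intros z Hzr.
    assert (Z : forall n, (n < k)%nat -> (c n * z ^ n)%C = RtoC 0)
      by (intros n Hn; rewrite (Hlt n Hn); ring).
    assert (A := is_cseries_drop_zeros (fun n => c n * z ^ n)%C _ k Z (HF z Hzr)).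
    eapply is_cseries_unique; [exact A|].
    assert (B := is_cseries_scal (z ^ k)%C _ _ (HG z Hzr)). revert B; apply is_cseries_ext; intros n.
    unfold e; cbv beta. rewrite Cpow_add_r. ring. }
  assert (G0 : G 0%C = c k).
  { eapply is_cseries_unique; [apply HG; rewrite Cmod_0; exact Hr|].
    apply is_cseries_tail. cbv beta.
    replace (c k - e O * 0 ^ 0)%C with (0 * 0)%C by (unfold e; rewrite Nat.add_0_r; simpl; ring).
    assert (A := is_cseries_scal 0%C _ _ (HG 0%C ltac:(rewrite Cmod_0; exact Hr))).
    replace (0 * G 0)%C with (0 * 0)%C in A by ring.
    revert A; apply is_cseries_ext; intros n. simpl. ring. }
  destruct (pseries_lipschitz e (M / r ^ k) r G 0%C He Hr HG) as (K & del & HK & Hdel & HL);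
    [rewrite Cmod_0; exact Hr|].
  assert (Hck : 0 < Cmod (c k)) by (apply Cmod_gt_0; exact Hk).
  exists k, (Cmod (c k) / 2), (Rmin del (Cmod (c k) / (2 * K))).
  split; [lra|]. split.
  { apply Rmin_pos; [exact Hdel|apply Rdiv_lt_0_compat; lra]. }
  intros z Hz.
  pose_Rmin.
  replace z with (z - 0)%C in Hz by ring.
  destruct (HL z) as [Hzr HLz]; [lra|].
  rewrite (EF z Hzr), Cmod_mult, Cmod_pow, Rmult_comm.
  apply Rmult_le_compat_l; [apply pow_le, Cmod_ge_0|].
  assert (HK2 : K * Cmod (z - 0) <= Cmod (c k) / 2).
  { replace (Cmod (c k) / 2) with (K * (Cmod (c k) / (2 * K))) by (field; lra).
    apply Rmult_le_compat_l; lra. }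
  rewrite G0 in HLz.
  assert (T := Cmod_minus_ge (c k) (G z)). rewrite Cmod_minus_sym in T. lra.
Qed.

(** * Connectedness of punctured discs and the identity theorem *)

Definition locally_constant_at (Q : C -> Prop) (z : C) : Prop :=
  exists del, 0 < del /\ forall w, Cmod (w - z) < del -> (Q w <-> Q z).

(** The one-dimensional case of the bisection principle: [Q] takes the same value at
    the two ends of an interval as soon as it does for both halves. *)
Lemma segment_locally_constant (Q : C -> Prop) (z1 z2 : C) :
  (forall t : R, 0 <= t <= 1 -> locally_constant_at Q (z1 + t * (z2 - z1))) ->
  Q z1 -> Q z2.
Proof.
  intros H H1.
  set (g := fun t : R => (z1 + t * (z2 - z1))%C).
  assert (HT : 0 <= 0 -> 0 + 1 <= 1 -> (Q (g 0) <-> Q (g (0 + 1)))).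
  { apply (bisection_principle (fun x _ h => 0 <= x -> x + h <= 1 -> (Q (g x) <-> Q (g (x + h)))) 0 0 1);
      [lra| |].
    - intros x y h Hh A B _ _ Hx Hxh.
      rewrite (A ltac:(lra) ltac:(lra)), (B ltac:(lra) ltac:(lra)).
      replace (x + h / 2 + h / 2) with (x + h) by field. reflexivity.
    - intros x y Hx Hy. destruct (H x ltac:(lra)) as (del & Hdel & Hw).
      assert (Hp := Cmod_ge_0 (z2 - z1)).
      exists (del / (1 + Cmod (z2 - z1))); split; [apply Rdiv_lt_0_compat; lra|].
      intros x' y' h Hh Hx' Hy' H0 H2.
      assert (near : forall s, Rabs (s - x) <= h -> (Q (g s) <-> Q (g x))).
      { intros s Hs; apply Hw. fold (g x).
        replace (g s - g x)%C with (RtoC (s - x) * (z2 - z1))%C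
          by (unfold g; rewrite RtoC_minus; ring).
        rewrite Cmod_mult, Cmod_R.
        apply Rle_lt_trans with (h * (1 + Cmod (z2 - z1))).
        - apply Rmult_le_compat; [apply Rabs_pos|exact Hp|exact Hs|lra].
        - destruct Hh as [_ Hh]. apply (Rmult_lt_compat_r (1 + Cmod (z2 - z1))) in Hh; [|lra].
          replace (del / (1 + Cmod (z2 - z1)) * (1 + Cmod (z2 - z1))) with del in Hh
            by (field; lra). exact Hh. }
      rewrite (near x'), (near (x' + h)); [reflexivity|apply Rabs_le; lra|apply Rabs_le; lra]. }
  specialize (HT ltac:(lra) ltac:(lra)).
  replace (g 0) with z1 in HT by (unfold g; ring).
  replace (g (0 + 1)) with z2 in HT by (unfold g; rewrite RtoC_plus; ring).
  tauto.
Qed.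

Lemma convex_lt t a b c : 0 <= t <= 1 -> a < c -> b < c -> (1 - t) * a + t * b < c.
Proof.
  intros Ht Ha Hb. destruct (Req_dec t 1) as [->|Hn]; [lra|].
  assert ((1 - t) * a < (1 - t) * c) by (apply Rmult_lt_compat_l; lra).
  assert (t * b <= t * c) by (apply Rmult_le_compat_l; lra). lra.
Qed.

Definition cross (a b : C) : R := Re a * Im b - Im a * Re b.

(** A segment between two points avoids [p] unless they are aligned with [p]; in that
    case go through the point obtained by a quarter turn about [p]. *)
Lemma punctured_disc_locally_constant (Q : C -> Prop) (p : C) (del : R) :
  (forall z, 0 < Cmod (z - p) < del -> locally_constant_at Q z) ->
  forall z z', 0 < Cmod (z - p) < del -> 0 < Cmod (z' - p) < del -> Q z -> Q z'.
Proof.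
  intros H.
  assert (key : forall z z', 0 < Cmod (z - p) < del -> 0 < Cmod (z' - p) < del ->
    cross (z - p) (z' - p) <> 0 -> Q z -> Q z').
  { intros z z' Hz Hz' Hc. apply segment_locally_constant. intros t Ht. apply H. split.
    - apply Cmod_gt_0. intros E. apply Hc.
      destruct z as [a b], z' as [a' b'], p as [p1 p2].
      assert (E1 := f_equal Re E). assert (E2 := f_equal Im E).
      unfold cross. simpl in *.
      assert (F1 : (1 - t) * (a - p1) + t * (a' - p1) = 0) by lra.
      assert (F2 : (1 - t) * (b - p2) + t * (b' - p2) = 0) by lra.
      replace ((a + - p1) * (b' + - p2) - (b + - p2) * (a' + - p1)) with
        (((1 - t) * (a - p1) + t * (a' - p1)) * (b' - p2 - (b - p2))
         - ((1 - t) * (b - p2) + t * (b' - p2)) * (a' - p1 - (a - p1))) by ring.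
      rewrite F1, F2; ring.
    - replace (z + t * (z' - z) - p)%C with (RtoC (1 - t) * (z - p) + RtoC t * (z' - p))%C
        by (rewrite RtoC_minus; ring).
      eapply Rle_lt_trans; [apply Cmod_triangle|].
      rewrite !Cmod_mult, !Cmod_R, !Rabs_pos_eq by lra. apply convex_lt; lra. }
  intros z z' Hz Hz'.
  destruct (Req_dec (cross (z - p) (z' - p)) 0) as [E|E]; [|exact (key z z' Hz Hz' E)].
  set (w := (p + Ci * (z - p))%C).
  assert (Ew : (w - p)%C = (Ci * (z - p))%C) by (unfold w; ring).
  assert (Hw : 0 < Cmod (w - p) < del).
  { rewrite Ew, Cmod_mult, Cmod_Ci, Rmult_1_l; exact Hz. }
  assert (N1 : Cmod (z - p) ^ 2 <> 0) by (apply pow_nonzero; lra).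
  assert (N2 : Cmod (z' - p) ^ 2 <> 0) by (apply pow_nonzero; lra).
  rewrite Cmod2_alt in N1, N2.
  intros Q1. apply (key w z' Hw Hz'); [|apply (key z w Hz Hw); [|exact Q1]].
  - rewrite Ew. intros E2.
    unfold cross in *. rewrite Re_Cmult, Im_Cmult in E2. simpl (Re Ci) in E2. simpl (Im Ci) in E2.
    set (a := Re (z - p)) in *. set (b := Im (z - p)) in *.
    set (c := Re (z' - p)) in *. set (d := Im (z' - p)) in *.
    (* Lagrange's identity: cross product and dot product cannot both vanish. *)
    assert (P : (a ^ 2 + b ^ 2) * (c ^ 2 + d ^ 2) = 0).
    { replace ((a ^ 2 + b ^ 2) * (c ^ 2 + d ^ 2)) with
        ((a * d - b * c) ^ 2 + ((0 * a - 1 * b) * d - (0 * b + 1 * a) * c) ^ 2) by ring.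
      rewrite E, E2; ring. }
    apply Rmult_integral in P; tauto.
  - rewrite Ew. intros E2. apply N1.
    unfold cross in *. rewrite Re_Cmult, Im_Cmult in E2. simpl (Re Ci) in E2. simpl (Im Ci) in E2.
    rewrite <- E2; ring.
Qed.

Definition isolated_in_disc (E : C -> Prop) (p : C) (rho : R) : Prop :=
  forall z, Cmod (z - p) < rho ->
    exists del, 0 < del /\ forall w, 0 < Cmod (w - z) < del -> ~ E w.

Lemma nearby_point (w z : C) eps : 0 < eps -> exists u, 0 < Cmod (u - w) < eps /\ u <> z.
Proof.
  intros He.
  assert (A : forall x : R, 0 < x -> Cmod (w + x - w) = x).
  { intros x Hx. replace (w + x - w)%C with (RtoC x) by ring. rewrite Cmod_R, Rabs_pos_eq; lra. }
  destruct (classic ((w + RtoC (eps / 2))%C = z)) as [E|E].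
  - exists (w + RtoC (eps / 4))%C; split; [rewrite A; lra|]. intros E'. rewrite <- E' in E.
    apply (f_equal Re) in E. destruct w; simpl in E; lra.
  - exists (w + RtoC (eps / 2))%C; split; [rewrite A; lra|exact E].
Qed.

Lemma isolated_punctured_disc E p rho z : isolated_in_disc E p rho -> Cmod (z - p) < rho ->
  exists del, 0 < del /\ forall w, Cmod (w - z) < del ->
    Cmod (w - p) < rho /\ (w <> z -> ~ E w).
Proof.
  intros HE Hz. destruct (HE z Hz) as (del & Hdel & H).
  exists (Rmin del (rho - Cmod (z - p))); split; [apply Rmin_pos; lra|].
  intros w Hw. pose_Rmin.
  split.
  - assert (T := Cmod_triangle_minus w z p). lra.
  - intros Hne. apply H. split; [apply Cmod_minus_pos, Hne|lra].
Qed.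

(** A disc minus a closed discrete set is connected: near each point [z] the predicate
    is constant on a punctured disc, so that value can be assigned to [z] as well.
    This gives a locally constant predicate on the whole disc, where segments are
    available. *)
Theorem disc_locally_constant (Q E : C -> Prop) (p : C) (rho : R) :
  isolated_in_disc E p rho ->
  (forall z, Cmod (z - p) < rho -> ~ E z -> locally_constant_at Q z) ->
  forall z1 z2, Cmod (z1 - p) < rho -> ~ E z1 -> Cmod (z2 - p) < rho -> ~ E z2 ->
    Q z1 -> Q z2.
Proof.
  intros HE HQ.
  set (Q' := fun z => exists del, 0 < del /\ forall w, 0 < Cmod (w - z) < del -> Q w).
  assert (HQ' : forall z, Cmod (z - p) < rho -> locally_constant_at Q' z).
  { intros z Hz. destruct (isolated_punctured_disc E p rho z HE Hz) as (del & Hdel & Hiso).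
    assert (Hconst : forall u v, 0 < Cmod (u - z) < del -> 0 < Cmod (v - z) < del ->
      Q u -> Q v).
    { apply punctured_disc_locally_constant. intros w Hw. apply HQ; [apply Hiso; lra|].
      apply Hiso; [lra|]. intros ->. rewrite Cmod_minus_self in Hw. lra. }
    assert (all : forall w, Cmod (w - z) < del ->
      (Q' w <-> forall v, 0 < Cmod (v - z) < del -> Q v)).
    { intros w Hw. split.
      - intros (d & Hd & HQw) v Hv.
        destruct (nearby_point w z (Rmin d (del - Cmod (w - z)))) as (u & Hu & Hne).
        { apply Rmin_pos; lra. }
        pose_Rmin.
        apply (Hconst u v); [|exact Hv|apply HQw; lra].
        split.
        + apply Cmod_minus_pos, Hne.
        + assert (T := Cmod_triangle_minus u w z). lra.
      - intros Hall. destruct (classic (w = z)) as [->|Hne].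
        + exists del; split; [exact Hdel|]. exact Hall.
        + assert (Hp := Cmod_minus_pos _ _ Hne).
          exists (Rmin (del - Cmod (w - z)) (Cmod (w - z))); split; [apply Rmin_pos; lra|].
          intros v Hv.
          pose_Rmin.
          apply Hall. split.
          * assert (T := Cmod_triangle_minus w v z). rewrite (Cmod_minus_sym w v) in T. lra.
          * assert (T := Cmod_triangle_minus v w z). lra. }
    exists del; split; [exact Hdel|]. intros w Hw.
    rewrite (all w Hw), (all z); [reflexivity|].
    rewrite Cmod_minus_self; exact Hdel. }
  assert (HQQ : forall z, Cmod (z - p) < rho -> ~ E z -> (Q z <-> Q' z)).
  { intros z Hz HEz. destruct (HQ z Hz HEz) as (del & Hdel & H). split.
    - intros Hq. exists del; split; [exact Hdel|]. intros w Hw. apply H; [lra|exact Hq].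
    - intros (d & Hd & Hall).
      destruct (nearby_point z z (Rmin d del)) as (u & Hu & _); [apply Rmin_pos; lra|].
      pose_Rmin.
      apply (H u); [lra|]. apply Hall; lra. }
  intros z1 z2 H1 E1 H2 E2. rewrite (HQQ z1 H1 E1), (HQQ z2 H2 E2).
  apply segment_locally_constant. intros t Ht. apply HQ'.
  replace (z1 + t * (z2 - z1) - p)%C with (RtoC (1 - t) * (z1 - p) + RtoC t * (z2 - p))%C
    by (rewrite RtoC_minus; ring).
  eapply Rle_lt_trans; [apply Cmod_triangle|].
  rewrite !Cmod_mult, !Cmod_R, !Rabs_pos_eq by lra. apply convex_lt; lra.
Qed.

Lemma is_cseries_zero (u : nat -> C) s : (forall n, u n = 0%C) -> is_cseries u s -> s = 0%C.
Proof.
  intros H HS. assert (A := is_cseries_scal 0%C _ _ HS). replace (0 * s)%C with (RtoC 0) in A by ring.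
  eapply is_cseries_unique; [exact HS|]. revert A; apply is_cseries_ext; intros n; rewrite H; ring.
Qed.

(** Taylor's theorem reduces this to the order of vanishing of a power series. *)
Lemma hol_zero_dichotomy (h : C -> C) (z : C) rho : 0 < rho ->
  (forall w, Cmod (w - z) < rho -> hol h w) ->
  (exists del, 0 < del /\ forall w, Cmod (w - z) < del -> h w = 0%C) \/
  exists k m del, 0 < m /\ 0 < del /\
    forall w, Cmod (w - z) < del -> m * Cmod (w - z) ^ k <= Cmod (h w).
Proof.
  intros Hrho Hh.
  destruct (taylor h z rho (rho / 2) Hh) as [c Hc]; [lra|].
  assert (HF : forall w, Cmod w < rho / 2 -> is_cseries (fun n => c n * w ^ n)%C (h (z + w)%C)).
  { intros w Hw. specialize (Hc (z + w)%C). replace (z + w - z)%C with w in Hc by ring.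
    apply Hc, Hw. }
  destruct (is_cseries_geom_bounded c (RtoC (rho / 4)) _ (HF (RtoC (rho / 4))
    ltac:(rewrite Cmod_R, Rabs_pos_eq; lra))) as (M & _ & HM).
  rewrite Cmod_R, Rabs_pos_eq in HM by lra.
  destruct (pseries_order c M (rho / 4) (fun w => h (z + w)%C) HM) as [H0|(k & m & del & Hm & Hdel & H)];
    [lra|intros w Hw; apply HF; lra| |].
  - left. exists (rho / 2); split; [lra|]. intros w Hw.
    apply (is_cseries_zero (fun n => c n * (w - z) ^ n)%C); [|apply Hc, Hw].
    intros n; rewrite H0; ring.
  - right. exists k, m, del; repeat split; try assumption. intros w Hw.
    specialize (H (w - z)%C Hw). replace (z + (w - z))%C with w in H by ring. exact H.
Qed.

(** Being zero on a neighbourhood is a locally constant property, because zeros that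
    are not of this kind are isolated. *)
Theorem identity_theorem (h : C -> C) (E : C -> Prop) (p : C) (rho : R) (z1 : C) :
  isolated_in_disc E p rho ->
  (forall z, Cmod (z - p) < rho -> ~ E z -> hol h z) ->
  Cmod (z1 - p) < rho -> ~ E z1 ->
  (forall del, 0 < del -> exists w, 0 < Cmod (w - z1) < del /\ h w = 0%C) ->
  forall z, Cmod (z - p) < rho -> ~ E z -> h z = 0%C.
Proof.
  intros HE Hh Hz1 HEz1 Hacc z Hz HEz.
  set (Q := fun z => exists del, 0 < del /\ forall w, Cmod (w - z) < del -> h w = 0%C).
  assert (dich : forall z, Cmod (z - p) < rho -> ~ E z -> Q z \/
    exists del, 0 < del /\ forall w, 0 < Cmod (w - z) < del -> h w <> 0%C).
  { intros y Hy HEy. destruct (isolated_punctured_disc E p rho y HE Hy) as (del & Hdel & Hiso).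
    destruct (hol_zero_dichotomy h y del Hdel) as [H|(k & m & d & Hm & Hd & H)].
    - intros w Hw. destruct (classic (w = y)) as [->|Hne]; [apply Hh; assumption|].
      apply Hh; [apply Hiso, Hw|apply Hiso; assumption].
    - left; exact H.
    - right. exists d; split; [exact Hd|]. intros w Hw E0. specialize (H w (proj2 Hw)).
      rewrite E0, Cmod_0 in H. assert (0 < Cmod (w - y) ^ k) by (apply pow_lt, Hw). nra. }
  assert (HQ : Q z).
  { apply (disc_locally_constant Q E p rho HE) with z1; try assumption.
    - intros y Hy HEy. destruct (dich y Hy HEy) as [HQy|(del & Hdel & Hne)].
      + destruct HQy as (del & Hdel & H0). exists del; split; [exact Hdel|].
        intros w Hw; split; [intros _; exists del; split; assumption|].
        intros _. exists (del - Cmod (w - y)); split; [lra|]. intros v Hv. apply H0.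
        assert (T := Cmod_triangle_minus v w y). lra.
      + exists del; split; [exact Hdel|]. intros w Hw.
        split; intros (d & Hd & H0); exfalso.
        * destruct (nearby_point w y (Rmin d (del - Cmod (w - y)))) as (u & Hu & Huy).
          { apply Rmin_pos; lra. }
          pose_Rmin.
          apply (Hne u); [|apply H0; lra]. split.
          -- apply Cmod_minus_pos, Huy.
          -- assert (T := Cmod_triangle_minus u w y). lra.
        * destruct (nearby_point y y (Rmin d del)) as (u & Hu & _); [apply Rmin_pos; lra|].
          pose_Rmin.
          apply (Hne u); [lra|apply H0; lra].
    - destruct (dich z1 Hz1 HEz1) as [HQ|(del & Hdel & Hne)]; [exact HQ|exfalso].
      destruct (Hacc del Hdel) as (w & Hw & E0). exact (Hne w Hw E0). }
  destruct HQ as (del & Hdel & H). apply H.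
  rewrite Cmod_minus_self; exact Hdel.
Qed.

(** * Quaternions and their complex slices *)

Definition q0 (q : quat) : R := fst (fst (fst q)).
Definition q1 (q : quat) : R := snd (fst (fst q)).
Definition q2 (q : quat) : R := snd (fst q).
Definition q3 (q : quat) : R := snd q.

Lemma quat_eq (p q : quat) : q0 p = q0 q -> q1 p = q1 q -> q2 p = q2 q -> q3 p = q3 q -> p = q.
Proof.
  destruct p as [[[a b] c] d], q as [[[a' b'] c'] d']; unfold q0, q1, q2, q3; simpl.
  intros -> -> -> ->; reflexivity.
Qed.

(** When [J] is an imaginary unit this is a ring embedding and an isometry, which brings
    computations within one slice back to complex numbers. *)
Definition emb (J : quat) (w : C) : quat := slice_pt J (Re w) (Im w).

Ltac quat_unfold :=
  unfold emb, slice_pt, qreal, q0, q1, q2, q3, minus, plus, scal, opp, zero; simpl;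
  unfold mult, scal, plus, opp, zero, Re, Im; simpl; unfold mult, plus, opp; simpl.

Ltac quat_components :=
  repeat match goal with q : NormedModule.sort _ _ |- _ => destruct q as [[[? ?] ?] ?]
         | q : C |- _ => destruct q as [? ?] end;
  apply quat_eq; quat_unfold; change_eq_R.

Ltac quat_ring := quat_components; first [ring | symmetry; ring].

Lemma qmul_assoc (p q r : quat) : qmul (qmul p q) r = qmul p (qmul q r).
Proof. quat_ring. Qed.

Lemma qmul_plus_l (p q r : quat) : qmul (plus p q) r = plus (qmul p r) (qmul q r).
Proof. quat_ring. Qed.

Lemma qmul_plus_r (p q r : quat) : qmul p (plus q r) = plus (qmul p q) (qmul p r).
Proof. quat_ring. Qed.

Lemma qmul_scal_l x (p q : quat) : qmul (scal x p) q = scal x (qmul p q).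
Proof. quat_ring. Qed.

Lemma qmul_minus_l (p q r : quat) : qmul (minus p q) r = minus (qmul p r) (qmul q r).
Proof. quat_ring. Qed.

Lemma qmul_minus_r (p q r : quat) : qmul p (minus q r) = minus (qmul p q) (qmul p r).
Proof. quat_ring. Qed.

Lemma qmul_1_l (q : quat) : qmul (qreal 1) q = q.
Proof. unfold qreal; quat_ring. Qed.

Lemma qmul_1_r (q : quat) : qmul q (qreal 1) = q.
Proof. unfold qreal; quat_ring. Qed.

Lemma qmul_0_l (q : quat) : qmul zero q = zero.
Proof. quat_ring. Qed.

Lemma qmul_0_r (q : quat) : qmul q zero = zero.
Proof. quat_ring. Qed.

Lemma norm_quat_sq (q : quat) : norm q ^ 2 = q0 q ^ 2 + q1 q ^ 2 + q2 q ^ 2 + q3 q ^ 2.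
Proof.
  destruct q as [[[a b] c] d]. unfold q0, q1, q2, q3. cbn [fst snd].
  unfold norm; simpl; unfold prod_norm; simpl. unfold norm; simpl. unfold prod_norm; simpl.
  unfold norm; simpl. unfold prod_norm; simpl. unfold norm; simpl. unfold abs; simpl.
  assert (A : forall x, 0 <= Rabs x * (Rabs x * 1)).
  { intros x. rewrite Rmult_1_r, <- Rabs_mult. apply Rabs_pos. }
  assert (B : forall x, Rabs x * (Rabs x * 1) = x * x).
  { intros x. rewrite Rmult_1_r, <- Rabs_mult. apply Rabs_pos_eq. nra. }
  assert (S : forall x, 0 <= x -> sqrt x * (sqrt x * 1) = x).
  { intros x Hx. rewrite Rmult_1_r. apply sqrt_sqrt; exact Hx. }
  assert (A1 := A a). assert (A2 := A b). assert (A3 := A c). assert (A4 := A d).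
  rewrite !S by (try rewrite !S; try rewrite !S; lra).
  rewrite !B. ring.
Qed.

Lemma norm_quat_ge_0 (q : quat) : 0 <= norm q.
Proof. apply norm_ge_0. Qed.

Lemma norm_quat_eq (q : quat) x : 0 <= x ->
  q0 q ^ 2 + q1 q ^ 2 + q2 q ^ 2 + q3 q ^ 2 = x ^ 2 -> norm q = x.
Proof.
  intros Hx E. rewrite <- norm_quat_sq in E. assert (H := norm_quat_ge_0 q).
  apply Rsqr_inj; [exact H|exact Hx|]. unfold Rsqr. simpl in E. lra.
Qed.

Lemma norm_qmul (p q : quat) : norm (qmul p q) = norm p * norm q.
Proof.
  apply norm_quat_eq; [apply Rmult_le_pos; apply norm_quat_ge_0|].
  rewrite Rpow_mult_distr, !norm_quat_sq.
  destruct p as [[[a b] c] d], q as [[[a' b'] c'] d']; unfold q0, q1, q2, q3; simpl; ring.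
Qed.

Lemma norm_qconj (q : quat) : norm (qconj q) = norm q.
Proof.
  apply norm_quat_eq; [apply norm_quat_ge_0|]. rewrite norm_quat_sq.
  destruct q as [[[a b] c] d]; unfold q0, q1, q2, q3; simpl; ring.
Qed.

Lemma norm_qreal x : norm (qreal x) = Rabs x.
Proof.
  apply norm_quat_eq; [apply Rabs_pos|]. rewrite pow2_abs.
  unfold qreal, q0, q1, q2, q3; simpl; ring.
Qed.

Lemma norm_quat_zero : norm (zero : quat) = 0.
Proof. apply norm_zero. Qed.

Lemma norm_quat_gt_0 (q : quat) : q <> zero -> 0 < norm q.
Proof.
  intros H. destruct (Rle_lt_or_eq_dec _ _ (norm_quat_ge_0 q)) as [L|E]; [exact L|].
  exfalso; apply H, norm_eq_zero; symmetry; exact E.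
Qed.

Lemma Rabs_component_le (q : quat) :
  Rabs (q0 q) <= norm q /\ Rabs (q1 q) <= norm q /\ Rabs (q2 q) <= norm q /\ Rabs (q3 q) <= norm q.
Proof.
  assert (H := norm_quat_ge_0 q). assert (E := norm_quat_sq q).
  assert (K : forall x, x ^ 2 <= norm q ^ 2 -> Rabs x <= norm q).
  { intros x Hx. rewrite <- (Rabs_pos_eq (norm q)) by exact H. apply Rsqr_le_abs_0. unfold Rsqr. simpl in Hx. lra. }
  repeat split; apply K; rewrite E;
    assert (A0 := pow2_ge_0 (q0 q)); assert (A1 := pow2_ge_0 (q1 q));
    assert (A2 := pow2_ge_0 (q2 q)); assert (A3 := pow2_ge_0 (q3 q)); lra.
Qed.

Lemma imag_unit_spec (J : quat) : imag_unit J <->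
  q0 J = 0 /\ q1 J ^ 2 + q2 J ^ 2 + q3 J ^ 2 = 1.
Proof.
  destruct J as [[[a b] c] d]; unfold imag_unit, q0, q1, q2, q3; simpl. split.
  - intros E. unfold qreal, opp in E; simpl in E.
    injection E; clear E; intros E3 E2 E1 E0. unfold opp in *; simpl in *.
    assert (Ha : a = 0).
    { destruct (Req_dec a 0) as [Ha|Ha]; [exact Ha|exfalso].
      assert (b = 0) by (apply (Rmult_eq_reg_l a); lra).
      assert (c = 0) by (apply (Rmult_eq_reg_l a); lra).
      assert (d = 0) by (apply (Rmult_eq_reg_l a); lra). subst b c d.
      assert (0 <= a * a) by nra. lra. }
    subst a. split; [reflexivity|]. lra.
  - intros [-> E]. unfold qreal; quat_components; lra.
Qed.

(** For an imaginary unit [J] this is [Re q - i Re (J q)], a complex linear map for the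
    structure given by left multiplication by [J].  The maps [q |-> ell J (q v)], for
    [v] a quaternion, are complex linear too and separate points, so statements on
    quaternion valued functions along a slice reduce to complex valued ones, and no
    unit orthogonal to [J] has to be chosen. *)
Definition ell (J q : quat) : C :=
  (q0 q, q1 J * q1 q + q2 J * q2 q + q3 J * q3 q).

Lemma emb_components J (HJ : imag_unit J) w : q0 (emb J w) = Re w /\ q1 (emb J w) = Im w * q1 J /\
  q2 (emb J w) = Im w * q2 J /\ q3 (emb J w) = Im w * q3 J.
Proof.
  destruct (proj1 (imag_unit_spec J) HJ) as [H0 _].
  destruct J as [[[a b] c] d], w as [x y]; unfold q0 in H0; simpl in H0; subst a.
  quat_unfold; repeat split; ring.
Qed.

Lemma emb_mult J (HJ : imag_unit J) (w z : C) : qmul (emb J w) (emb J z) = emb J (w * z)%C.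
Proof.
  destruct (proj1 (imag_unit_spec J) HJ) as [H0 H1].
  destruct J as [[[a b] c] d], w as [x y], z as [x' y'].
  unfold q0, q1, q2, q3 in *; simpl in H0, H1; subst a.
  apply quat_eq; quat_unfold; change_eq_R; try ring.
  transitivity (x * x' - y * y' * (b * (b * 1) + c * (c * 1) + d * (d * 1))); [ring|].
  rewrite H1; ring.
Qed.

Lemma emb_minus J (w z : C) : emb J (w - z)%C = minus (emb J w) (emb J z).
Proof. unfold emb, slice_pt, qreal; quat_ring. Qed.

Lemma emb_real J x : emb J (RtoC x) = qreal x.
Proof. unfold emb, slice_pt, qreal; quat_ring. Qed.

Lemma norm_emb J (HJ : imag_unit J) w : norm (emb J w) = Cmod w.
Proof.
  apply norm_quat_eq; [apply Cmod_ge_0|]. rewrite Cmod2_alt.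
  destruct (emb_components J HJ w) as (-> & -> & -> & ->).
  destruct (proj1 (imag_unit_spec J) HJ) as [_ H1].
  replace (Im w ^ 2) with (Im w ^ 2 * (q1 J ^ 2 + q2 J ^ 2 + q3 J ^ 2)) by (rewrite H1; ring).
  ring.
Qed.

Lemma emb_pow J (HJ : imag_unit J) w n : qpow (emb J w) n = emb J (w ^ n)%C.
Proof.
  induction n as [|n IH]; [symmetry; apply emb_real|].
  change (qmul (emb J w) (qpow (emb J w) n) = emb J (w * w ^ n)%C).
  rewrite IH. apply emb_mult, HJ.
Qed.

Lemma qmul_qinv_l (q : quat) : q <> zero -> qmul (qinv q) q = qreal 1.
Proof.
  intros H. apply norm_quat_gt_0 in H. unfold qinv.
  assert (E := norm_quat_sq q). set (N := norm q) in *.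
  assert (HN : N ^ 2 <> 0) by (apply pow_nonzero; lra). clearbody N.
  destruct q as [[[a b] c] d]. unfold q0, q1, q2, q3 in E; cbn [fst snd] in E.
  rewrite qmul_scal_l.
  transitivity (scal (/ N ^ 2) (qreal (N ^ 2))).
  - f_equal. rewrite E. unfold qreal; quat_ring.
  - unfold qreal; quat_components; field; lra.
Qed.

Lemma norm_qinv (q : quat) : q <> zero -> norm (qinv q) = / norm q.
Proof.
  intros H. assert (H' := norm_quat_gt_0 q H).
  assert (E := f_equal (fun p : quat => norm p) (qmul_qinv_l q H)). cbv beta in E.
  rewrite norm_qmul, norm_qreal, Rabs_R1 in E.
  apply (Rmult_eq_reg_r (norm q)); [|lra]. rewrite Rinv_l; lra.
Qed.

Lemma emb_neq_0 J (HJ : imag_unit J) (w : C) : w <> 0%C -> emb J w <> zero.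
Proof.
  intros H E. apply Cmod_gt_0 in H. rewrite <- (norm_emb J HJ), E, norm_quat_zero in H. lra.
Qed.

Lemma qinv_emb J (HJ : imag_unit J) (w : C) : w <> 0%C -> qinv (emb J w) = emb J (/ w)%C.
Proof.
  intros H.
  assert (E := qmul_qinv_l _ (emb_neq_0 J HJ w H)).
  rewrite <- (qmul_1_r (qinv (emb J w))), <- (emb_real J).
  replace (RtoC 1) with (w * / w)%C by (field; exact H).
  rewrite <- (emb_mult J HJ), <- qmul_assoc, E, qmul_1_l. reflexivity.
Qed.

Lemma ell_emb_mul J (HJ : imag_unit J) w q : ell J (qmul (emb J w) q) = (w * ell J q)%C.
Proof.
  destruct (proj1 (imag_unit_spec J) HJ) as [H0 H1].
  destruct J as [[[a b] c] d], w as [x y], q as [[[e f] g] h].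
  unfold q0, q1, q2, q3 in *; simpl in H0, H1; subst a.
  apply injective_projections; unfold ell; quat_unfold; change_eq_R; [ring|].
  transitivity (x * (b * f + c * g + d * h) + y * e * (b * (b * 1) + c * (c * 1) + d * (d * 1)));
    [ring|rewrite H1; ring].
Qed.

Lemma ell_plus J p q : ell J (plus p q) = (ell J p + ell J q)%C.
Proof.
  destruct p as [[[a b] c] d], q as [[[a' b'] c'] d'].
  apply injective_projections; unfold ell; quat_unfold; ring.
Qed.

Lemma ell_minus J p q : ell J (minus p q) = (ell J p - ell J q)%C.
Proof.
  destruct p as [[[a b] c] d], q as [[[a' b'] c'] d'].
  apply injective_projections; unfold ell; quat_unfold; ring.
Qed.

Lemma ell_zero J : ell J zero = 0%C.
Proof.
  apply injective_projections; unfold ell; quat_unfold; ring.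
Qed.

Lemma Cmod_ell_le J (HJ : imag_unit J) q : Cmod (ell J q) <= 2 * norm q.
Proof.
  assert (A := proj1 (Rabs_component_le q)).
  assert (B := proj1 (Rabs_component_le (qmul J q))).
  assert (E : Im (ell J q) = - q0 (qmul J q)).
  { destruct (proj1 (imag_unit_spec J) HJ) as [H0 _].
    destruct J as [[[a b] c] d], q as [[[e f] g] h].
    unfold q0 in H0; simpl in H0; subst a. unfold ell, q0, q1, q2, q3; simpl; ring. }
  assert (HN : norm J = 1).
  { apply norm_quat_eq; [lra|]. destruct (proj1 (imag_unit_spec J) HJ) as [H0 H1].
    rewrite H0; lra. }
  rewrite norm_qmul, HN in B.
  eapply Rle_trans; [apply Cmod_le_Re_Im|]. rewrite E, Rabs_Ropp.
  change (Re (ell J q)) with (q0 q). lra.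
Qed.

Definition qi : quat := (0, 1, 0, 0).
Definition qj : quat := (0, 0, 1, 0).
Definition qk : quat := (0, 0, 0, 1).

Lemma ell_components J q :
  q0 q = Re (ell J (qmul q (qreal 1))) /\ q1 q = Re (ell J (qmul q (opp qi))) /\
  q2 q = Re (ell J (qmul q (opp qj))) /\ q3 q = Re (ell J (qmul q (opp qk))).
Proof.
  destruct q as [[[a b] c] d]; unfold ell, qi, qj, qk; quat_unfold; repeat split; symmetry; change_eq_R; ring.
Qed.

Lemma ell_separates J p q : (forall v, ell J (qmul p v) = ell J (qmul q v)) -> p = q.
Proof.
  intros H. destruct (ell_components J p) as (A & B & C & D).
  destruct (ell_components J q) as (A' & B' & C' & D').
  apply quat_eq; rewrite ?A, ?B, ?C, ?D, ?A', ?B', ?C', ?D', H; reflexivity.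
Qed.

(** A left inverse of [q |-> (ell J (q v))] for [v = 1, i, j, k]: half the sum of the
    [emb J (ell J (q v))] times the conjugate of [v].  It makes sense for any four
    complex numbers, which is how quaternionic Taylor coefficients are assembled. *)
Definition from_ell (J : quat) (c : quat -> C) : quat :=
  scal (/ 2) (plus (plus (qmul (emb J (c (qreal 1))) (qreal 1)) (qmul (emb J (c qi)) (opp qi)))
                   (plus (qmul (emb J (c qj)) (opp qj)) (qmul (emb J (c qk)) (opp qk)))).

Lemma from_ell_ell J q : imag_unit J -> from_ell J (fun v => ell J (qmul q v)) = q.
Proof.
  intros HJ. destruct (proj1 (imag_unit_spec J) HJ) as [H0 H1].
  destruct J as [[[a b] c] d], q as [[[e f] g] h].
  unfold q0, q1, q2, q3 in *; simpl in H0, H1; subst a.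
  apply quat_eq; unfold from_ell, ell, qi, qj, qk; quat_unfold; change_eq_R.
  - transitivity (/ 2 * e * (1 + (b * (b * 1) + c * (c * 1) + d * (d * 1)))); [ring|].
    rewrite H1; field.
  - transitivity (/ 2 * f * (1 + (b * (b * 1) + c * (c * 1) + d * (d * 1)))); [ring|].
    rewrite H1; field.
  - transitivity (/ 2 * g * (1 + (b * (b * 1) + c * (c * 1) + d * (d * 1)))); [ring|].
    rewrite H1; field.
  - transitivity (/ 2 * h * (1 + (b * (b * 1) + c * (c * 1) + d * (d * 1)))); [ring|].
    rewrite H1; field.
Qed.

(** * Holomorphy along a slice *)

Lemma hol_ext_locally (phi psi : C -> C) w del : 0 < del ->
  (forall z, Cmod (z - w) < del -> phi z = psi z) -> hol phi w -> hol psi w.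
Proof.
  intros Hdel H [d Hd]. exists d. intros eps Heps. destruct (Hd eps Heps) as (e & He & Hz).
  exists (Rmin del e); split; [apply Rmin_pos; assumption|]. intros z Hzw.
  pose_Rmin.
  rewrite <- (H z), <- (H w); [apply Hz; lra| |lra].
  rewrite Cmod_minus_self; exact Hdel.
Qed.

Lemma hol_plus phi psi w : hol phi w -> hol psi w -> hol (fun z => phi z + psi z)%C w.
Proof.
  intros [d Hd] [e He]. exists (d + e)%C. intros eps Heps.
  destruct (Hd (eps / 2)) as (d1 & Hd1 & H1); [lra|].
  destruct (He (eps / 2)) as (d2 & Hd2 & H2); [lra|].
  exists (Rmin d1 d2); split; [apply Rmin_pos; assumption|]. intros z Hz.
  pose_Rmin.
  specialize (H1 z ltac:(lra)). specialize (H2 z ltac:(lra)).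
  replace (phi z + psi z - (phi w + psi w) - (d + e) * (z - w))%C with
    ((phi z - phi w - d * (z - w)) + (psi z - psi w - e * (z - w)))%C by ring.
  eapply Rle_trans; [apply Cmod_triangle|]. lra.
Qed.

Lemma hol_const c w : hol (fun _ => c) w.
Proof.
  exists 0%C. intros eps Heps. exists 1; split; [lra|]. intros z _.
  replace (c - c - 0 * (z - w))%C with (RtoC 0) by ring. rewrite Cmod_0.
  assert (H := Cmod_ge_0 (z - w)). nra.
Qed.

Lemma hol_id w : hol (fun z => z) w.
Proof.
  exists 1%C. intros eps Heps. exists 1; split; [lra|]. intros z _.
  replace (z - w - 1 * (z - w))%C with (RtoC 0) by ring. rewrite Cmod_0.
  assert (H := Cmod_ge_0 (z - w)). nra.
Qed.

Lemma hol_minus_const c w : hol (fun z => z - c)%C w.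
Proof. apply (hol_plus (fun z => z) (fun _ => - c)%C); [apply hol_id|apply hol_const]. Qed.

Lemma hol_mult phi psi w : hol phi w -> hol psi w -> hol (fun z => phi z * psi z)%C w.
Proof.
  intros [d Hd] [e He].
  (* The derivative is found by linearity; the product of the two increments is of second order. *)
  assert (A0 := hol_plus _ _ w (hol_scal _ _ (psi w) (ex_intro _ d Hd))
                 (hol_scal _ _ (phi w) (ex_intro _ e He))).
  destruct (is_cderiv_lipschitz _ _ _ Hd) as (K1 & d1 & HK1 & Hd1 & L1).
  destruct (is_cderiv_lipschitz _ _ _ He) as (K2 & d2 & HK2 & Hd2 & L2).
  destruct A0 as [f Hf]. exists f. intros eps Heps.
  destruct (Hf (eps / 2)) as (d3 & Hd3 & L3); [lra|].
  set (d4 := eps / (2 * (K1 * K2))).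
  assert (Hd4 : 0 < d4).
  { unfold d4. apply Rdiv_lt_0_compat; [lra|]. nra. }
  exists (Rmin (Rmin d1 d2) (Rmin d3 d4)); split; [repeat apply Rmin_pos; assumption|].
  intros z Hz.
  pose_Rmin.
  specialize (L1 z ltac:(lra)). specialize (L2 z ltac:(lra)). specialize (L3 z ltac:(lra)).
  replace (phi z * psi z - phi w * psi w - f * (z - w))%C with
    ((psi w * phi z + phi w * psi z - (psi w * phi w + phi w * psi w) - f * (z - w))
     + (phi z - phi w) * (psi z - psi w))%C by ring.
  eapply Rle_trans; [apply Cmod_triangle|]. rewrite Cmod_mult.
  assert (N := Cmod_ge_0 (z - w)).
  assert (P : Cmod (phi z - phi w) * Cmod (psi z - psi w)
     <= (K1 * Cmod (z - w)) * (K2 * Cmod (z - w))).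
  { apply Rmult_le_compat; try apply Cmod_ge_0; assumption. }
  assert (Q : K1 * K2 * Cmod (z - w) <= eps / 2).
  { replace (eps / 2) with (K1 * K2 * d4) by (unfold d4; field; lra).
    apply Rmult_le_compat_l; nra. }
  nra.
Qed.

Lemma hol_pow phi w n : hol phi w -> hol (fun z => phi z ^ n)%C w.
Proof.
  intros H; induction n as [|n IH]; simpl; [apply hol_const|].
  apply (hol_mult phi (fun z => phi z ^ n)%C); assumption.
Qed.

Lemma hol_translate phi (w c : C) : hol phi (w + c)%C -> hol (fun z => phi (z + c)%C) w.
Proof.
  intros [d Hd]; exists d; intros eps Heps; destruct (Hd eps Heps) as (del & Hdel & H).
  exists del; split; [exact Hdel|]; intros z Hz.
  specialize (H (z + c)%C). replace (z + c - (w + c))%C with (z - w)%C in H by ring.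
  apply H, Hz.
Qed.

Lemma is_series_prod (U V : NormedModule R_AbsRing) (u : nat -> U * V) (s : U * V) :
  @is_series R_AbsRing (prod_NormedModule R_AbsRing U V) u s <->
  is_series (fun n => fst (u n)) (fst s) /\ is_series (fun n => snd (u n)) (snd s).
Proof.
  assert (F : forall n, fst (@sum_n (prod_AbelianMonoid U V) u n) = sum_n (fun k => fst (u k)) n).
  { induction n as [|n IH]; [rewrite !sum_O; reflexivity|].
    rewrite !sum_Sn, <- IH; reflexivity. }
  assert (S : forall n, snd (@sum_n (prod_AbelianMonoid U V) u n) = sum_n (fun k => snd (u k)) n).
  { induction n as [|n IH]; [rewrite !sum_O; reflexivity|].
    rewrite !sum_Sn, <- IH; reflexivity. }
  unfold is_series. split.
  - intros H. split.
    + apply filterlim_locally; intros eps.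
      generalize (proj1 (filterlim_locally _ _) H eps). apply filter_imp; intros n [A _].
      rewrite <- F; exact A.
    + apply filterlim_locally; intros eps.
      generalize (proj1 (filterlim_locally _ _) H eps). apply filter_imp; intros n [_ A].
      rewrite <- S; exact A.
  - intros [A B]. apply filterlim_locally; intros eps.
    generalize (filter_and _ _ (proj1 (filterlim_locally _ _) A eps)
      (proj1 (filterlim_locally _ _) B eps)).
    apply filter_imp; intros n [A' B']; split; [rewrite F|rewrite S]; assumption.
Qed.

Lemma is_series_quat (u : nat -> quat) (s : quat) : is_series u s <->
  is_series (fun n => q0 (u n)) (q0 s) /\ is_series (fun n => q1 (u n)) (q1 s) /\
  is_series (fun n => q2 (u n)) (q2 s) /\ is_series (fun n => q3 (u n)) (q3 s).
Proof.
  unfold quat in *. rewrite is_series_prod, is_series_prod, is_series_prod.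
  unfold q0, q1, q2, q3. tauto.
Qed.

Lemma is_cseries_ell J (u : nat -> quat) s v : is_series u s ->
  is_cseries (fun n => ell J (qmul (u n) v)) (ell J (qmul s v)).
Proof.
  intros H. apply is_series_quat in H. destruct H as (A & B & C & D).
  assert (L : forall x y z t, is_series
     (fun n => (x * q0 (u n) + y * q1 (u n)) + (z * q2 (u n) + t * q3 (u n)))
     ((x * q0 s + y * q1 s) + (z * q2 s + t * q3 s))).
  { intros x y z t. apply (is_series_plus (V := R_NormedModule));
      apply is_series_lincomb; assumption. }
  destruct v as [[[a b] c] d].
  set (m1 := q1 J). set (m2 := q2 J). set (m3 := q3 J).
  split.
  - specialize (L a (- b) (- c) (- d)).
    match type of L with is_series _ ?l => assert (E : l = Re (ell J (qmul s (a, b, c, d)))) end.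
    { destruct s as [[[e f] g] h]. unfold ell; quat_unfold; change_eq_R; ring. }
    rewrite E in L. revert L; apply is_series_ext; intros n. destruct (u n) as [[[e f] g] h].
    unfold ell; quat_unfold; change_eq_R; ring.
  - specialize (L (m1 * b + m2 * c + m3 * d) (m1 * a - m2 * d + m3 * c)
      (m1 * d + m2 * a - m3 * b) (- m1 * c + m2 * b + m3 * a)).
    match type of L with is_series _ ?l => assert (E : l = Im (ell J (qmul s (a, b, c, d)))) end.
    { destruct s as [[[e f] g] h]. unfold ell. fold m1 m2 m3. clearbody m1 m2 m3.
      quat_unfold; change_eq_R; ring. }
    rewrite E in L. revert L; apply is_series_ext; intros n. destruct (u n) as [[[e f] g] h].
    unfold ell. fold m1 m2 m3. clearbody m1 m2 m3. quat_unfold; change_eq_R; ring.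
Qed.

(** The real parts of [ell J (q v)] for [v = 1, - i, - j, - k] are the four components
    of [q]. *)
Lemma is_series_of_ell J (u : nat -> quat) s :
  (forall v, is_cseries (fun n => ell J (qmul (u n) v)) (ell J (qmul s v))) -> is_series u s.
Proof.
  intros H. apply is_series_quat.
  destruct (ell_components J s) as (-> & -> & -> & ->).
  repeat split.
  - apply (is_series_ext (fun n => Re (ell J (qmul (u n) (qreal 1))))); [|exact (proj1 (H (qreal 1)))].
    intros n; symmetry; apply (ell_components J (u n)).
  - apply (is_series_ext (fun n => Re (ell J (qmul (u n) (opp qi))))); [|exact (proj1 (H (opp qi)))].
    intros n; symmetry; apply (ell_components J (u n)).
  - apply (is_series_ext (fun n => Re (ell J (qmul (u n) (opp qj))))); [|exact (proj1 (H (opp qj)))].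
    intros n; symmetry; apply (ell_components J (u n)).
  - apply (is_series_ext (fun n => Re (ell J (qmul (u n) (opp qk))))); [|exact (proj1 (H (opp qk)))].
    intros n; symmetry; apply (ell_components J (u n)).
Qed.

Lemma is_series_quat_unique (u : nat -> quat) s t : is_series u s -> is_series u t -> s = t.
Proof.
  intros A B. apply (ell_separates qi). intros v.
  eapply is_cseries_unique; [apply (is_cseries_ell qi u s v A)|apply is_cseries_ell; exact B].
Qed.

Lemma qSeries_correct (u : nat -> quat) s : is_series u s -> qSeries u = s.
Proof.
  intros H. apply is_series_quat in H. destruct H as (A & B & C & D).
  apply quat_eq; apply is_series_unique; assumption.
Qed.

(** Testing on the complex linear maps [q |-> ell J (q v)] turns each closure property
    into the corresponding one for complex functions. *)
Definition slice_hol (J : quat) (G : C -> quat) (w : C) : Prop :=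
  forall v, hol (fun z => ell J (qmul (G z) v)) w.

Lemma slice_hol_ext_locally J (G H : C -> quat) w del : 0 < del ->
  (forall z, Cmod (z - w) < del -> G z = H z) -> slice_hol J G w -> slice_hol J H w.
Proof.
  intros Hdel E HG v. apply (hol_ext_locally (fun z => ell J (qmul (G z) v)) _ w del Hdel);
    [|apply HG]. intros z Hz; rewrite E by exact Hz; reflexivity.
Qed.

Lemma slice_hol_minus J G H w : slice_hol J G w -> slice_hol J H w -> slice_hol J (fun z => minus (G z) (H z)) w.
Proof.
  intros HG HH v.
  apply (hol_ext_locally (fun z => ell J (qmul (G z) v) + - (1) * ell J (qmul (H z) v))%C _ w 1);
    [lra| |].
  - intros z _. rewrite qmul_minus_l, ell_minus. ring.
  - apply hol_plus; [apply HG|]. apply (hol_scal (fun z => ell J (qmul (H z) v))), HH.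
Qed.

Lemma slice_hol_emb_mul J phi G w : imag_unit J -> hol phi w -> slice_hol J G w ->
  slice_hol J (fun z => qmul (emb J (phi z)) (G z)) w.
Proof.
  intros HJ Hphi HG v.
  apply (hol_ext_locally (fun z => phi z * ell J (qmul (G z) v))%C _ w 1); [lra| |].
  - intros z _. rewrite qmul_assoc, ell_emb_mul by exact HJ. reflexivity.
  - apply (hol_mult phi); [exact Hphi|apply HG].
Qed.

Lemma slice_hol_of_bound J (G : C -> quat) w (d : quat) : imag_unit J ->
  (forall eps, 0 < eps -> exists del, 0 < del /\ forall z, Cmod (z - w) < del ->
     norm (minus (minus (G z) (G w)) (qmul (emb J (z - w)%C) d)) <= eps * Cmod (z - w)) ->
  slice_hol J G w.
Proof.
  intros HJ H v. exists (ell J (qmul d v)). intros eps Heps.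
  assert (Hv := norm_quat_ge_0 v).
  destruct (H (eps / (2 * (1 + norm v)))) as (del & Hdel & Hz).
  { apply Rdiv_lt_0_compat; lra. }
  exists del; split; [exact Hdel|]. intros z Hzw. specialize (Hz z Hzw).
  replace (ell J (qmul (G z) v) - ell J (qmul (G w) v) - ell J (qmul d v) * (z - w))%C
    with (ell J (qmul (minus (minus (G z) (G w)) (qmul (emb J (z - w)%C) d)) v)).
  - eapply Rle_trans; [apply Cmod_ell_le; exact HJ|]. rewrite norm_qmul.
    assert (N := norm_quat_ge_0 (minus (minus (G z) (G w)) (qmul (emb J (z - w)%C) d))).
    assert (Nz := Cmod_ge_0 (z - w)).
    replace (eps * Cmod (z - w)) with
      (2 * ((eps / (2 * (1 + norm v)) * Cmod (z - w)) * (1 + norm v))) by (field; lra).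
    apply Rmult_le_compat_l; [lra|].
    apply Rle_trans with (norm (minus (minus (G z) (G w)) (qmul (emb J (z - w)%C) d)) * (1 + norm v)).
    + apply Rmult_le_compat_l; lra.
    + apply Rmult_le_compat_r; [lra|exact Hz].
  - rewrite !qmul_minus_l, !ell_minus, qmul_assoc, ell_emb_mul by exact HJ. ring.
Qed.

Lemma norm_quat_scal x (q : quat) : norm (scal x q) = Rabs x * norm q.
Proof.
  replace (scal x q) with (qmul (qreal x) q) by (unfold qreal; quat_ring).
  rewrite norm_qmul, norm_qreal; reflexivity.
Qed.

Lemma is_derive_quat_bound (g : R -> quat) (x : R) (d : quat) :
  @is_derive R_AbsRing quat g x d -> forall eps, 0 < eps ->
  exists r, 0 < r /\ forall h, Rabs h < r ->
    norm (minus (minus (g (x + h)) (g x)) (scal h d)) <= eps * Rabs h.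
Proof.
  intros [_ Hd] eps Heps.
  destruct (Hd x (fun P HP => HP) (mkposreal eps Heps)) as [r Hr].
  exists r; split; [apply cond_pos|]. intros h Hh.
  assert (Ex : h = (x + h) + - x) by ring.
  assert (B : ball x r (x + h)).
  { unfold ball; simpl; unfold AbsRing_ball, abs, minus, plus, opp; simpl.
    rewrite <- Ex; exact Hh. }
  specialize (Hr (x + h) B). rewrite Ex at 2 3. exact Hr.
Qed.

Lemma filterdiff_quat_bound (f l : quat -> quat) (q : quat) :
  filterdiff f (locally q) l -> forall eps, 0 < eps ->
  exists r, 0 < r /\ forall p, norm (minus p q) < r ->
    norm (minus (minus (f p) (f q)) (l (minus p q))) <= eps * norm (minus p q).
Proof.
  intros [_ Hl] eps Heps.
  destruct (locally_norm_le_locally (V := quat) q _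
    (Hl q (fun P HP => HP) (mkposreal eps Heps))) as [r Hr].
  exists r; split; [apply cond_pos|]. exact Hr.
Qed.

Lemma quat_minus_eq (p q : quat) : norm (minus p q) = 0 -> p = q.
Proof.
  intros Z. apply norm_eq_zero in Z.
  replace p with (plus (minus p q) q) by (clear; quat_ring). rewrite Z. clear.
  quat_ring.
Qed.

(** Moving from [q] in the direction [e], both the Frechet derivative and the
    derivative along the line approximate the increment to first order. *)
Lemma is_derive_along (f : quat -> quat) (q e d : quat) (l : quat -> quat) (g : R -> quat) (x : R) :
  filterdiff f (locally q) l ->
  (forall h, g (x + h) = plus q (scal h e)) ->
  @is_derive R_AbsRing quat (fun t => f (g t)) x d -> l e = d.
Proof.
  intros Hf Hg Hd.
  assert (Hs : forall h, l (scal h e) = scal h (l e)).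
  { intros h; apply (linear_scal l (proj1 Hf)). }
  assert (gx : g x = q).
  { replace x with (x + 0) by ring. rewrite Hg. clear. quat_ring. }
  assert (gm : forall h, minus (g (x + h)) q = scal h e).
  { intros h; rewrite Hg. clear. quat_ring. }
  assert (He := norm_quat_ge_0 e).
  assert (small : forall eps, 0 < eps -> norm (minus (l e) d) <= eps * (1 + norm e)).
  { intros eps Heps.
    destruct (filterdiff_quat_bound f l q Hf eps Heps) as (r1 & P1 & Hr1).
    destruct (is_derive_quat_bound _ x d Hd eps Heps) as (r2 & P2 & Hr2).
    set (h := Rmin (r1 / (2 * (1 + norm e))) (r2 / 2)).
    assert (Hh : 0 < h).
    { apply Rmin_pos; [apply Rdiv_lt_0_compat; lra|lra]. }
    assert (h1 : h <= r1 / (2 * (1 + norm e))) by apply Rmin_l.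
    assert (h2 : h <= r2 / 2) by apply Rmin_r.
    clearbody h.
    assert (Nh : forall p : quat, norm (scal h p) = h * norm p).
    { intros p. rewrite norm_quat_scal, Rabs_pos_eq; lra. }
    specialize (Hr1 (g (x + h))). rewrite gm, Nh, Hs in Hr1.
    assert (B1 : h * norm e < r1).
    { apply Rle_lt_trans with (r1 / (2 * (1 + norm e)) * (1 + norm e)).
      - apply Rmult_le_compat; lra.
      - replace (r1 / (2 * (1 + norm e)) * (1 + norm e)) with (r1 / 2) by (field; lra). lra. }
    specialize (Hr1 B1).
    specialize (Hr2 h). rewrite gx, Rabs_pos_eq in Hr2 by lra.
    specialize (Hr2 ltac:(lra)).
    assert (T : norm (scal h (minus (l e) d)) <= h * (eps * (1 + norm e))).
    { replace (scal h (minus (l e) d)) with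
        (plus (minus (minus (f (g (x + h))) (f q)) (scal h d))
           (opp (minus (minus (f (g (x + h))) (f q)) (scal h (l e))))).
      - eapply Rle_trans; [apply norm_triangle|].
        replace (h * (eps * (1 + norm e))) with (eps * h + eps * (h * norm e)) by ring.
        apply Rplus_le_compat; [exact Hr2|].
        eapply Rle_trans; [right; apply norm_opp|exact Hr1].
      - generalize (l e) (f (g (x + h))) (f q). clear. intros. quat_ring. }
    rewrite Nh in T. apply (Rmult_le_reg_l h); assumption. }
  apply quat_minus_eq, Rle_antisym; [|apply norm_ge_0]. apply Rnot_lt_le; intros Hp.
  assert (Hq : 0 < norm (minus (l e) d) / (2 * (1 + norm e))) by (apply Rdiv_lt_0_compat; lra).
  specialize (small _ Hq).
  replace (norm (minus (l e) d) / (2 * (1 + norm e)) * (1 + norm e))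
    with (norm (minus (l e) d) / 2) in small by (field; lra). lra.
Qed.

(** A regular function is real differentiable and satisfies the Cauchy-Riemann
    equation [d/dy = J d/dx] on the slice, so its differential restricted to the slice
    is multiplication of increments by a fixed quaternion. *)
Lemma regular_slice_hol (f : pfun) J w : regular f -> imag_unit J -> dom f (emb J w) ->
  slice_hol J (fun z => f (emb J z)) w.
Proof.
  intros (_ & Hdiff & HCR) HJ Hw.
  destruct (HCR J (Re w) (Im w) HJ Hw) as (dx & dy & Hdx & Hdy & E).
  destruct (Hdiff _ Hw) as [l Hl].
  assert (E1 : l (qreal 1) = dx).
  { apply (is_derive_along f (emb J w) (qreal 1) dx l (fun t => slice_pt J t (Im w)) (Re w) Hl);
      [|exact Hdx]. intros t. quat_ring. }
  assert (E2 : l J = dy).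
  { apply (is_derive_along f (emb J w) J dy l (fun t => slice_pt J (Re w) t) (Im w) Hl);
      [|exact Hdy]. intros t. quat_ring. }
  assert (E3 : dy = qmul J dx).
  { assert (A : plus dx (qmul J dy) = zero).
    { replace (plus dx (qmul J dy)) with (scal 2 (scal (/ 2) (plus dx (qmul J dy))))
        by (generalize (qmul J dy); intros p; clear; quat_components; field).
      rewrite E. clear. quat_ring. }
    apply (f_equal (qmul J)) in A. rewrite qmul_plus_r, <- qmul_assoc, HJ, qmul_0_r in A.
    revert A. generalize (qmul J dx). clear. intros p A.
    replace dy with (minus p (plus p (qmul (opp (qreal 1)) dy))) by (quat_ring).
    rewrite A. quat_ring. }
  apply (slice_hol_of_bound J _ w dx HJ). intros eps Heps.
  destruct (filterdiff_quat_bound f l _ Hl eps Heps) as (r & Hrpos & Hr).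
  destruct Hl as [Hlin _].
  exists r; split; [exact Hrpos|]. intros z Hz. specialize (Hr (emb J z)).
  rewrite <- emb_minus, (norm_emb J HJ) in Hr. specialize (Hr Hz). simpl in Hr.
  replace (qmul (emb J (z - w)%C) dx) with (l (emb J (z - w)%C)); [exact Hr|].
  unfold emb at 1, slice_pt.
  replace (qreal (Re (z - w))) with (scal (Re (z - w)) (qreal 1) : quat)
    by (unfold qreal; generalize (Re (z - w)); clear; intros; quat_ring).
  rewrite (linear_plus l Hlin), !(linear_scal l Hlin), E1, E2, E3.
  unfold emb, slice_pt. rewrite qmul_plus_l, qmul_scal_l. f_equal.
  unfold qreal. generalize (Re (z - w)); clear; intros; quat_ring.
Qed.

Lemma ell_scal J x q : ell J (scal x q) = (RtoC x * ell J q)%C.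
Proof.
  destruct q as [[[a b] c] d].
  apply injective_projections; unfold ell; quat_unfold; ring.
Qed.

Lemma ell_from_ell J (c : quat -> C) v : imag_unit J ->
  ell J (qmul (from_ell J c) v) =
  ((c (qreal 1) * (/ 2 * ell J (qmul (qreal 1) v)) + c qi * (/ 2 * ell J (qmul (opp qi) v)))
   + (c qj * (/ 2 * ell J (qmul (opp qj) v)) + c qk * (/ 2 * ell J (qmul (opp qk) v))))%C.
Proof.
  intros HJ. unfold from_ell.
  rewrite qmul_scal_l, ell_scal, !qmul_plus_l, !ell_plus, !qmul_assoc, !ell_emb_mul by exact HJ.
  rewrite RtoC_inv by lra. ring.
Qed.

(** Apply the complex theorem to the four functions [ell J (G v)] and assemble the
    coefficients with [from_ell], which is linear over the slice. *)
Theorem slice_taylor J (G : C -> quat) z0 rho r : imag_unit J ->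
  (forall w, Cmod (w - z0) < rho -> slice_hol J G w) -> 0 < r < rho ->
  exists b : nat -> quat, forall w, Cmod (w - z0) < r ->
    is_series (fun n => qmul (emb J ((w - z0) ^ n)%C) (b n)) (G w).
Proof.
  intros HJ HG Hr.
  assert (HT : forall v, exists c, forall w, Cmod (w - z0) < r ->
    is_cseries (fun n => c n * (w - z0) ^ n)%C (ell J (qmul (G w) v))).
  { intros v. apply (taylor (fun w => ell J (qmul (G w) v)) z0 rho r); [|exact Hr].
    intros w Hw; apply HG, Hw. }
  set (c := fun v => proj1_sig (constructive_indefinite_description _ (HT v))).
  assert (Hc : forall v w, Cmod (w - z0) < r ->
    is_cseries (fun n => c v n * (w - z0) ^ n)%C (ell J (qmul (G w) v))).
  { intros v. exact (proj2_sig (constructive_indefinite_description _ (HT v))). }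
  exists (fun n => from_ell J (fun v => c v n)). intros w Hw.
  apply (is_series_of_ell J). intros v.
  rewrite <- (from_ell_ell J (G w) HJ). rewrite ell_from_ell by exact HJ.
  assert (K : forall e x, is_cseries (fun n => x * (c e n * (w - z0) ^ n))%C (x * ell J (qmul (G w) e))%C).
  { intros e x. apply is_cseries_scal, Hc, Hw. }
  eapply is_cseries_ext; [|
    assert (S := is_cseries_plus _ _ _ _
      (is_cseries_plus _ _ _ _ (K (qreal 1) (/ 2 * ell J (qmul (qreal 1) v))%C)
                       (K qi (/ 2 * ell J (qmul (opp qi) v))%C))
      (is_cseries_plus _ _ _ _ (K qj (/ 2 * ell J (qmul (opp qj) v))%C)
                       (K qk (/ 2 * ell J (qmul (opp qk) v))%C)));
    match type of S with is_cseries _ ?s => match goal with |- is_cseries _ ?t =>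
      replace t with s by ring end end; exact S].
  intros n. cbv beta. rewrite qmul_assoc, ell_emb_mul, ell_from_ell by exact HJ. ring.
Qed.

Lemma power_series_slice_hol J (b : nat -> quat) (G : C -> quat) z0 r w : imag_unit J ->
  (forall z, Cmod (z - z0) < r -> is_series (fun n => qmul (emb J ((z - z0) ^ n)%C) (b n)) (G z)) ->
  Cmod (w - z0) < r -> slice_hol J G w.
Proof.
  intros HJ HG Hw v.
  set (r' := (Cmod (w - z0) + r) / 2).
  assert (H0 := Cmod_ge_0 (w - z0)).
  set (c := fun n => ell J (qmul (b n) v)).
  assert (HF : forall z, Cmod z < r -> is_cseries (fun n => c n * z ^ n)%C (ell J (qmul (G (z + z0)%C) v))).
  { intros z Hz. assert (A := HG (z + z0)%C). replace (z + z0 - z0)%C with z in A by ring.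
    specialize (A Hz). apply (is_cseries_ell J _ _ v) in A. revert A; apply is_cseries_ext; intros n.
    rewrite qmul_assoc, ell_emb_mul by exact HJ. unfold c; ring. }
  assert (Hr' : Cmod (w - z0) < r' < r) by (unfold r'; lra).
  destruct (is_cseries_geom_bounded c (RtoC r') _ (HF (RtoC r')
    ltac:(rewrite Cmod_R, Rabs_pos_eq; lra))) as (M & _ & HM).
  rewrite Cmod_R, Rabs_pos_eq in HM by lra.
  assert (A : hol (fun z => ell J (qmul (G (z + z0)%C) v)) (w - z0)%C).
  { apply (pseries_hol c M r'); [exact HM|lra|intros z Hz; apply HF; lra|lra]. }
  assert (B := hol_translate (fun z => ell J (qmul (G (z + z0)%C) v)) w (- z0)%C A).
  revert B. apply (hol_ext_locally _ _ w 1); [lra|]. intros z _.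
  replace (z + - z0 + z0)%C with z by ring. reflexivity.
Qed.

(** A function that is [O(|z - w|^2)] at [w] has derivative 0 there.  Multiplying by two
    extra powers of [z - w] therefore removes a singularity without Riemann's
    theorem. *)
Lemma slice_hol_of_quadratic_bound J (G : C -> quat) w M del : imag_unit J -> 0 < del ->
  (forall z, Cmod (z - w) < del -> norm (G z) <= M * Cmod (z - w) ^ 2) -> slice_hol J G w.
Proof.
  intros HJ Hdel H.
  assert (G0 : G w = zero).
  { apply norm_eq_zero, Rle_antisym; [|apply norm_ge_0].
    specialize (H w). rewrite Cmod_minus_self in H.
    specialize (H Hdel). lra. }
  apply (slice_hol_of_bound J G w zero HJ). intros eps Heps.
  assert (HM := Rabs_pos M).
  exists (Rmin del (eps / (1 + Rabs M))); split.
  { apply Rmin_pos; [exact Hdel|apply Rdiv_lt_0_compat; lra]. }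
  intros z Hz. pose_Rmin.
  assert (Hz' : Cmod (z - w) < del) by lra.
  rewrite G0, qmul_0_r.
  match goal with |- norm ?x <= _ => replace x with (G z)
    by (generalize (G z); clear; intros; quat_ring) end.
  eapply Rle_trans; [exact (H z Hz')|].
  assert (N := Cmod_ge_0 (z - w)).
  assert (C1 : (1 + Rabs M) * Cmod (z - w) <= eps).
  { replace eps with ((1 + Rabs M) * (eps / (1 + Rabs M))) by (field; lra).
    apply Rmult_le_compat_l; lra. }
  assert (C2 := Rle_abs M). simpl. rewrite Rmult_1_r, <- Rmult_assoc.
  apply Rmult_le_compat_r; [exact N|].
  apply Rle_trans with ((1 + Rabs M) * Cmod (z - w)); [|exact C1].
  apply Rmult_le_compat_r; lra.
Qed.

Lemma norm_quat_le_components (q : quat) :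
  norm q <= Rabs (q0 q) + Rabs (q1 q) + Rabs (q2 q) + Rabs (q3 q).
Proof.
  assert (E := norm_quat_sq q). assert (N := norm_quat_ge_0 q).
  assert (R0 := Rabs_pos (q0 q)). assert (R1 := Rabs_pos (q1 q)).
  assert (R2 := Rabs_pos (q2 q)). assert (R3 := Rabs_pos (q3 q)).
  rewrite <- (pow2_abs (q0 q)), <- (pow2_abs (q1 q)), <- (pow2_abs (q2 q)), <- (pow2_abs (q3 q)) in E.
  set (a := Rabs (q0 q)) in *. set (b := Rabs (q1 q)) in *. set (c := Rabs (q2 q)) in *.
  set (d := Rabs (q3 q)) in *. clearbody a b c d.
  apply Rsqr_incr_0; [|exact N|lra]. unfold Rsqr. simpl in E.
  assert (P1 := Rmult_le_pos _ _ R0 R1). assert (P2 := Rmult_le_pos _ _ R0 R2).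
  assert (P3 := Rmult_le_pos _ _ R0 R3). assert (P4 := Rmult_le_pos _ _ R1 R2).
  assert (P5 := Rmult_le_pos _ _ R1 R3). assert (P6 := Rmult_le_pos _ _ R2 R3). lra.
Qed.

Lemma norm_le_ell J q : norm q <=
  Cmod (ell J (qmul q (qreal 1))) + Cmod (ell J (qmul q (opp qi))) +
  Cmod (ell J (qmul q (opp qj))) + Cmod (ell J (qmul q (opp qk))).
Proof.
  destruct (ell_components J q) as (A & B & C & D).
  eapply Rle_trans; [apply norm_quat_le_components|]. rewrite A, B, C, D.
  repeat apply Rplus_le_compat; apply re_le_Cmod.
Qed.

Lemma hol_locally_bounded phi w : hol phi w ->
  exists K del, 0 < K /\ 0 < del /\ forall z, Cmod (z - w) < del -> Cmod (phi z) <= K.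
Proof.
  intros [d Hd]. destruct (is_cderiv_continuous _ _ _ Hd 1 Rlt_0_1) as (del & Hdel & H).
  exists (1 + Cmod (phi w)), del. assert (N := Cmod_ge_0 (phi w)).
  repeat split; [lra|exact Hdel|]. intros z Hz. specialize (H z Hz).
  assert (T := Cmod_minus_ge (phi z) (phi w)). lra.
Qed.

Lemma slice_hol_locally_bounded J (G : C -> quat) w : slice_hol J G w ->
  exists K del, 0 < K /\ 0 < del /\ forall z, Cmod (z - w) < del -> norm (G z) <= K.
Proof.
  intros HG.
  assert (B := fun v => hol_locally_bounded _ w (HG v)).
  destruct (B (qreal 1)) as (K0 & d0 & P0 & Q0 & H0).
  destruct (B (opp qi)) as (K1 & d1 & P1 & Q1 & H1).
  destruct (B (opp qj)) as (K2 & d2 & P2 & Q2 & H2).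
  destruct (B (opp qk)) as (K3 & d3 & P3 & Q3 & H3).
  exists (K0 + K1 + K2 + K3), (Rmin (Rmin d0 d1) (Rmin d2 d3)).
  split; [lra|]. split; [repeat apply Rmin_pos; assumption|]. intros z Hz.
  pose_Rmin.
  eapply Rle_trans; [apply (norm_le_ell J)|].
  specialize (H0 z ltac:(lra)). specialize (H1 z ltac:(lra)).
  specialize (H2 z ltac:(lra)). specialize (H3 z ltac:(lra)). lra.
Qed.

Lemma slice_hol_zero_dichotomy J (G : C -> quat) z rho : imag_unit J -> 0 < rho ->
  (forall w, Cmod (w - z) < rho -> slice_hol J G w) ->
  (exists del, 0 < del /\ forall w, Cmod (w - z) < del -> G w = zero) \/
  exists k m del, 0 < m /\ 0 < del /\
    forall w, Cmod (w - z) < del -> m * Cmod (w - z) ^ k <= norm (G w).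
Proof.
  intros HJ Hrho HG.
  assert (D := fun v => hol_zero_dichotomy (fun w => ell J (qmul (G w) v)) z rho Hrho
                          (fun w Hw => HG w Hw v)).
  assert (lower : forall v, (exists k m del, 0 < m /\ 0 < del /\ forall w, Cmod (w - z) < del ->
      m * Cmod (w - z) ^ k <= Cmod (ell J (qmul (G w) v))) ->
    exists k m del, 0 < m /\ 0 < del /\
      forall w, Cmod (w - z) < del -> m * Cmod (w - z) ^ k <= norm (G w)).
  { intros v (k & m & del & Hm & Hdel & H).
    assert (Nv := norm_quat_ge_0 v).
    exists k, (m / (2 * (1 + norm v))), del; repeat split; [|exact Hdel|].
    { apply Rdiv_lt_0_compat; lra. }
    intros w Hw. specialize (H w Hw).
    assert (B := Cmod_ell_le J HJ (qmul (G w) v)). rewrite norm_qmul in B.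
    assert (Ng := norm_quat_ge_0 (G w)).
    apply (Rmult_le_reg_l (2 * (1 + norm v))); [lra|].
    replace (2 * (1 + norm v) * (m / (2 * (1 + norm v)) * Cmod (w - z) ^ k))
      with (m * Cmod (w - z) ^ k) by (field; lra). nra. }
  destruct (D (qreal 1)) as [(d0 & Q0 & H0)|L]; [|right; apply (lower _ L)].
  destruct (D (opp qi)) as [(d1 & Q1 & H1)|L]; [|right; apply (lower _ L)].
  destruct (D (opp qj)) as [(d2 & Q2 & H2)|L]; [|right; apply (lower _ L)].
  destruct (D (opp qk)) as [(d3 & Q3 & H3)|L]; [|right; apply (lower _ L)].
  left. exists (Rmin (Rmin d0 d1) (Rmin d2 d3)); split; [repeat apply Rmin_pos; assumption|].
  intros w Hw.
  pose_Rmin.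
  destruct (ell_components J (G w)) as (A & B & C & E).
  rewrite H0 in A by lra. rewrite H1 in B by lra. rewrite H2 in C by lra. rewrite H3 in E by lra.
  apply quat_eq; [rewrite A|rewrite B|rewrite C|rewrite E]; reflexivity.
Qed.

(** Near the centre [p] all real points but [p] are outside [E], so the zeros
    accumulate at a real point of the domain. *)
Theorem slice_identity J (G : C -> quat) (E : C -> Prop) (p rho : R) : imag_unit J -> 0 < rho ->
  isolated_in_disc E p rho ->
  (forall z, Cmod (z - p) < rho -> ~ E z -> slice_hol J G z) ->
  (forall x : R, Rabs (x - p) < rho -> ~ E x -> G (RtoC x) = zero) ->
  forall z, Cmod (z - p) < rho -> ~ E z -> G z = zero.
Proof.
  intros HJ Hrho HE HG Hreal z Hz HEz.
  destruct (isolated_punctured_disc E p rho p HE) as (del & Hdel & Hiso).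
  { rewrite Cmod_minus_self; exact Hrho. }
  assert (real_ok : forall x : R, 0 < Rabs (x - p) < del -> Rabs (x - p) < rho /\ ~ E x).
  { intros x Hx. assert (A : Cmod (x - p) = Rabs (x - p)).
    { rewrite <- RtoC_minus; apply Cmod_R. }
    rewrite <- A. rewrite <- A in Hx. split; [apply Hiso; lra|].
    apply Hiso; [lra|]. intros E0. rewrite E0 in Hx.
    rewrite Cmod_minus_self in Hx. lra. }
  set (x1 := p + del / 2).
  assert (D1 : Rabs (x1 - p) = del / 2).
  { unfold x1; replace (p + del / 2 - p) with (del / 2) by ring. apply Rabs_pos_eq; lra. }
  destruct (real_ok x1) as [R1 R2]; [lra|].
  apply (ell_separates J). intros v. rewrite qmul_0_l, ell_zero.
  apply (identity_theorem (fun z => ell J (qmul (G z) v)) E p rho (RtoC x1) HE);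
    [intros y Hy HEy; apply (HG y Hy HEy)| |exact R2| |exact Hz|exact HEz].
  { rewrite <- RtoC_minus, Cmod_R; exact R1. }
  intros d Hd. set (h := Rmin (d / 2) (del / 4)).
  assert (Hh : 0 < h) by (apply Rmin_pos; lra).
  assert (h1 : h <= d / 2) by apply Rmin_l. assert (h2 : h <= del / 4) by apply Rmin_r.
  exists (RtoC (x1 + h)). split.
  - rewrite <- RtoC_minus, Cmod_R. replace (x1 + h - x1) with h by ring.
    rewrite Rabs_pos_eq; lra.
  - assert (Dx : Rabs (x1 + h - p) = del / 2 + h).
    { unfold x1; replace (p + del / 2 + h - p) with (del / 2 + h) by ring. apply Rabs_pos_eq; lra. }
    destruct (real_ok (x1 + h)) as [R3 R4]; [lra|].
    rewrite (Hreal _ R3 R4), qmul_0_l. apply ell_zero.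
Qed.

(** * Quaternionic power series and Laurent series *)

Lemma is_series_emb_mul J c (u : nat -> quat) s : imag_unit J -> is_series u s ->
  is_series (fun n => qmul (emb J c) (u n)) (qmul (emb J c) s).
Proof.
  intros HJ H. apply (is_series_of_ell J). intros v.
  rewrite qmul_assoc, ell_emb_mul by exact HJ.
  generalize (is_cseries_scal c _ _ (is_cseries_ell J u s v H)). apply is_cseries_ext; intros n.
  rewrite qmul_assoc, ell_emb_mul by exact HJ. reflexivity.
Qed.

Lemma is_series_quat_tail (u : nat -> quat) s :
  is_series u s <-> is_series (fun n => u (S n)) (minus s (u O)).
Proof.
  split; intros H; apply (is_series_of_ell qi); intros v.
  - generalize (proj1 (is_cseries_tail _ _) (is_cseries_ell qi u s v H)).
    rewrite qmul_minus_l, ell_minus. exact (fun h => h).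
  - apply is_cseries_tail. generalize (is_cseries_ell qi _ _ v H). rewrite qmul_minus_l, ell_minus.
    exact (fun h => h).
Qed.

Lemma is_series_quat_zero : is_series (fun _ : nat => zero : quat) zero.
Proof.
  apply (is_series_of_ell qi). intros v. rewrite qmul_0_l, ell_zero.
  assert (A : is_series (fun _ : nat => 0) 0).
  { apply is_series_Reals. intros eps Heps. exists O. intros n _.
    rewrite sum_eq_R0 by reflexivity. unfold Rdist. rewrite Rminus_0_r, Rabs_R0. exact Heps. }
  split; exact A.
Qed.

(** The Laurent coefficients of [zeta^(-N) * sum zeta^n b n]. *)
Definition shifted_coeff (b : nat -> quat) (N : nat) (n : Z) : quat :=
  if Z_lt_dec (n + Z.of_nat N) 0 then zero else b (Z.to_nat (n + Z.of_nat N)).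

Lemma shifted_coeff_nonneg b N n : shifted_coeff b N (Z.of_nat n) = b (n + N)%nat.
Proof.
  unfold shifted_coeff. destruct (Z_lt_dec _ _); [lia|]. f_equal; lia.
Qed.

Lemma shifted_coeff_vanish b N m : (N < m)%nat -> shifted_coeff b N (- Z.of_nat m) = zero.
Proof. intros H. unfold shifted_coeff. destruct (Z_lt_dec _ _); [reflexivity|lia]. Qed.

(** Dividing by [zeta] moves the constant term from the nonnegative to the negative
    part of the series. *)
Lemma laurent_of_power_series J (zeta : C) (b : nat -> quat) g N : imag_unit J ->
  zeta <> 0%C -> is_series (fun n => qmul (emb J (zeta ^ n)%C) (b n)) g ->
  exists u v,
    is_series (fun n => qmul (emb J (zeta ^ n)%C) (shifted_coeff b N (Z.of_nat n))) u /\
    is_series (fun n => qmul (emb J ((/ zeta) ^ S n)%C) (shifted_coeff b N (- Z.of_nat (S n))%Z)) v /\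
    qmul (emb J ((/ zeta) ^ N)%C) g = plus u v.
Proof.
  intros HJ Hz H. induction N as [|N IH].
  - exists g, zero. split; [|split].
    + revert H; apply is_series_ext; intros n. rewrite shifted_coeff_nonneg, Nat.add_0_r. reflexivity.
    + generalize is_series_quat_zero; apply is_series_ext; intros n.
      rewrite shifted_coeff_vanish by lia. symmetry; apply qmul_0_r.
    + change ((/ zeta) ^ 0)%C with (RtoC 1). rewrite emb_real, qmul_1_l.
      clear; quat_ring.
  - destruct IH as (u & v & Hu & Hv & E).
    set (s := emb J (/ zeta)%C).
    exists (qmul s (minus u (b N))), (plus (qmul s (b N)) (qmul s v)). split; [|split].
    + apply (proj1 (is_series_quat_tail _ _)), (is_series_emb_mul J (/ zeta)%C _ _ HJ) in Hu.
      cbv beta in Hu. rewrite shifted_coeff_nonneg in Hu. simpl (0 + N)%nat in Hu.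
      change (zeta ^ 0)%C with (RtoC 1) in Hu. rewrite emb_real, qmul_1_l in Hu.
      revert Hu; apply is_series_ext; intros n.
      rewrite <- qmul_assoc, emb_mult, !shifted_coeff_nonneg by exact HJ.
      replace (S n + N)%nat with (n + S N)%nat by lia. f_equal. f_equal.
      change (zeta ^ S n)%C with (zeta * zeta ^ n)%C. field. exact Hz.
    + apply is_series_quat_tail.
      assert (E0 : shifted_coeff b (S N) (- Z.of_nat 1) = b N).
      { unfold shifted_coeff. destruct (Z_lt_dec _ _); [lia|]. f_equal; lia. }
      rewrite E0.
      replace (minus (plus (qmul s (b N)) (qmul s v)) (qmul (emb J ((/ zeta) ^ 1)%C) (b N)))
        with (qmul s v).
      * apply (is_series_emb_mul J (/ zeta)%C _ _ HJ) in Hv.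
        revert Hv; apply is_series_ext; intros n.
        rewrite <- qmul_assoc, emb_mult by exact HJ. f_equal.
        unfold shifted_coeff.
        destruct (Z_lt_dec (- Z.of_nat (S n) + Z.of_nat N) 0),
          (Z_lt_dec (- Z.of_nat (S (S n)) + Z.of_nat (S N)) 0); try lia; [reflexivity|].
        f_equal; lia.
      * replace ((/ zeta) ^ 1)%C with (/ zeta)%C by (simpl; ring). fold s.
        generalize (qmul s (b N)) (qmul s v). clear. intros. quat_ring.
    + change ((/ zeta) ^ S N)%C with (/ zeta * (/ zeta) ^ N)%C.
      rewrite <- emb_mult, qmul_assoc, E by exact HJ. fold s.
      rewrite qmul_minus_r, qmul_plus_r.
      generalize (qmul s (b N)) (qmul s v) (qmul s u). clear. intros. quat_ring.
Qed.

(** The inverse process: each multiplication by [zeta] lowers the order of the pole by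
    one. *)
Lemma power_series_of_laurent J (zeta : C) N : imag_unit J -> zeta <> 0%C ->
  forall (a : Z -> quat) u v,
  (forall m, (N < m)%nat -> a (- Z.of_nat m)%Z = zero) ->
  is_series (fun n => qmul (emb J (zeta ^ n)%C) (a (Z.of_nat n))) u ->
  is_series (fun n => qmul (emb J ((/ zeta) ^ S n)%C) (a (- Z.of_nat (S n))%Z)) v ->
  is_series (fun n => qmul (emb J (zeta ^ n)%C) (a (Z.of_nat n - Z.of_nat N)%Z))
    (qmul (emb J (zeta ^ N)%C) (plus u v)).
Proof.
  intros HJ Hz. induction N as [|N IH]; intros a u v Ha Hu Hv.
  - assert (Ev : v = zero).
    { eapply is_series_quat_unique; [exact Hv|].
      generalize is_series_quat_zero; apply is_series_ext; intros n.
      rewrite Ha by lia. symmetry; apply qmul_0_r. }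
    subst v. change (zeta ^ 0)%C with (RtoC 1). rewrite emb_real, qmul_1_l.
    replace (plus u zero) with u by (clear; quat_ring).
    revert Hu; apply is_series_ext; intros n. f_equal. f_equal. lia.
  - set (s := emb J zeta).
    assert (Hu' : is_series (fun n => qmul (emb J (zeta ^ n)%C) (a (Z.of_nat n - 1)%Z))
                    (plus (a (- 1)%Z) (qmul s u))).
    { apply is_series_quat_tail. change (zeta ^ 0)%C with (RtoC 1). rewrite emb_real, qmul_1_l.
      replace (minus (plus (a (-1)%Z) (qmul s u)) (a (Z.of_nat 0 - 1)%Z)) with (qmul s u)
        by (change (Z.of_nat 0 - 1)%Z with (-1)%Z; generalize (qmul s u) (a (-1)%Z); clear;
            intros; quat_ring).
      apply (is_series_emb_mul J zeta _ _ HJ) in Hu. revert Hu; apply is_series_ext; intros n.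
      rewrite <- qmul_assoc, emb_mult by exact HJ. f_equal. f_equal. lia. }
    assert (Hv' : is_series (fun n => qmul (emb J ((/ zeta) ^ S n)%C) (a (- Z.of_nat (S n) - 1)%Z))
                    (minus (qmul s v) (a (- 1)%Z))).
    { apply (proj1 (is_series_quat_tail _ _)), (is_series_emb_mul J zeta _ _ HJ) in Hv.
      fold s in Hv. cbv beta in Hv.
      assert (Ec : qmul s (minus v (qmul (emb J ((/ zeta) ^ 1)%C) (a (- Z.of_nat 1)%Z)))
                   = minus (qmul s v) (a (- 1)%Z)).
      { rewrite qmul_minus_r. f_equal. rewrite <- qmul_assoc. unfold s.
        rewrite emb_mult by exact HJ.
        replace (zeta * (/ zeta) ^ 1)%C with (RtoC 1) by (simpl; field; exact Hz).
        rewrite emb_real. apply qmul_1_l. }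
      rewrite Ec in Hv.
      revert Hv; apply is_series_ext; intros n. unfold s.
      rewrite <- qmul_assoc, emb_mult by exact HJ. f_equal; [|f_equal; lia].
      f_equal. change ((/ zeta) ^ S (S n))%C with (/ zeta * (/ zeta) ^ S n)%C.
      field. exact Hz. }
    assert (Ha' : forall m, (N < m)%nat -> a (- Z.of_nat m - 1)%Z = zero).
    { intros m Hm. replace (- Z.of_nat m - 1)%Z with (- Z.of_nat (S m))%Z by lia.
      apply Ha; lia. }
    assert (R := IH (fun n => a (n - 1)%Z) _ _ Ha' Hu' Hv').
    replace (plus (plus (a (-1)%Z) (qmul s u)) (minus (qmul s v) (a (-1)%Z)))
      with (qmul s (plus u v)) in R.
    + unfold s in R. rewrite <- qmul_assoc, emb_mult in R by exact HJ.
      replace (zeta ^ S N)%C with (zeta ^ N * zeta)%C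
        by (change (zeta ^ S N)%C with (zeta * zeta ^ N)%C; ring).
      revert R; apply is_series_ext; intros n. cbv beta. f_equal. f_equal. lia.
    + rewrite qmul_plus_r. generalize (qmul s u) (qmul s v) (a (-1)%Z). clear. intros.
      quat_ring.
Qed.

Lemma qzpow_emb_nonneg J (z : C) n : imag_unit J -> qzpow (emb J z) (Z.of_nat n) = emb J (z ^ n)%C.
Proof.
  intros HJ. destruct n as [|n]; [simpl; symmetry; apply emb_real|].
  simpl Z.of_nat. unfold qzpow. rewrite SuccNat2Pos.id_succ. apply emb_pow, HJ.
Qed.

Lemma qzpow_emb_neg J (z : C) n : imag_unit J -> z <> 0%C ->
  qzpow (emb J z) (- Z.of_nat (S n)) = emb J ((/ z) ^ S n)%C.
Proof.
  intros HJ Hz. simpl Z.of_nat. unfold qzpow. simpl Z.opp. cbv iota.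
  rewrite SuccNat2Pos.id_succ, qinv_emb by assumption. apply emb_pow, HJ.
Qed.

Definition qbounded (a : nat -> quat) (x : R) : Prop :=
  exists M, 0 < M /\ forall n, norm (a n) * x ^ n <= M.

Lemma is_series_quat_bounded (u : nat -> quat) s : is_series u s ->
  exists M, 0 < M /\ forall n, norm (u n) <= M.
Proof.
  intros H. apply is_series_quat in H. destruct H as (A & B & C & D).
  destruct (ex_series_bounded _ (ex_intro _ _ A)) as (M1 & P1 & H1).
  destruct (ex_series_bounded _ (ex_intro _ _ B)) as (M2 & P2 & H2).
  destruct (ex_series_bounded _ (ex_intro _ _ C)) as (M3 & P3 & H3).
  destruct (ex_series_bounded _ (ex_intro _ _ D)) as (M4 & P4 & H4).
  exists (M1 + M2 + M3 + M4); split; [lra|]. intros n.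
  specialize (H1 n). specialize (H2 n). specialize (H3 n). specialize (H4 n).
  eapply Rle_trans; [apply norm_quat_le_components|]. lra.
Qed.

Lemma ex_series_quat_dominated (u : nat -> quat) (v : nat -> R) :
  (forall n, norm (u n) <= v n) -> ex_series v -> ex_series u.
Proof.
  intros H Hv.
  assert (cv : forall t : nat -> R, (forall n, Rabs (t n) <= norm (u n)) -> ex_series t).
  { intros t Ht. apply (ex_series_le (V := R_CompleteNormedModule) t v); [|exact Hv].
    intros n. eapply Rle_trans; [apply Ht|apply H]. }
  destruct (cv (fun n => q0 (u n))) as [s0 H0]; [intros n; apply (Rabs_component_le (u n))|].
  destruct (cv (fun n => q1 (u n))) as [s1 H1]; [intros n; apply (Rabs_component_le (u n))|].
  destruct (cv (fun n => q2 (u n))) as [s2 H2]; [intros n; apply (Rabs_component_le (u n))|].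
  destruct (cv (fun n => q3 (u n))) as [s3 H3]; [intros n; apply (Rabs_component_le (u n))|].
  exists ((s0, s1, s2, s3) : quat). apply is_series_quat. repeat split; assumption.
Qed.

Lemma norm_qpow (q : quat) n : norm (qpow q n) = norm q ^ n.
Proof.
  induction n as [|n IH]; [change (norm (qreal 1) = 1); rewrite norm_qreal; apply Rabs_R1|].
  change (norm (qmul q (qpow q n)) = norm q * norm q ^ n). rewrite norm_qmul, IH; reflexivity.
Qed.

Lemma in_D_bounded r a x : in_D r a -> 0 < x < r -> qbounded a x.
Proof.
  intros H Hx. destruct (H (qreal x)) as [s Hs].
  { unfold qball. rewrite norm_qreal, Rabs_pos_eq by lra. simpl. lra. }
  destruct (is_series_quat_bounded _ _ Hs) as (M & HM & B).
  exists M; split; [exact HM|]. intros n. specialize (B n). unfold pterm in B.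
  rewrite norm_qmul, norm_qpow, norm_qreal, Rabs_pos_eq in B by lra. lra.
Qed.

Lemma bounded_in_D r a : (forall x, 0 < x < r -> qbounded a x) -> in_D r a.
Proof.
  intros H q Hq. unfold qball in Hq; simpl in Hq. assert (Nq := norm_quat_ge_0 q).
  set (x := (norm q + r) / 2).
  assert (Hx : norm q < x < r) by (unfold x; lra).
  destruct (H x ltac:(lra)) as (M & HM & B).
  apply (ex_series_quat_dominated _ (fun n => M * (norm q / x) ^ n)).
  - intros n. unfold pterm. rewrite norm_qmul, norm_qpow.
    assert (Hp : 0 < x ^ n) by (apply pow_lt; lra).
    unfold Rdiv. rewrite Rpow_mult_distr, pow_inv.
    assert (Hw : 0 <= norm q ^ n) by (apply pow_le; exact Nq).
    apply (Rmult_le_reg_r (x ^ n)); [exact Hp|].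
    replace (M * (norm q ^ n * / x ^ n) * x ^ n) with (M * norm q ^ n) by (field; lra).
    replace (norm q ^ n * norm (a n) * x ^ n) with (norm (a n) * x ^ n * norm q ^ n) by ring.
    apply Rmult_le_compat_r; [exact Hw|apply B].
  - eexists. apply is_series_geom_ratio; lra.
Qed.

Lemma sum_pow_le y n : 0 <= y < 1 -> sum_n (fun k => y ^ k) n <= / (1 - y).
Proof.
  intros Hy.
  assert (E : sum_n (fun k => y ^ k) n = (1 - y ^ S n) / (1 - y)).
  { induction n as [|n IH]; [rewrite sum_O; simpl; field; lra|].
    rewrite sum_Sn, IH. unfold plus; simpl. field; lra. }
  rewrite E. unfold Rdiv. rewrite <- (Rmult_1_l (/ (1 - y))) at 2.
  apply Rmult_le_compat_r; [left; apply Rinv_0_lt_compat; lra|].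
  assert (0 <= y ^ S n) by (apply pow_le; lra). lra.
Qed.

Lemma norm_sum_n_le (u : nat -> quat) (v : nat -> R) n :
  (forall k, (k <= n)%nat -> norm (u k) <= v k) -> norm (sum_n u n) <= sum_n v n.
Proof.
  induction n as [|n IH]; intros H; [rewrite !sum_O; apply H; lia|].
  rewrite !sum_Sn. eapply Rle_trans; [apply norm_triangle|].
  apply Rplus_le_compat; [apply IH; intros; apply H; lia|apply H; lia].
Qed.

(** Bound [a] at a radius [x'] larger than [x], so that the terms of the convolution at
    [x] are dominated by a geometric sum. *)
Lemma in_D_star r a b : in_D r a -> in_D r b -> in_D r (star a b).
Proof.
  intros Ha Hb. apply bounded_in_D. intros x Hx.
  set (x' := (x + r) / 2). assert (Hx' : x < x' < r) by (unfold x'; lra).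
  destruct (in_D_bounded r a x' Ha ltac:(lra)) as (M & HM & BM).
  destruct (in_D_bounded r b x Hb Hx) as (M' & HM' & BM').
  set (y := x / x').
  assert (Hy : 0 <= y < 1).
  { unfold y; split; [apply Rdiv_le_0_compat; lra|apply Rlt_div_l; lra]. }
  exists (M * M' * / (1 - y)). split.
  { apply Rmult_lt_0_compat; [nra|apply Rinv_0_lt_compat; lra]. }
  intros n. unfold star.
  assert (Hxn : 0 < x ^ n) by (apply pow_lt; lra).
  apply Rle_trans with (sum_n (fun k => (M * M' / x ^ n) * y ^ k) n * x ^ n).
  - apply Rmult_le_compat_r; [lra|]. apply norm_sum_n_le. intros k Hk. rewrite norm_qmul.
    specialize (BM k). specialize (BM' (n - k)%nat).
    assert (Hn : x ^ n = x ^ k * x ^ (n - k)) by (rewrite <- pow_add; f_equal; lia).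
    assert (P1 : 0 < x ^ k) by (apply pow_lt; lra).
    assert (P2 : 0 < x ^ (n - k)) by (apply pow_lt; lra).
    assert (P3 : 0 < x' ^ k) by (apply pow_lt; lra).
    rewrite Hn. unfold y, Rdiv. rewrite Rpow_mult_distr, pow_inv.
    apply (Rmult_le_reg_r (x' ^ k * x ^ (n - k))); [apply Rmult_lt_0_compat; lra|].
    replace (M * M' * / (x ^ k * x ^ (n - k)) * (x ^ k * / x' ^ k) * (x' ^ k * x ^ (n - k)))
      with (M * M') by (field; lra).
    replace (norm (a k) * norm (b (n - k)%nat) * (x' ^ k * x ^ (n - k)))
      with ((norm (a k) * x' ^ k) * (norm (b (n - k)%nat) * x ^ (n - k))) by ring.
    apply Rmult_le_compat; try assumption; apply Rmult_le_pos; try apply norm_quat_ge_0; lra.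
  - assert (E : sum_n (fun k => (M * M' / x ^ n) * y ^ k) n
              = (M * M' / x ^ n) * sum_n (fun k => y ^ k) n).
    { exact (sum_n_mult_l (K := R_Ring) (M * M' / x ^ n) (fun k => y ^ k) n). }
    rewrite E. assert (S := sum_pow_le y n Hy).
    replace (M * M' / x ^ n * sum_n (fun k => y ^ k) n * x ^ n)
      with (M * M' * sum_n (fun k => y ^ k) n) by (field; lra).
    apply Rmult_le_compat_l; [nra|exact S].
Qed.

Lemma in_D_reg_conj r a : in_D r a -> in_D r (reg_conj a).
Proof.
  intros Ha. apply bounded_in_D. intros x Hx.
  destruct (in_D_bounded r a x Ha Hx) as (M & HM & B). exists M; split; [exact HM|].
  intros n; unfold reg_conj; rewrite norm_qconj; apply B.
Qed.

Lemma psum_correct r a q : in_D r a -> norm q < r -> is_series (pterm a q) (psum a q).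
Proof.
  intros Ha Hq. destruct (Ha q Hq) as [s Hs].
  unfold psum. rewrite (qSeries_correct _ _ Hs). exact Hs.
Qed.

Lemma psum_slice r a J z : imag_unit J -> in_D r a -> Cmod z < r ->
  is_series (fun n => qmul (emb J ((z - 0) ^ n)%C) (a n)) (psum a (emb J z)).
Proof.
  intros HJ Ha Hz.
  assert (H := psum_correct r a (emb J z) Ha). rewrite norm_emb in H by exact HJ.
  specialize (H Hz). revert H; apply is_series_ext; intros n.
  unfold pterm. rewrite emb_pow by exact HJ. replace (z - 0)%C with z by ring. reflexivity.
Qed.

Lemma psum_slice_hol r a J z : imag_unit J -> in_D r a -> Cmod z < r ->
  slice_hol J (fun w => psum a (emb J w)) z.
Proof.
  intros HJ Ha Hz.
  apply (power_series_slice_hol J a _ 0%C r z HJ).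
  - intros w Hw. apply (psum_slice r); [exact HJ|exact Ha|].
    replace (w - 0)%C with w in Hw by ring; exact Hw.
  - replace (z - 0)%C with z by ring; exact Hz.
Qed.

(** By the identity theorem the sum vanishes on the whole slice of the ball, in
    particular near 0, where its order of vanishing would be finite if some
    coefficient were nonzero. *)
Lemma psum_locally_zero r a J w del : imag_unit J -> in_D r a -> Cmod w < r -> 0 < del ->
  (forall z, Cmod (z - w) < del -> psum a (emb J z) = zero) -> forall n, a n = zero.
Proof.
  intros HJ Ha Hw Hdel H0.
  assert (C0 : forall z, (z - 0)%C = z) by (intros; ring).
  assert (Hr : 0 < r) by (assert (H := Cmod_ge_0 w); lra).
  assert (A : forall v n, ell J (qmul (a n) v) = 0%C).
  { intros v.
    assert (Z : forall z, Cmod z < r -> ell J (qmul (psum a (emb J z)) v) = 0%C).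
    { intros z Hz.
      apply (identity_theorem (fun z => ell J (qmul (psum a (emb J z)) v)) (fun _ => False) 0%C r w).
      - intros y _; exists 1; split; [lra|]. intros x _ F; exact F.
      - intros y Hy _. rewrite C0 in Hy. apply (psum_slice_hol r a J y HJ Ha Hy v).
      - rewrite C0; exact Hw.
      - exact (fun F => F).
      - intros d Hd. destruct (nearby_point w w (Rmin d del)) as (u & Hu & _);
          [apply Rmin_pos; assumption|].
        pose_Rmin.
        exists u; split; [lra|]. rewrite H0 by lra. rewrite qmul_0_l. apply ell_zero.
      - rewrite C0; exact Hz.
      - exact (fun F => F). }
    set (c := fun n => ell J (qmul (a n) v)).
    assert (HF : forall z, Cmod z < r -> is_cseries (fun n => c n * z ^ n)%C 0%C).
    { intros z Hz. rewrite <- (Z z Hz).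
      generalize (is_cseries_ell J _ _ v (psum_slice r a J z HJ Ha Hz)). apply is_cseries_ext; intros n.
      rewrite qmul_assoc, ell_emb_mul, C0 by exact HJ. unfold c; ring. }
    destruct (is_cseries_geom_bounded c (RtoC (r / 2)) _ (HF (RtoC (r / 2))
      ltac:(rewrite Cmod_R, Rabs_pos_eq; lra))) as (M & _ & HM).
    rewrite Cmod_R, Rabs_pos_eq in HM by lra.
    destruct (pseries_order c M (r / 2) (fun _ => 0%C) HM) as [E|(k & m & d & Hm & Hd & L)];
      [lra|intros z Hz; apply HF; lra|exact E|exfalso].
    assert (Hh : Cmod (RtoC (d / 2)) = d / 2) by (rewrite Cmod_R, Rabs_pos_eq; lra).
    specialize (L (RtoC (d / 2))). rewrite Hh, Cmod_0 in L. specialize (L ltac:(lra)).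
    assert (0 < (d / 2) ^ k) by (apply pow_lt; lra). nra. }
  intros n. apply (ell_separates J). intros v. rewrite A, qmul_0_l, ell_zero. reflexivity.
Qed.

Lemma sum_n_quat_single (u : nat -> quat) m n :
  (forall k, (k <= n)%nat -> k <> m -> u k = zero) ->
  sum_n u n = if le_dec m n then u m else zero.
Proof.
  induction n as [|n IH]; intros H.
  - rewrite sum_O. destruct (le_dec m 0) as [Hm|Hm]; [f_equal; lia|apply H; lia].
  - rewrite sum_Sn, IH by (intros; apply H; lia).
    destruct (le_dec m n), (le_dec m (S n)); try lia.
    + rewrite (H (S n)) by lia. generalize (u m). clear. intros. quat_ring.
    + replace m with (S n) by lia. generalize (u (S n)). clear. intros. quat_ring.
    + rewrite (H (S n)) by lia. clear. quat_ring.
Qed.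

(** If [a m] is the first nonzero coefficient, the coefficient of index [2 m] is
    [a m * conj (a m)]. *)
Lemma symmetrization_nonzero (a : nat -> quat) :
  (exists n, a n <> zero) -> exists n, symmetrization a n <> zero.
Proof.
  intros [k0 Hk0]. destruct (first_nonzero quat zero a) as [H|(m & Hm & Hlt)]; [elim (Hk0 (H k0))|].
  exists (m + m)%nat. unfold symmetrization, star.
  rewrite (sum_n_quat_single _ m).
  - destruct (le_dec m (m + m)) as [_|H]; [|lia].
    replace (m + m - m)%nat with m by lia. unfold reg_conj.
    intros E. apply (f_equal (fun q : quat => norm q)) in E.
    rewrite norm_qmul, norm_qconj, norm_quat_zero in E.
    assert (P := norm_quat_gt_0 _ Hm). nra.
  - intros k Hk Hne. destruct (Nat.lt_ge_cases k m) as [L|G].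
    + rewrite (Hlt k L). apply qmul_0_l.
    + unfold reg_conj. rewrite (Hlt (m + m - k)%nat) by lia.
      replace (qconj zero) with (zero : quat); [apply qmul_0_r|].
      apply quat_eq; unfold qconj; quat_unfold; change_eq_R; ring.
Qed.

(** * Quotients of power series have only poles *)

Lemma Rbar_lt_between (x : R) (R0 : Rbar) : Rbar_lt x R0 -> exists r : R, x < r /\ Rbar_lt r R0.
Proof.
  destruct R0 as [y| |]; simpl; intros H; [|exists (x + 1); split; [lra|exact I]|contradiction].
  exists ((x + y) / 2); lra.
Qed.

Lemma slice_coordinates (q : quat) : exists J w, imag_unit J /\ q = emb J w.
Proof.
  destruct q as [[[a b] c] d].
  set (s := sqrt (b * b + c * c + d * d)).
  assert (Hp : 0 <= b * b + c * c + d * d) by nra.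
  assert (Hs : s * s = b * b + c * c + d * d) by (apply sqrt_sqrt; exact Hp).
  destruct (Req_dec s 0) as [E|E].
  - assert (b = 0 /\ c = 0 /\ d = 0) as (-> & -> & ->).
    { rewrite E in Hs. repeat split; nra. }
    exists qi, (a, 0). split.
    + apply imag_unit_spec. unfold qi, q0, q1, q2, q3; simpl; split; [reflexivity|ring].
    + unfold qi. quat_ring.
  - exists (0, b / s, c / s, d / s), (a, s). split.
    + apply imag_unit_spec. unfold q0, q1, q2, q3; simpl; split; [reflexivity|].
      transitivity ((b * b + c * c + d * d) / (s * s)); [field; exact E|].
      rewrite Hs. field. rewrite <- Hs. nra.
    + apply quat_eq; quat_unfold; symmetry; change_eq_R; field; exact E.
Qed.

Lemma norm_slice_minus J z w : imag_unit J -> norm (minus (emb J z) (emb J w)) = Cmod (z - w).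
Proof. intros HJ. rewrite <- emb_minus. apply norm_emb, HJ. Qed.

Lemma open_quat_ball (U : quat -> Prop) q : open U -> U q ->
  exists r, 0 < r /\ forall p, norm (minus p q) < r -> U p.
Proof.
  intros HU Hq. destruct (locally_norm_le_locally (V := quat) q _ (HU q Hq)) as [r Hr].
  exists r; split; [apply cond_pos|exact Hr].
Qed.

Lemma quat_ball_open (U : quat -> Prop) :
  (forall q, U q -> exists r, 0 < r /\ forall p, norm (minus p q) < r -> U p) -> open U.
Proof.
  intros H q Hq. destruct (H q Hq) as (r & Hr & B).
  apply (locally_le_locally_norm (V := quat)). exists (mkposreal r Hr). exact B.
Qed.

Lemma norm_quat_triangle (p q : quat) : norm p <= norm q + norm (minus p q).
Proof.
  eapply Rle_trans; [|apply norm_triangle]. right. f_equal. clear. quat_ring.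
Qed.

Lemma qball_open (R0 : Rbar) : open (qball R0).
Proof.
  apply quat_ball_open. intros q Hq. destruct (Rbar_lt_between _ _ Hq) as (r & H1 & H2).
  exists (r - norm q); split; [lra|]. intros p Hp. unfold qball.
  apply (Rbar_lt_trans _ r); [simpl|exact H2]. assert (T := norm_quat_triangle p q). lra.
Qed.

Lemma qball_lt (R0 : Rbar) (r : R) q : Rbar_lt r R0 -> norm q < r -> qball R0 q.
Proof. intros H1 H2. apply (Rbar_lt_trans _ r); [exact H2|exact H1]. Qed.

(** At a point of the domain because the domain is open, at a point of [E] because [E]
    is discrete in the slice. *)
Lemma slice_isolated R0 (f : pfun) E J w : open (dom f) ->
  defined_off (qball R0) E (restrict f (qball R0)) -> imag_unit J -> qball R0 (emb J w) ->
  exists del, 0 < del /\ forall z, 0 < Cmod (z - w) < del -> dom f (emb J z) /\ qball R0 (emb J z).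
Proof.
  intros Hop (HEA & Hdisc & Hdom) HJ Hw.
  destruct (open_quat_ball _ _ (qball_open R0) Hw) as (d0 & Hd0 & B0).
  destruct (classic (dom f (emb J w))) as [Hf|Hf].
  - destruct (open_quat_ball _ _ Hop Hf) as (d1 & Hd1 & B1).
    exists (Rmin d0 d1); split; [apply Rmin_pos; assumption|]. intros z Hz.
    pose_Rmin.
    split; [apply B1|apply B0]; rewrite norm_slice_minus by exact HJ; lra.
  - assert (Ew : E (emb J w)).
    { apply NNPP; intros HE. apply Hf. apply (proj2 (Hdom (emb J w)) (conj Hw HE)). }
    destruct (Hdisc J (emb J w) HJ (ex_intro _ _ (ex_intro _ _ eq_refl)) Ew) as (d1 & Hd1 & B1).
    exists (Rmin d0 d1); split; [apply Rmin_pos; assumption|]. intros z Hz.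
    pose_Rmin.
    assert (Az : qball R0 (emb J z)) by (apply B0; rewrite norm_slice_minus by exact HJ; lra).
    split; [|exact Az].
    assert (HE : ~ E (emb J z)).
    { intros HE. specialize (B1 (emb J z) (ex_intro _ _ (ex_intro _ _ eq_refl)) HE).
      rewrite norm_slice_minus in B1 by exact HJ. specialize (B1 ltac:(lra)).
      assert (X := norm_slice_minus J z w HJ). rewrite B1 in X.
      rewrite <- X in Hz. replace (minus (emb J w) (emb J w)) with (zero : quat) in Hz
        by (generalize (emb J w); clear; intros; quat_ring).
      rewrite norm_quat_zero in Hz. lra. }
    apply (proj2 (Hdom (emb J z)) (conj Az HE)).
Qed.

Lemma slice_isolated_in_disc R0 (f : pfun) E J p rho : open (dom f) ->
  defined_off (qball R0) E (restrict f (qball R0)) -> imag_unit J ->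
  (forall z, Cmod (z - p) < rho -> qball R0 (emb J z)) ->
  isolated_in_disc (fun z => ~ dom f (emb J z)) p rho.
Proof.
  intros Hop HE HJ Hin z Hz.
  destruct (slice_isolated R0 f E J z Hop HE HJ (Hin z Hz)) as (d & Hd & B).
  exists d; split; [exact Hd|]. intros w Hw Hn. apply Hn, (B w Hw).
Qed.

Lemma Cminus_0_r (z : C) : (z - 0)%C = z.
Proof. ring. Qed.

(** Each slice of the ball minus the exceptional set is connected, and all slices share
    the real points of the domain. *)
Lemma domain_complement R0 (f : pfun) E : Rbar_lt 0 R0 -> open (dom f) ->
  defined_off (qball R0) E (restrict f (qball R0)) -> Defs.domain (dom (restrict f (qball R0))).
Proof.
  intros HR0 Hop HE.
  assert (real_pt : exists x0 : R, 0 <= x0 /\ dom f (qreal x0) /\ qball R0 (qreal x0)).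
  { assert (Hqi : imag_unit qi).
    { apply imag_unit_spec. unfold qi, q0, q1, q2, q3; simpl; split; [reflexivity|ring]. }
    destruct (slice_isolated R0 f E qi 0%C Hop HE Hqi) as (d & Hd & B).
    { unfold qball. rewrite norm_emb, Cmod_0 by exact Hqi. exact HR0. }
    exists (d / 2). rewrite <- (emb_real qi). split; [lra|]. apply B.
    rewrite Cminus_0_r, Cmod_R, Rabs_pos_eq; lra. }
  destruct real_pt as (x0 & Hx0 & Df & Dq).
  split; [|split].
  - exists (qreal x0). split; assumption.
  - apply open_and; [exact Hop|apply qball_open].
  - intros V W HV HW Hcov (p1 & U1 & V1) (p2 & U2 & W2).
    apply NNPP; intros Hno.
    assert (disj : forall q, dom f q -> qball R0 q -> V q -> W q -> False).
    { intros q A B C D. apply Hno. exists q. repeat split; assumption. }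
    assert (slicewise : forall J w1 w2, imag_unit J -> dom f (emb J w1) -> qball R0 (emb J w1) ->
      dom f (emb J w2) -> qball R0 (emb J w2) -> V (emb J w1) -> V (emb J w2)).
    { intros J w1 w2 HJ D1 B1 D2 B2 Vw.
      destruct (Rbar_lt_between _ _ B1) as (r1 & L1 & M1).
      destruct (Rbar_lt_between _ _ B2) as (r2 & L2 & M2).
      rewrite norm_emb in L1, L2 by exact HJ.
      assert (Hr : Rbar_lt (Rmax r1 r2) R0).
      { unfold Rmax; destruct (Rle_dec r1 r2); assumption. }
      assert (X1 := Rmax_l r1 r2). assert (X2 := Rmax_r r1 r2).
      set (r := Rmax r1 r2) in *.
      assert (inb : forall z, Cmod (z - 0) < r -> qball R0 (emb J z)).
      { intros z Hz. rewrite Cminus_0_r in Hz. apply (qball_lt R0 r); [exact Hr|].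
        rewrite norm_emb by exact HJ; exact Hz. }
      apply (disc_locally_constant (fun z => V (emb J z)) (fun z => ~ dom f (emb J z)) 0%C r)
        with (z1 := w1); try (rewrite Cminus_0_r; lra); try tauto.
      - apply (slice_isolated_in_disc R0 f E); assumption.
      - intros z Hz Hd. apply NNPP in Hd. assert (Bz := inb z Hz).
        destruct (open_quat_ball _ _ Hop Hd) as (e0 & He0 & N0).
        destruct (open_quat_ball _ _ (qball_open R0) Bz) as (e1 & He1 & N1).
        destruct (Hcov (emb J z) (conj Hd Bz)) as [Hv|Hw].
        + destruct (open_quat_ball _ _ HV Hv) as (e2 & He2 & N2).
          exists e2; split; [exact He2|]. intros w Hw.
          assert (V (emb J w)) by (apply N2; rewrite norm_slice_minus by exact HJ; exact Hw).
          tauto.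
        + destruct (open_quat_ball _ _ HW Hw) as (e2 & He2 & N2).
          exists (Rmin (Rmin e0 e1) e2); split; [repeat apply Rmin_pos; assumption|].
          intros w Hwz.
          pose_Rmin.
          split; intros Hv'; exfalso.
          * apply (disj (emb J w)); [| |exact Hv'|];
              [apply N0|apply N1|apply N2]; rewrite norm_slice_minus by exact HJ; lra.
          * apply (disj (emb J z)); assumption. }
    destruct (slice_coordinates p1) as (J1 & w1 & HJ1 & ->).
    destruct (slice_coordinates p2) as (J2 & w2 & HJ2 & ->).
    destruct U1 as [D1 B1]. destruct U2 as [D2 B2].
    assert (Vx : V (qreal x0)).
    { rewrite <- (emb_real J1). apply (slicewise J1 w1); rewrite ?emb_real; assumption. }
    apply (disj (emb J2 w2)); try assumption.
    rewrite <- (emb_real J2) in Vx. apply (slicewise J2 x0); rewrite ?emb_real; assumption ||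
      (rewrite <- (emb_real J2); exact Vx).
Qed.

(** [(z - w)^(k+2) f] extends by 0 to a function that is complex differentiable at [w]
    too; shifting its Taylor coefficients gives the Laurent expansion of [f]. *)
Lemma pole_of_polynomial_bound (f : pfun) J w k K del : regular f -> imag_unit J -> 0 < del ->
  (forall z, 0 < Cmod (z - w) < del -> dom f (emb J z) /\
     norm (f (emb J z)) * Cmod (z - w) ^ k <= K) ->
  pole f (emb J w).
Proof.
  intros Hf HJ Hdel H.
  set (G := fun z => if excluded_middle_informative (z = w) then zero
                     else qmul (emb J ((z - w) ^ (k + 2))%C) (f (emb J z))).
  assert (Gne : forall z, z <> w -> G z = qmul (emb J ((z - w) ^ (k + 2))%C) (f (emb J z))).
  { intros z Hz. unfold G. destruct (excluded_middle_informative (z = w)); tauto. }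
  assert (pos : forall z, z <> w -> 0 < Cmod (z - w)) by (intros z Hz; apply Cmod_minus_pos, Hz).
  assert (HG : forall z, Cmod (z - w) < del -> slice_hol J G z).
  { intros z Hz. destruct (classic (z = w)) as [->|Hne].
    - apply (slice_hol_of_quadratic_bound J G w K del HJ Hdel). intros y Hy.
      destruct (classic (y = w)) as [->|Hyw].
      + unfold G. destruct (excluded_middle_informative (w = w)); [|tauto].
        rewrite norm_quat_zero. rewrite Cmod_minus_self. lra.
      + rewrite (Gne y Hyw), norm_qmul, norm_emb, Cmod_pow, pow_add by exact HJ.
        destruct (H y (conj (pos y Hyw) Hy)) as [_ B].
        assert (P := Rle_0_sqr (Cmod (y - w))). unfold Rsqr in P.
        replace (Cmod (y - w) ^ k * Cmod (y - w) ^ 2 * norm (f (emb J y))) with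
          ((norm (f (emb J y)) * Cmod (y - w) ^ k) * Cmod (y - w) ^ 2) by ring.
        apply Rmult_le_compat_r; [simpl; lra|exact B].
    - apply (slice_hol_ext_locally J (fun y => qmul (emb J ((y - w) ^ (k + 2))%C) (f (emb J y))) G z
               (Cmod (z - w)) (pos z Hne)).
      + intros y Hy. symmetry; apply Gne. intros ->. rewrite Cmod_minus_sym in Hy. lra.
      + apply (slice_hol_emb_mul J (fun y => (y - w) ^ (k + 2))%C); [exact HJ| |].
        * apply (hol_pow (fun y => y - w)%C), hol_minus_const.
        * apply regular_slice_hol; [exact Hf|exact HJ|]. apply H. split; [apply pos, Hne|exact Hz]. }
  destruct (slice_taylor J G w del (del / 2) HJ HG) as [b Hb]; [lra|].
  exists J, (shifted_coeff b (k + 2)). split; [exact HJ|]. split.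
  { exists (Re w), (Im w); reflexivity. }
  split.
  - exists (del / 2); split; [lra|]. intros q [x [y ->]] Hz.
    set (z := (x, y) : C). change (slice_pt J x y) with (emb J z) in *.
    rewrite norm_slice_minus in Hz by exact HJ.
    destruct (H z) as [Hd _]; [lra|]. split; [exact Hd|].
    assert (Hne : (z - w)%C <> 0%C) by (apply Cmod_gt_0; lra).
    assert (Hzw : z <> w) by (intros ->; apply Hne; ring).
    destruct (laurent_of_power_series J (z - w)%C b (G z) (k + 2) HJ Hne) as (u & v & Hu & Hv & E).
    { apply Hb; lra. }
    exists u, v. rewrite <- emb_minus. split; [|split].
    + revert Hu; apply is_series_ext; intros n. rewrite qzpow_emb_nonneg by exact HJ. reflexivity.
    + revert Hv; apply is_series_ext; intros n. rewrite qzpow_emb_neg by assumption. reflexivity.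
    + rewrite <- E, (Gne z Hzw), <- qmul_assoc, emb_mult by exact HJ.
      rewrite <- Cpow_mult_l. replace (/ (z - w) * (z - w))%C with (RtoC 1) by (field; exact Hne).
      rewrite Cpow_1_l, emb_real, qmul_1_l. reflexivity.
  - exists (k + 2)%nat. intros m Hm. apply shifted_coeff_vanish, Hm.
Qed.

(** The numerator is bounded near [w].  The symmetrization does not vanish identically
    near [w], since otherwise all its coefficients would be zero, so it is bounded
    below by a power of [|z - w|]. *)
Lemma quotient_polynomial_bound r (a b : nat -> quat) J w : imag_unit J -> Cmod w < r ->
  in_D r a -> in_D r b -> (exists q, qball r q /\ psum a q <> zero) ->
  exists k K del, 0 < del /\ forall z, 0 < Cmod (z - w) < del ->
    dom (left_quotient r a b) (emb J z) /\
    norm (left_quotient r a b (emb J z)) * Cmod (z - w) ^ k <= K.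
Proof.
  intros HJ Hw Ha Hb (q & Hq & Hne).
  assert (Hs : in_D r (symmetrization a)) by (exact (in_D_star r a (reg_conj a) Ha (in_D_reg_conj r a Ha))).
  assert (Hn : in_D r (star (reg_conj a) b)) by (exact (in_D_star r (reg_conj a) b (in_D_reg_conj r a Ha) Hb)).
  assert (Hnz : exists n, symmetrization a n <> zero).
  { apply symmetrization_nonzero. apply NNPP; intros H0. apply Hne.
    eapply is_series_quat_unique; [apply (psum_correct r); [exact Ha|exact Hq]|].
    generalize is_series_quat_zero; apply is_series_ext; intros n. unfold pterm.
    replace (a n) with (zero : quat); [symmetry; apply qmul_0_r|].
    symmetry; apply NNPP; intros E; apply H0; exists n; exact E. }
  set (rho := r - Cmod w).
  assert (inside : forall z, Cmod (z - w) < rho -> Cmod z < r).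
  { intros z Hz. assert (T := Cmod_triangle_minus z w 0). rewrite !Cminus_0_r in T.
    unfold rho in Hz. lra. }
  destruct (slice_hol_zero_dichotomy J (fun z => psum (symmetrization a) (emb J z)) w rho HJ)
    as [(d & Hd & Z)|(k & m & d & Hm & Hd & L)].
  - unfold rho; lra.
  - intros z Hz. apply (psum_slice_hol r); [exact HJ|exact Hs|apply inside, Hz].
  - exfalso. destruct Hnz as [n Hn0]. apply Hn0.
    exact (psum_locally_zero r _ J w d HJ Hs Hw Hd Z n).
  - destruct (slice_hol_locally_bounded J _ w (psum_slice_hol r _ J w HJ Hn Hw)) as (K & e & HK & He & B).
    exists k, (K / m), (Rmin (Rmin d e) rho).
    split; [repeat apply Rmin_pos; unfold rho; lra|]. intros z Hz.
    pose_Rmin.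
    specialize (L z ltac:(lra)). specialize (B z ltac:(lra)).
    assert (P : 0 < Cmod (z - w) ^ k) by (apply pow_lt, Hz).
    assert (N0 : psum (symmetrization a) (emb J z) <> zero).
    { intros E0. rewrite E0, norm_quat_zero in L. nra. }
    split.
    + split; [|exact N0]. unfold qball. rewrite norm_emb by exact HJ. apply inside; lra.
    + change (left_quotient r a b (emb J z)) with
        (qmul (qinv (psum (symmetrization a) (emb J z))) (psum (star (reg_conj a) b) (emb J z))).
      rewrite norm_qmul, norm_qinv by exact N0.
      assert (Q := norm_quat_gt_0 _ N0).
      set (A := norm (psum (symmetrization a) (emb J z))) in *.
      set (X := norm (psum (star (reg_conj a) b) (emb J z))) in *.
      assert (HX : 0 <= X) by apply norm_quat_ge_0.
      clearbody A X.
      apply (Rmult_le_reg_r (A * m)); [apply Rmult_lt_0_compat; lra|].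
      replace (/ A * X * Cmod (z - w) ^ k * (A * m)) with (X * (m * Cmod (z - w) ^ k)) by (field; lra).
      replace (K / m * (A * m)) with (K * A) by (field; lra).
      apply Rmult_le_compat; [exact HX|nra|exact B|exact L].
Qed.

(** The exceptional set is what the domain of [f] misses in the ball; locally it is the
    exceptional set given by one of the smaller balls. *)
Lemma semiregular_of_in_L (R0 : Rbar) (hR0 : Rbar_lt 0 R0) (f : pfun) (hf : regular f) :
  (forall r : R, 0 < r -> Rbar_lt r R0 -> in_L r (restrict f (qball r))) ->
  semiregular (qball R0) (restrict f (qball R0)).
Proof.
  intros HL.
  assert (local : forall p, qball R0 p -> exists r : R, norm p < r /\ Rbar_lt r R0 /\
    in_L r (restrict f (qball r))).
  { intros p Hp. destruct (Rbar_lt_between _ _ Hp) as (r & H1 & H2).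
    exists r; split; [exact H1|]. split; [exact H2|]. apply HL; [|exact H2].
    assert (N := norm_quat_ge_0 p). lra. }
  set (E := fun q => qball R0 q /\ ~ dom f q).
  assert (HE : defined_off (qball R0) E (restrict f (qball R0))).
  { split; [|split].
    - intros q [Hq _]; exact Hq.
    - intros J p HJ Hp [Bp Dp]. destruct (local p Bp) as (r & Hr & Hr0 & [(E' & HA & HD & Hdom) _]).
      assert (toE' : forall q, norm q < r -> ~ dom f q -> E' q).
      { intros q Hq Hdq. apply NNPP; intros HE'. apply Hdq.
        apply (proj2 (Hdom q) (conj Hq HE')). }
      destruct (HD J p HJ Hp (toE' p Hr Dp)) as (eps & Heps & Hz).
      exists (Rmin eps (r - norm p)); split; [apply Rmin_pos; lra|].
      intros z Sz [Bz Dz] Nz.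
      pose_Rmin.
      apply Hz; [exact Sz| |lra]. apply toE'; [|exact Dz].
      assert (T := norm_quat_triangle z p). lra.
    - intros q; simpl; unfold E. split; [|tauto].
      intros [Dq Bq]; tauto. }
  assert (Hop : open (dom f)) by apply hf.
  assert (Hreg : regular (restrict f (qball R0))).
  { destruct hf as (_ & Hdiff & HCR). split; [|split].
    - apply (domain_complement R0 f E hR0 Hop HE).
    - intros q [Dq _]. apply Hdiff, Dq.
    - intros I x y HI [Dq _]. apply HCR; assumption. }
  exists E. split; [exact HE|]. split; [exact Hreg|].
  intros p [Bp Dp] Hess. apply Hess.
  destruct (local p Bp) as (r & Hr & Hr0 & [_ (a & b & Ha & Hb & Hne & Heq)]).
  destruct (slice_coordinates p) as (J & w & HJ & ->).
  assert (Hw : Cmod w < r) by (rewrite <- (norm_emb J HJ); exact Hr).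
  destruct (quotient_polynomial_bound r a b J w HJ Hw Ha Hb Hne) as (k & K & d1 & Hd1 & B1).
  destruct (slice_isolated R0 f E J w Hop HE HJ Bp) as (d2 & Hd2 & B2).
  apply (pole_of_polynomial_bound _ J w k K (Rmin d1 d2) Hreg HJ); [apply Rmin_pos; assumption|].
  intros z Hz. pose_Rmin.
  destruct (B1 z ltac:(lra)) as [Dl Bl]. destruct (B2 z ltac:(lra)) as [Df Bz].
  split; [split; assumption|].
  change (norm (f (emb J z)) * Cmod (z - w) ^ k <= K).
  assert (Ev : f (emb J z) = left_quotient r a b (emb J z)).
  { apply (Heq (emb J z)); [|exact Dl]. split; [exact Df|apply Dl]. }
  rewrite Ev; exact Bl.
Qed.

(** * Clearing the poles on one slice by a real polynomial *)

Definition pole_bound (f : pfun) (J : quat) (w : C) : Prop :=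
  exists N M del, 0 < del /\ forall z, 0 < Cmod (z - w) < del ->
    norm (f (emb J z)) * Cmod (z - w) ^ N <= M.

Lemma in_D_of_series_at r (b : nat -> quat) :
  (forall x, 0 < x < r -> exists s, is_series (fun n => qmul (qreal (x ^ n)) (b n)) s) -> in_D r b.
Proof.
  intros H. apply bounded_in_D. intros x Hx. destruct (H x Hx) as [s Hs].
  destruct (is_series_quat_bounded _ _ Hs) as (M & HM & B).
  exists M; split; [exact HM|]. intros n. specialize (B n).
  rewrite norm_qmul, norm_qreal, Rabs_pos_eq in B by (apply pow_le; lra). lra.
Qed.

(** The power series [beta] produced here can be evaluated on every slice, which is what
    carries the information from the slice where the pole is given to other slices. *)
Lemma pole_laurent_series (f : pfun) p : pole f p -> exists I w r N beta, imag_unit I /\ p = emb I w /\ 0 < r /\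
  in_D r beta /\ forall z, 0 < Cmod (z - w) < r -> dom f (emb I z) /\
    qmul (emb I ((z - w) ^ N)%C) (f (emb I z)) = psum beta (emb I (z - w)%C).
Proof.
  intros (I & a & HI & [x [y ->]] & (r & Hr & HL) & (N & HN)).
  set (w := (x, y) : C). change (slice_pt I x y) with (emb I w) in *.
  exists I, w, r, N, (fun n => a (Z.of_nat n - Z.of_nat N)%Z).
  split; [exact HI|]. split; [reflexivity|]. split; [exact Hr|].
  assert (HS : forall z, 0 < Cmod (z - w) < r -> dom f (emb I z) /\
    is_series (fun n => qmul (emb I ((z - w) ^ n)%C) (a (Z.of_nat n - Z.of_nat N)%Z))
      (qmul (emb I ((z - w) ^ N)%C) (f (emb I z)))).
  { intros z Hz.
    destruct (HL (emb I z)) as (Dz & u & v & Hu & Hv & E).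
    { exists (Re z), (Im z); reflexivity. }
    { rewrite norm_slice_minus by exact HI; exact Hz. }
    split; [exact Dz|]. rewrite E.
    assert (Hne : (z - w)%C <> 0%C) by (apply Cmod_gt_0, Hz).
    apply (power_series_of_laurent I (z - w)%C N HI Hne a u v HN).
    - revert Hu; apply is_series_ext; intros n.
      rewrite <- emb_minus, qzpow_emb_nonneg by exact HI. reflexivity.
    - revert Hv; apply is_series_ext; intros n.
      rewrite <- emb_minus, qzpow_emb_neg by assumption. reflexivity. }
  assert (HD : in_D r (fun n => a (Z.of_nat n - Z.of_nat N)%Z)).
  { apply in_D_of_series_at. intros t Ht. destruct (HS (w + t)%C) as [_ St].
    { replace (w + t - w)%C with (RtoC t) by ring. rewrite Cmod_R, Rabs_pos_eq; lra. }
    exists (qmul (emb I ((w + t - w) ^ N)%C) (f (emb I (w + t)%C))).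
    revert St. apply is_series_ext. intros n.
    replace (w + t - w)%C with (RtoC t) by ring. rewrite <- RtoC_pow, emb_real. reflexivity. }
  split; [exact HD|]. intros z Hz. destruct (HS z Hz) as [Dz Sz]. split; [exact Dz|].
  eapply is_series_quat_unique; [exact Sz|].
  assert (P := psum_slice r _ I (z - w)%C HI HD (proj2 Hz)). rewrite Cminus_0_r in P. exact P.
Qed.

(** A nonreal point determines its slice, but [I] and [J] may be opposite. *)
Lemma emb_same_slice I J w w' (z : C) : imag_unit I -> imag_unit J -> emb J w = emb I w' ->
  Im w <> 0 -> exists z', emb J z = emb I z'.
Proof.
  intros HI HJ E Hw.
  exists ((Re z, Im z * (Im w' / Im w)) : C).
  destruct (emb_components J HJ w) as (A0 & A1 & A2 & A3).
  destruct (emb_components I HI w') as (B0 & B1 & B2 & B3).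
  rewrite <- E in B0, B1, B2, B3. rewrite A1 in B1. rewrite A2 in B2. rewrite A3 in B3.
  destruct (emb_components J HJ z) as (C0 & C1 & C2 & C3).
  set (z' := (Re z, Im z * (Im w' / Im w)) : C).
  destruct (emb_components I HI z') as (D0 & D1 & D2 & D3).
  apply quat_eq; [rewrite C0, D0; reflexivity|rewrite C1, D1|rewrite C2, D2|rewrite C3, D3];
    simpl (Im z'); apply (Rmult_eq_reg_l (Im w)); try exact Hw.
  - replace (Im w * (Im z * q1 J)) with (Im z * (Im w * q1 J)) by ring. rewrite B1. field; exact Hw.
  - replace (Im w * (Im z * q2 J)) with (Im z * (Im w * q2 J)) by ring. rewrite B2. field; exact Hw.
  - replace (Im w * (Im z * q3 J)) with (Im z * (Im w * q3 J)) by ring. rewrite B3. field; exact Hw.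
Qed.

(** For a real [p] the Laurent expansion may be given on another slice than that of
    [J].  There [(q - p)^N f] agrees with a power series [beta] in [q - p]; both sides
    make sense on the slice of [J], agree at real points, and hence agree by the
    identity theorem. *)
Lemma pole_bounded_on_slice R0 (f : pfun) E J w : regular f -> imag_unit J ->
  defined_off (qball R0) E (restrict f (qball R0)) -> qball R0 (emb J w) ->
  ~ dom f (emb J w) -> pole (restrict f (qball R0)) (emb J w) -> pole_bound f J w.
Proof.
  intros Hf HJ HE Bw Dw Hp.
  destruct (pole_laurent_series _ _ Hp) as (I & w' & r & N & beta & HI & Ep & Hr & HD & HL).
  assert (Z0 : forall J', slice_hol J' (fun z => psum beta (emb J' z)) 0%C \/ ~ imag_unit J').
  { intros J'. destruct (classic (imag_unit J')) as [H|H]; [left|right; exact H].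
    apply (psum_slice_hol r); [exact H|exact HD|rewrite Cmod_0; exact Hr]. }
  destruct (Req_dec (Im w) 0) as [Hreal|Hnr].
  - set (x0 := Re w).
    assert (Ew : w = RtoC x0).
    { apply injective_projections; [reflexivity|exact Hreal]. }
    assert (Ew' : w' = RtoC x0).
    { assert (A := emb_components J HJ w). assert (B := emb_components I HI w').
      rewrite <- Ep in B. destruct A as (A0 & A1 & A2 & A3), B as (B0 & B1 & B2 & B3).
      rewrite A0 in B0. rewrite A1, Hreal, Rmult_0_l in B1. rewrite A2, Hreal, Rmult_0_l in B2.
      rewrite A3, Hreal, Rmult_0_l in B3.
      destruct (proj1 (imag_unit_spec I) HI) as [_ N1].
      assert (I0 : Im w' = 0).
      { apply Rsqr_0_uniq. unfold Rsqr.
        replace (Im w' * Im w') with (Im w' * Im w' * (q1 I ^ 2 + q2 I ^ 2 + q3 I ^ 2))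
          by (rewrite N1; ring).
        replace (Im w' * Im w' * (q1 I ^ 2 + q2 I ^ 2 + q3 I ^ 2)) with
          ((Im w' * q1 I) ^ 2 + (Im w' * q2 I) ^ 2 + (Im w' * q3 I) ^ 2) by ring.
        rewrite <- B1, <- B2, <- B3. ring. }
      apply injective_projections; [symmetry; exact B0|exact I0]. }
    clearbody x0. subst w w'.
    destruct (Rbar_lt_between _ _ Bw) as (r1 & Hr1 & Hr1').
    rewrite norm_emb in Hr1 by exact HJ.
    set (rho := Rmin r (r1 - Cmod x0)).
    assert (Hrho : 0 < rho) by (apply Rmin_pos; lra).
    assert (rho1 : rho <= r) by apply Rmin_l.
    assert (rho2 : rho <= r1 - Cmod x0) by apply Rmin_r.
    clearbody rho.
    assert (Hop : open (dom f)) by apply Hf.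
    assert (inb : forall z, Cmod (z - x0) < rho -> qball R0 (emb J z)).
    { intros z Hz. apply (qball_lt R0 r1); [exact Hr1'|]. rewrite norm_emb by exact HJ.
      assert (T := Cmod_triangle_minus z x0 0). rewrite !Cminus_0_r in T. lra. }
    assert (Hiso := slice_isolated_in_disc R0 f E J x0 rho Hop HE HJ inb).
    assert (Hb : forall z, Cmod (z - x0) < rho ->
      slice_hol J (fun y => psum beta (emb J (y - x0)%C)) z).
    { intros z Hz v.
      apply (hol_translate (fun y => ell J (qmul (psum beta (emb J y)) v)) z (- x0)%C).
      apply (psum_slice_hol r beta J (z + - x0)%C HJ HD).
      change (z + - x0)%C with (z - x0)%C. lra. }
    assert (Hzero : forall z, Cmod (z - x0) < rho -> ~ ~ dom f (emb J z) ->
      minus (qmul (emb J ((z - x0) ^ N)%C) (f (emb J z))) (psum beta (emb J (z - x0)%C)) = zero).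
    { apply (slice_identity J _ _ x0 rho HJ Hrho Hiso).
      - intros z Hz Dz. apply NNPP in Dz. apply slice_hol_minus; [|apply Hb, Hz].
        apply (slice_hol_emb_mul J (fun y => (y - x0) ^ N)%C); [exact HJ| |].
        + apply (hol_pow (fun y => y - x0)%C), hol_minus_const.
        + apply regular_slice_hol; assumption.
      - intros x Hx Dx. apply NNPP in Dx.
        assert (Hne : x <> x0) by (intros ->; exact (Dw Dx)).
        destruct (HL (RtoC x)) as [_ EL].
        { rewrite <- RtoC_minus, Cmod_R. split; [|lra].
          apply Rabs_pos_lt; lra. }
        change (restrict f (qball R0) (emb I x)) with (f (emb I x)) in EL.
        rewrite <- RtoC_minus, <- RtoC_pow, !emb_real in EL.
        rewrite <- RtoC_minus, <- RtoC_pow, !emb_real, EL.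
        generalize (psum beta (qreal (x - x0))). clear. intros. quat_ring. }
    destruct (Z0 J) as [Zj|Zj]; [|elim (Zj HJ)].
    destruct (slice_hol_locally_bounded J _ 0%C Zj) as (K & d & HK & Hd & B).
    destruct (Hiso x0) as (d2 & Hd2 & B2).
    { rewrite Cmod_minus_self. exact Hrho. }
    exists N, K, (Rmin (Rmin d d2) rho). split; [repeat apply Rmin_pos; assumption|].
    intros z Hz.
    pose_Rmin.
    specialize (B (z - x0)%C). rewrite Cminus_0_r in B. specialize (B ltac:(lra)).
    assert (Ez := Hzero z ltac:(lra) (B2 z ltac:(lra))).
    assert (Ez' : qmul (emb J ((z - x0) ^ N)%C) (f (emb J z)) = psum beta (emb J (z - x0)%C)).
    { apply quat_minus_eq. rewrite Ez. apply norm_quat_zero. }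
    rewrite <- Ez', norm_qmul, norm_emb, Cmod_pow in B by exact HJ. lra.
  - destruct (Z0 I) as [Zi|Zi]; [|elim (Zi HI)].
    destruct (slice_hol_locally_bounded I _ 0%C Zi) as (K & d & HK & Hd & B).
    exists N, K, (Rmin d r). split; [apply Rmin_pos; assumption|]. intros z Hz.
    pose_Rmin.
    destruct (emb_same_slice I J w w' z HI HJ Ep Hnr) as [z' Ez].
    assert (En : Cmod (z - w) = Cmod (z' - w')).
    { rewrite <- (norm_slice_minus J z w HJ), Ez, Ep. apply norm_slice_minus, HI. }
    rewrite En in *. rewrite Ez.
    specialize (B (z' - w')%C). rewrite Cminus_0_r in B. specialize (B ltac:(lra)).
    destruct (HL z') as [_ EL]; [lra|].
    change (restrict f (qball R0) (emb I z')) with (f (emb I z')) in EL.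
    rewrite <- EL, norm_qmul, norm_emb, Cmod_pow in B by exact HI. lra.
Qed.

(** The product of [(z - c)(z - conj c)]: having real coefficients, it extends
    to a polynomial of a quaternionic variable that preserves every slice. *)
Fixpoint conj_poly (l : list C) (z : C) : C :=
  match l with nil => 1%C | c :: l' => ((z - c) * (z - Cconj c) * conj_poly l' z)%C end.

Lemma conj_poly_app l l' z : conj_poly (l ++ l') z = (conj_poly l z * conj_poly l' z)%C.
Proof. induction l as [|c l IH]; simpl; [ring|rewrite IH; ring]. Qed.

Lemma conj_poly_repeat c n z : conj_poly (repeat c n) z = ((z - c) ^ n * (z - Cconj c) ^ n)%C.
Proof. induction n as [|n IH]; simpl; [ring|rewrite IH; ring]. Qed.

Lemma conj_poly_hol l w : hol (conj_poly l) w.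
Proof.
  induction l as [|c l IH]; simpl; [apply hol_const|].
  apply (hol_mult (fun z => (z - c) * (z - Cconj c))%C (conj_poly l)); [|exact IH].
  apply (hol_mult (fun z => z - c)%C (fun z => z - Cconj c)%C); apply hol_minus_const.
Qed.

(** Either [w] is not a singularity, or the product of the polynomial with [f] vanishes
    to second order at [w], as needed to extend it by 0. *)
Definition cleared (f : pfun) (J : quat) (l : list C) (w : C) : Prop :=
  dom f (emb J w) \/ exists M del, 0 < del /\ forall z, 0 < Cmod (z - w) < del ->
    Cmod (conj_poly l z) * norm (f (emb J z)) <= M * Cmod (z - w) ^ 2.

Lemma cleared_mult f J l l' l'' w : (forall z, conj_poly l'' z = conj_poly l z * conj_poly l' z)%C ->
  cleared f J l w -> cleared f J l'' w.
Proof.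
  intros Hm [H|(M & del & Hdel & H)]; [left; exact H|right].
  destruct (hol_locally_bounded _ w (conj_poly_hol l' w)) as (K & d & HK & Hd & B).
  exists (K * M), (Rmin del d). split; [apply Rmin_pos; assumption|]. intros z Hz.
  pose_Rmin.
  specialize (H z ltac:(lra)). specialize (B z ltac:(lra)).
  rewrite Hm, Cmod_mult.
  assert (N := Rmult_le_pos _ _ (Cmod_ge_0 (conj_poly l z)) (norm_quat_ge_0 (f (emb J z)))).
  replace (Cmod (conj_poly l z) * Cmod (conj_poly l' z) * norm (f (emb J z)))
    with (Cmod (conj_poly l' z) * (Cmod (conj_poly l z) * norm (f (emb J z)))) by ring.
  rewrite Rmult_assoc.
  apply Rmult_le_compat; [apply Cmod_ge_0|exact N|exact B|exact H].
Qed.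

Lemma pole_bound_cleared f J w : pole_bound f J w -> exists l, cleared f J l w.
Proof.
  intros (N & M & del & Hdel & H).
  (* [N] factors for the pole and two for the zero of second order. *)
  exists (repeat w (N + 2)). right.
  destruct (hol_locally_bounded _ w (hol_pow (fun z => z - Cconj w)%C w (N + 2)
    (hol_minus_const _ w)))
    as (K & d & HK & Hd & B).
  exists (K * M), (Rmin del d). split; [apply Rmin_pos; assumption|]. intros z Hz.
  pose_Rmin.
  specialize (H z ltac:(lra)). specialize (B z ltac:(lra)).
  rewrite conj_poly_repeat, Cmod_mult, Cmod_pow, pow_add.
  assert (P := pow_le (Cmod (z - w)) 2 (Cmod_ge_0 _)).
  assert (P' := pow_le (Cmod (z - w)) N (Cmod_ge_0 _)).
  set (X := Cmod ((z - Cconj w) ^ (N + 2))) in *.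
  replace (Cmod (z - w) ^ N * Cmod (z - w) ^ 2 * X * norm (f (emb J z)))
    with (X * (norm (f (emb J z)) * Cmod (z - w) ^ N) * Cmod (z - w) ^ 2) by ring.
  apply Rmult_le_compat_r; [exact P|].
  apply Rmult_le_compat; [apply Cmod_ge_0| |exact B|exact H].
  apply Rmult_le_pos; [apply norm_quat_ge_0|exact P'].
Qed.

(** The poles in a closed disc are finite in number; the bisection principle encodes
    this, by multiplying the polynomials that work on the four quarters of a square. *)
Lemma clear_poles R0 (f : pfun) E J (r1 : R) : regular f -> imag_unit J ->
  defined_off (qball R0) E (restrict f (qball R0)) -> 0 < r1 -> Rbar_lt r1 R0 ->
  (forall p, E p -> pole (restrict f (qball R0)) p) ->
  exists l, forall w, Cmod w <= r1 -> cleared f J l w.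
Proof.
  intros Hf HJ HE Hr1 Hr0 Hpole.
  set (T := fun x y h => exists l, forall w : C, x <= Re w <= x + h -> y <= Im w <= y + h ->
    Cmod w <= r1 -> cleared f J l w).
  assert (HT : T (- r1) (- r1) (2 * r1)).
  { apply bisection_principle; [lra| |].
    - intros x y h Hh (l1 & H1) (l2 & H2) (l3 & H3) (l4 & H4).
      exists ((l1 ++ l2) ++ (l3 ++ l4)). intros w Hx Hy Hw.
      destruct (Rle_dec (Re w) (x + h / 2)) as [Cx|Cx], (Rle_dec (Im w) (y + h / 2)) as [Cy|Cy].
      + apply (cleared_mult f J l1 (l2 ++ (l3 ++ l4))); [|apply H1; lra].
        intros z; rewrite !conj_poly_app; ring.
      + apply (cleared_mult f J l3 (l1 ++ (l2 ++ l4))); [|apply H3; lra].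
        intros z; rewrite !conj_poly_app; ring.
      + apply (cleared_mult f J l2 (l1 ++ (l3 ++ l4))); [|apply H2; lra].
        intros z; rewrite !conj_poly_app; ring.
      + apply (cleared_mult f J l4 (l1 ++ (l2 ++ l3))); [|apply H4; lra].
        intros z; rewrite !conj_poly_app; ring.
    - intros x y _ _. set (w0 := (x, y) : C).
      assert (near : forall x' y' h w, x' <= x <= x' + h -> y' <= y <= y' + h ->
        x' <= Re w <= x' + h -> y' <= Im w <= y' + h -> Cmod (w - w0) <= 2 * h).
      { intros x' y' h w A B C D. eapply Rle_trans; [apply Cmod_le_Re_Im|].
        change (Re (w - w0)) with (Re w - x). change (Im (w - w0)) with (Im w - y).
        assert (Rabs (Re w - x) <= h) by (apply Rabs_le; lra).
        assert (Rabs (Im w - y) <= h) by (apply Rabs_le; lra). lra. }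
      destruct (Rle_dec (Cmod w0) r1) as [Hin|Hout].
      + assert (Bw : qball R0 (emb J w0)).
        { apply (Rbar_le_lt_trans _ r1); [|exact Hr0]. simpl. rewrite norm_emb by exact HJ. exact Hin. }
        destruct (slice_isolated R0 f E J w0 (proj1 (proj2 (proj1 Hf))) HE HJ Bw) as (d & Hd & B).
        assert (L : exists l, cleared f J l w0).
        { destruct (classic (dom f (emb J w0))) as [Dw|Dw]; [exists nil; left; exact Dw|].
          apply pole_bound_cleared, (pole_bounded_on_slice R0 f E); try assumption.
          apply Hpole. destruct HE as (_ & _ & Hdom). apply NNPP; intros HnE. apply Dw.
          apply (proj2 (Hdom (emb J w0)) (conj Bw HnE)). }
        destruct L as [l Hl].
        exists (d / 2); split; [lra|]. intros x' y' h Hh Hx Hy. exists l. intros w Wx Wy _.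
        destruct (classic (w = w0)) as [->|Hne]; [exact Hl|left].
        apply B. split.
        * apply Cmod_minus_pos, Hne.
        * specialize (near x' y' h w Hx Hy Wx Wy). lra.
      + exists ((Cmod w0 - r1) / 2); split; [lra|]. intros x' y' h Hh Hx Hy. exists nil.
        intros w Wx Wy Hw. exfalso. specialize (near x' y' h w Hx Hy Wx Wy).
        assert (Tr := Cmod_triangle_minus w0 w 0). rewrite !Cminus_0_r, Cmod_minus_sym in Tr. lra. }
  destruct HT as [l Hl]. exists l. intros w Hw.
  assert (A := re_le_Cmod w). assert (B := Im_le_Cmod w).
  apply Rabs_le_between in A. apply Rabs_le_between in B.
  apply Hl; [lra|lra|exact Hw].
Qed.

(** The product of the polynomial with [f], extended by 0. *)
Lemma cleared_extension f J l r1 : regular f -> imag_unit J ->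
  (forall w, Cmod w <= r1 -> cleared f J l w) ->
  exists G, (forall w, Cmod w < r1 -> slice_hol J G w) /\
    forall w, dom f (emb J w) -> G w = qmul (emb J (conj_poly l w)) (f (emb J w)).
Proof.
  intros Hf HJ Hl.
  set (G := fun w => if excluded_middle_informative (dom f (emb J w))
                     then qmul (emb J (conj_poly l w)) (f (emb J w)) else zero).
  assert (G1 : forall w, dom f (emb J w) -> G w = qmul (emb J (conj_poly l w)) (f (emb J w))).
  { intros w Hw. unfold G. destruct (excluded_middle_informative _); tauto. }
  assert (G0 : forall w, ~ dom f (emb J w) -> G w = zero).
  { intros w Hw. unfold G. destruct (excluded_middle_informative _); tauto. }
  exists G; split; [|exact G1]. intros w Hw.
  destruct (classic (dom f (emb J w))) as [Dw|Dw].
  - destruct (open_quat_ball _ _ (proj1 (proj2 (proj1 Hf))) Dw) as (d & Hd & B).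
    apply (slice_hol_ext_locally J (fun z => qmul (emb J (conj_poly l z)) (f (emb J z))) G w d Hd).
    + intros z Hz. symmetry; apply G1, B. rewrite norm_slice_minus by exact HJ; exact Hz.
    + apply (slice_hol_emb_mul J (conj_poly l)); [exact HJ|apply conj_poly_hol|].
      apply regular_slice_hol; assumption.
  - destruct (Hl w) as [D|(M & d & Hd & H)]; [lra|elim (Dw D)|].
    apply (slice_hol_of_quadratic_bound J G w (Rabs M) d HJ Hd). intros z Hz.
    assert (P := pow_le (Cmod (z - w)) 2 (Cmod_ge_0 _)).
    assert (Q : 0 <= Rabs M * Cmod (z - w) ^ 2) by (apply Rmult_le_pos; [apply Rabs_pos|exact P]).
    destruct (classic (dom f (emb J z))) as [Dz|Dz].
    + rewrite (G1 z Dz), norm_qmul, norm_emb by exact HJ.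
      eapply Rle_trans; [apply H|].
      * split; [|exact Hz]. apply Cmod_minus_pos. intros ->. exact (Dw Dz).
      * apply Rmult_le_compat_r; [exact P|apply Rle_abs].
    + rewrite (G0 z Dz), norm_quat_zero. exact Q.
Qed.

(** * Semiregular functions are quotients of power series *)

Definition qcoef (u : nat -> R) (n : nat) : quat := qreal (u n).

Definition is_component (pi : quat -> R) : Prop :=
  (forall p q : quat, pi (plus p q) = pi p + pi q) /\
  (forall x (q : quat), pi (scal x q) = x * pi q) /\
  (forall q : quat, Rabs (pi q) <= norm q).

Ltac component_tac :=
  split; [|split; [|intros q; apply (Rabs_component_le q)]];
  [intros [[[? ?] ?] ?] [[[? ?] ?] ?]|intros x [[[? ?] ?] ?]]; reflexivity.

Lemma is_component_q0 : is_component q0. Proof. component_tac. Qed.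
Lemma is_component_q1 : is_component q1. Proof. component_tac. Qed.
Lemma is_component_q2 : is_component q2. Proof. component_tac. Qed.
Lemma is_component_q3 : is_component q3. Proof. component_tac. Qed.

Lemma qmul_qreal_l x (q : quat) : qmul (qreal x) q = scal x q.
Proof. quat_ring. Qed.

Lemma qreal_mult x y : qmul (qreal x) (qreal y) = qreal (x * y).
Proof. quat_ring. Qed.

Lemma qpow_qreal x n : qpow (qreal x) n = qreal (x ^ n).
Proof.
  induction n as [|n IH]; [reflexivity|].
  change (qmul (qreal x) (qpow (qreal x) n) = qreal (x * x ^ n)).
  rewrite IH. apply qreal_mult.
Qed.

Lemma component_pterm pi c x n : is_component pi ->
  pi (pterm c (qreal x) n) = x ^ n * pi (c n).
Proof.
  intros (_ & Hs & _). unfold pterm. rewrite qpow_qreal, qmul_qreal_l. apply Hs.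
Qed.

Lemma component_sum_n pi (u : nat -> quat) n : is_component pi ->
  pi (sum_n u n) = sum_f_R0 (fun k => pi (u k)) n.
Proof.
  intros (Hp & _ & _). induction n as [|n IH]; [rewrite sum_O; reflexivity|].
  rewrite sum_Sn. simpl. rewrite <- IH. apply Hp.
Qed.

Lemma component_star pi u b n : is_component pi ->
  pi (star (qcoef u) b n) = PS_mult u (fun k => pi (b k)) n.
Proof.
  intros Hpi. unfold star, PS_mult. rewrite component_sum_n by exact Hpi.
  apply sum_eq. intros k _. unfold qcoef. rewrite qmul_qreal_l. apply Hpi.
Qed.

Lemma CV_radius_component r c x pi : is_component pi -> in_D r c -> Rabs x < r ->
  Rbar_lt (Rabs x) (CV_radius (fun n => pi (c n))).
Proof.
  intros (_ & _ & Hb) Hc Hx. assert (N := Rabs_pos x).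
  set (x' := (Rabs x + r) / 2). assert (Hx' : Rabs x < x' < r) by (unfold x'; lra).
  destruct (in_D_bounded r c x' Hc) as (M & HM & B); [lra|].
  apply (Rbar_lt_le_trans _ x'); [simpl; lra|].
  apply (proj1 (CV_radius_bounded (fun n => pi (c n)))).
  exists M. intros n. rewrite Rabs_mult.
  rewrite (Rabs_pos_eq (x' ^ n)) by (apply pow_le; lra).
  eapply Rle_trans; [|apply (B n)]. apply Rmult_le_compat_r; [apply pow_le; lra|apply Hb].
Qed.

(** At real points each component of the product is a Cauchy product of real power
    series. *)
Lemma component_psum_star pi r u b x : is_component pi -> in_D r (qcoef u) -> in_D r b ->
  Rabs x < r ->
  Series (fun n => pi (pterm (star (qcoef u) b) (qreal x) n)) =
  PSeries u x * Series (fun n => pi (pterm b (qreal x) n)).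
Proof.
  intros Hpi Hu Hb Hx.
  rewrite (Series_ext _ (fun n => PS_mult u (fun k => pi (b k)) n * x ^ n)).
  2:{ intros n. rewrite component_pterm, component_star by exact Hpi. ring. }
  rewrite (Series_ext (fun n => pi (pterm b (qreal x) n)) (fun n => pi (b n) * x ^ n)).
  2:{ intros n. rewrite component_pterm by exact Hpi. ring. }
  apply (PSeries_mult u (fun k => pi (b k)) x).
  - apply (CV_radius_component r (qcoef u) x q0 is_component_q0 Hu Hx).
  - apply (CV_radius_component r b x pi Hpi Hb Hx).
Qed.

Lemma psum_star_real r u b x : in_D r (qcoef u) -> in_D r b -> Rabs x < r ->
  psum (star (qcoef u) b) (qreal x) = scal (PSeries u x) (psum b (qreal x)).
Proof.
  intros Hu Hb Hx. apply quat_eq.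
  - rewrite (proj1 (proj2 is_component_q0)).
    exact (component_psum_star q0 r u b x is_component_q0 Hu Hb Hx).
  - rewrite (proj1 (proj2 is_component_q1)).
    exact (component_psum_star q1 r u b x is_component_q1 Hu Hb Hx).
  - rewrite (proj1 (proj2 is_component_q2)).
    exact (component_psum_star q2 r u b x is_component_q2 Hu Hb Hx).
  - rewrite (proj1 (proj2 is_component_q3)).
    exact (component_psum_star q3 r u b x is_component_q3 Hu Hb Hx).
Qed.

Lemma psum_qcoef_real u x : psum (qcoef u) (qreal x) = qreal (PSeries u x).
Proof.
  assert (Z : forall pi, is_component pi -> (forall n, pi (qcoef u n) = 0) ->
    Series (fun n => pi (pterm (qcoef u) (qreal x) n)) = 0).
  { intros pi Hpi H. rewrite (Series_ext _ (fun n => 0 * 0)).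
    - rewrite Series_scal_l. ring.
    - intros n. rewrite component_pterm, H by exact Hpi. ring. }
  apply quat_eq.
  - change (Series (fun n => q0 (pterm (qcoef u) (qreal x) n)) = PSeries u x).
    apply Series_ext. intros n. rewrite (component_pterm q0) by apply is_component_q0.
    unfold qcoef, q0, qreal; simpl. ring.
  - exact (Z q1 is_component_q1 (fun n => eq_refl)).
  - exact (Z q2 is_component_q2 (fun n => eq_refl)).
  - exact (Z q3 is_component_q3 (fun n => eq_refl)).
Qed.

Lemma in_D_ext r a b : (forall n, a n = b n) -> in_D r a -> in_D r b.
Proof.
  intros E H q Hq. destruct (H q Hq) as [s Hs]. exists s. revert Hs.
  apply is_series_ext; intros n. unfold pterm. rewrite E. reflexivity.
Qed.

Lemma star_qcoef u v n : star (qcoef u) (qcoef v) n = qcoef (PS_mult u v) n.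
Proof.
  apply quat_eq.
  - exact (component_star q0 u (qcoef v) n is_component_q0).
  - rewrite (component_star q1 u (qcoef v) n is_component_q1). unfold PS_mult.
    rewrite sum_eq_R0; [reflexivity|]. intros k _. unfold qcoef, q1, qreal; simpl; ring.
  - rewrite (component_star q2 u (qcoef v) n is_component_q2). unfold PS_mult.
    rewrite sum_eq_R0; [reflexivity|]. intros k _. unfold qcoef, q2, qreal; simpl; ring.
  - rewrite (component_star q3 u (qcoef v) n is_component_q3). unfold PS_mult.
    rewrite sum_eq_R0; [reflexivity|]. intros k _. unfold qcoef, q3, qreal; simpl; ring.
Qed.

Lemma in_D_PS_mult r u v : in_D r (qcoef u) -> in_D r (qcoef v) -> in_D r (qcoef (PS_mult u v)).
Proof.
  intros Hu Hv. apply (in_D_ext r (star (qcoef u) (qcoef v))).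
  - apply star_qcoef.
  - exact (in_D_star r _ _ Hu Hv).
Qed.

Definition quadratic_coef (c0 c1 c2 : R) (n : nat) : R :=
  match n with 0%nat => c0 | 1%nat => c1 | 2%nat => c2 | _ => 0 end.

Lemma in_D_quadratic r c0 c1 c2 : in_D r (qcoef (quadratic_coef c0 c1 c2)).
Proof.
  apply bounded_in_D. intros x Hx.
  assert (A0 := Rabs_pos c0). assert (A1 := Rabs_pos c1). assert (A2 := Rabs_pos c2).
  assert (X1 : 0 <= Rabs c1 * x) by (apply Rmult_le_pos; lra).
  assert (X2 : 0 <= Rabs c2 * x ^ 2) by (apply Rmult_le_pos; [lra|apply pow_le; lra]).
  exists (1 + Rabs c0 + Rabs c1 * x + Rabs c2 * x ^ 2); split; [lra|].
  intros n. unfold qcoef. rewrite norm_qreal.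
  destruct n as [|[|[|n]]]; simpl quadratic_coef.
  - simpl (x ^ 0). lra.
  - rewrite pow_1. lra.
  - lra.
  - rewrite Rabs_R0, Rmult_0_l. lra.
Qed.

Lemma PSeries_quadratic c0 c1 c2 x :
  PSeries (quadratic_coef c0 c1 c2) x = c0 + c1 * x + c2 * x ^ 2.
Proof.
  apply is_series_unique. do 3 (apply is_series_tail).
  assert (E : c0 + c1 * x + c2 * x ^ 2 - quadratic_coef c0 c1 c2 0 * x ^ 0 -
    quadratic_coef c0 c1 c2 1 * x ^ 1 - quadratic_coef c0 c1 c2 2 * x ^ 2 = 0)
    by (simpl; ring).
  rewrite E. apply is_series_Reals. intros eps Heps. exists O. intros n _.
  rewrite sum_eq_R0 by (intros k _; simpl; ring).
  unfold Rdist. rewrite Rminus_0_r, Rabs_R0. exact Heps.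
Qed.

Fixpoint conj_poly_coef (l : list C) : nat -> R :=
  match l with
  | nil => quadratic_coef 1 0 0
  | c :: l' => PS_mult (quadratic_coef (Cmod c ^ 2) (- 2 * Re c) 1) (conj_poly_coef l')
  end.

Lemma in_D_conj_poly r l : in_D r (qcoef (conj_poly_coef l)).
Proof.
  induction l as [|c l IH]; simpl; [apply in_D_quadratic|].
  apply in_D_PS_mult; [apply in_D_quadratic|exact IH].
Qed.

Lemma conj_poly_real l x : conj_poly l (RtoC x) = RtoC (PSeries (conj_poly_coef l) x).
Proof.
  induction l as [|c l IH].
  - simpl. rewrite PSeries_quadratic. f_equal. ring.
  - assert (R : Rabs x < Rabs x + 1) by lra.
    change (conj_poly (c :: l) x) with ((x - c) * (x - Cconj c) * conj_poly l x)%C.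
    change (conj_poly_coef (c :: l)) with
      (PS_mult (quadratic_coef (Cmod c ^ 2) (- 2 * Re c) 1) (conj_poly_coef l)).
    rewrite PSeries_mult.
    + rewrite RtoC_mult, <- IH, PSeries_quadratic. f_equal. rewrite Cmod2_alt.
      destruct c as [a b]; apply injective_projections; simpl; ring.
    + exact (CV_radius_component (Rabs x + 1) _ x q0 is_component_q0 (in_D_quadratic _ _ _ _) R).
    + exact (CV_radius_component (Rabs x + 1) _ x q0 is_component_q0 (in_D_conj_poly _ l) R).
Qed.

Lemma conj_poly_nonzero l : forall s t : R, s < t ->
  exists x : R, s < x < t /\ conj_poly l (RtoC x) <> 0%C.
Proof.
  induction l as [|c l IH]; intros s t Hst.
  - exists ((s + t) / 2). split; [lra|]. simpl. intros E. apply (f_equal Re) in E. simpl in E. lra.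
  - assert (I : exists s' t', s <= s' /\ s' < t' /\ t' <= t /\ forall x, s' < x < t' -> x <> Re c).
    { destruct (Rle_dec (Re c) ((s + t) / 2)).
      - exists ((s + t) / 2), t. repeat split; try lra. intros x Hx; lra.
      - exists s, ((s + t) / 2). repeat split; try lra. intros x Hx; lra. }
    destruct I as (s' & t' & H1 & H2 & H3 & H4).
    destruct (IH s' t' H2) as (x & Hx & Hn). exists x. split; [lra|]. simpl.
    specialize (H4 x Hx).
    assert (N : forall d : C, Re d = Re c -> (RtoC x - d)%C <> 0%C).
    { intros d Hd E0. apply (f_equal Re) in E0. simpl in E0. apply H4.
      rewrite <- Hd. unfold Re. lra. }
    apply Cmult_neq_0; [apply Cmult_neq_0|exact Hn]; apply N; [reflexivity|].
    destruct c; reflexivity.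
Qed.

(** With real coefficients the sum stays in the complex line of its argument. *)
Lemma psum_real_coef_slice r u J z : imag_unit J -> in_D r (qcoef u) -> Cmod z < r ->
  psum (qcoef u) (emb J z) = emb J (ell J (psum (qcoef u) (emb J z))).
Proof.
  intros HJ Hu Hz.
  assert (H := psum_slice r (qcoef u) J z HJ Hu Hz).
  eapply is_series_quat_unique; [exact H|].
  assert (L := is_cseries_ell J _ _ (qreal 1) H). rewrite qmul_1_r in L.
  apply (is_series_of_ell J). intros v. rewrite ell_emb_mul, Cmult_comm by exact HJ.
  generalize (is_cseries_scal (ell J v) _ _ L). apply is_cseries_ext; intros n.
  unfold qcoef. rewrite qmul_1_r, <- (emb_real J), emb_mult, ell_emb_mul by exact HJ.
  rewrite <- (qmul_1_r (emb J _)), ell_emb_mul by exact HJ.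
  replace (ell J (qreal 1)) with (RtoC 1); [ring|].
  apply injective_projections; unfold ell, q0, q1, q2, q3, qreal; simpl; ring.
Qed.

(** Let [a] be the polynomial, with [a^s = a * a].  At real points
    [a^s f = a (a f) = a b], which is the product of [a^c = a] and [b].  On every slice
    both sides are holomorphic off the exceptional set, so the equality spreads by the
    identity theorem. *)
Lemma regular_left_quotient (f : pfun) E R0 r l b : regular f ->
  defined_off (qball R0) E (restrict f (qball R0)) -> 0 < r -> Rbar_lt r R0 -> in_D r b ->
  (forall x : R, Rabs x < r -> dom f (qreal x) ->
     psum b (qreal x) = scal (PSeries (conj_poly_coef l) x) (f (qreal x))) ->
  forall q, dom f q -> dom (left_quotient r (qcoef (conj_poly_coef l)) b) q ->
    f q = left_quotient r (qcoef (conj_poly_coef l)) b q.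
Proof.
  intros Hf HE Hr Hr0 Hb Hreal q Dq [Bq Nq].
  set (al := conj_poly_coef l) in *.
  assert (Ha : forall r', in_D r' (qcoef al)) by (intros r'; apply in_D_conj_poly).
  assert (Econj : reg_conj (qcoef al) = qcoef al).
  { apply functional_extensionality. intros n. unfold reg_conj, qcoef. quat_ring. }
  assert (Esym : symmetrization (qcoef al) = qcoef (PS_mult al al)).
  { unfold symmetrization. rewrite Econj. apply functional_extensionality. intros n.
    apply star_qcoef. }
  assert (Hs : in_D r (qcoef (PS_mult al al))) by (apply in_D_PS_mult; apply Ha).
  assert (Hn : in_D r (star (qcoef al) b)) by (exact (in_D_star r _ _ (Ha r) Hb)).
  rewrite Esym in Nq.
  destruct (slice_coordinates q) as (J & w & HJ & ->).
  unfold qball in Bq. rewrite norm_emb in Bq by exact HJ. simpl in Bq.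
  assert (key : minus (qmul (psum (qcoef (PS_mult al al)) (emb J w)) (f (emb J w)))
                      (psum (star (qcoef al) b) (emb J w)) = zero).
  { apply (slice_identity J (fun z => minus (qmul (psum (qcoef (PS_mult al al)) (emb J z)) (f (emb J z)))
                      (psum (star (qcoef al) b) (emb J z))) (fun z => ~ dom f (emb J z)) 0 r HJ Hr).
    - apply (slice_isolated_in_disc R0 f E); try assumption; [apply Hf|].
      intros z Hz. rewrite Cminus_0_r in Hz. apply (qball_lt R0 r (emb J z) Hr0).
      rewrite norm_emb by exact HJ. exact Hz.
    - intros z Hz Dz. apply NNPP in Dz. rewrite Cminus_0_r in Hz.
      apply slice_hol_minus; [|apply (psum_slice_hol r); assumption].
      apply (slice_hol_ext_locally J (fun y => qmul (emb J (ell J (qmul (psum (qcoef (PS_mult al al)) (emb J y)) (qreal 1))))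
               (f (emb J y))) _ z (r - Cmod z)); [lra| |].
      + intros y Hy. rewrite qmul_1_r. f_equal. symmetry.
        apply (psum_real_coef_slice r); [exact HJ|exact Hs|].
        assert (T := Cmod_triangle_minus y z 0). rewrite !Cminus_0_r in T. lra.
      + apply (slice_hol_emb_mul J (fun y => ell J (qmul (psum (qcoef (PS_mult al al)) (emb J y)) (qreal 1))));
          [exact HJ| |apply regular_slice_hol; assumption].
        exact (psum_slice_hol r _ J z HJ Hs Hz (qreal 1)).
    - intros x Hx Dx. apply NNPP in Dx. rewrite Rminus_0_r in Hx. rewrite emb_real in *.
      rewrite psum_qcoef_real, (psum_star_real r al b x (Ha r) Hb Hx), (Hreal x Hx Dx).
      rewrite PSeries_mult by
        exact (CV_radius_component r (qcoef al) x q0 is_component_q0 (Ha r) Hx).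
      generalize (f (qreal x)) (PSeries al x). clear. intros. quat_ring.
    - rewrite Cminus_0_r. exact Bq.
    - tauto. }
  change (f (emb J w) = qmul (qinv (psum (symmetrization (qcoef al)) (emb J w)))
    (psum (star (reg_conj (qcoef al)) b) (emb J w))).
  rewrite Esym, Econj.
  assert (E2 : psum (star (qcoef al) b) (emb J w) =
     qmul (psum (qcoef (PS_mult al al)) (emb J w)) (f (emb J w))).
  { symmetry. apply quat_minus_eq. rewrite key. apply norm_quat_zero. }
  rewrite E2, <- qmul_assoc, qmul_qinv_l, qmul_1_l by exact Nq. reflexivity.
Qed.

(** Only the slice of [i] is used to build the quotient: clear the poles there, take the
    power series of the product, and let the identity theorem do the rest. *)
Lemma in_L_of_semiregular (R0 : Rbar) (f : pfun) (hf : regular f) (r : R) :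
  semiregular (qball R0) (restrict f (qball R0)) -> 0 < r -> Rbar_lt r R0 ->
  in_L r (restrict f (qball r)).
Proof.
  intros (E & HE & _ & Hpole) Hr Hr0.
  split.
  { destruct HE as (HA & HD & Hdom). exists (fun q => E q /\ qball r q). split; [|split].
    - intros q [_ Hq]; exact Hq.
    - intros J p HJ Hp [Ep _]. destruct (HD J p HJ Hp Ep) as (eps & Heps & H).
      exists eps; split; [exact Heps|]. intros z Sz [Ez _]. apply H; assumption.
    - intros q. assert (sub : qball r q -> qball R0 q) by (apply (qball_lt R0 r q Hr0)).
      specialize (Hdom q). simpl in *. tauto. }
  set (J := qi).
  assert (HJ : imag_unit J).
  { apply imag_unit_spec. unfold J, qi, q0, q1, q2, q3; simpl; split; [reflexivity|ring]. }
  destruct (Rbar_lt_between _ _ Hr0) as (r1 & H1 & H2).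
  destruct (clear_poles R0 f E J r1 hf HJ HE ltac:(lra) H2) as [l Hl].
  { intros p Ep. apply NNPP. exact (Hpole p Ep). }
  destruct (cleared_extension f J l r1 hf HJ Hl) as (G & HG & EG).
  destruct (slice_taylor J G 0%C r1 r HJ) as [b Hb]; [|lra|].
  { intros w Hw. apply HG. rewrite Cminus_0_r in Hw. exact Hw. }
  assert (HbD : in_D r b).
  { apply in_D_of_series_at. intros x Hx. exists (G (RtoC x)).
    assert (S := Hb (RtoC x)). rewrite Cminus_0_r, Cmod_R, Rabs_pos_eq in S by lra.
    specialize (S (proj2 Hx)). revert S. apply is_series_ext; intros n.
    rewrite <- RtoC_pow, emb_real. reflexivity. }
  exists (qcoef (conj_poly_coef l)), b.
  split; [apply in_D_conj_poly|]. split; [exact HbD|]. split.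
  - destruct (conj_poly_nonzero l 0 r Hr) as (x & Hx & Hn).
    exists (qreal x). split.
    + unfold qball. rewrite norm_qreal, Rabs_pos_eq by lra. simpl; lra.
    + rewrite psum_qcoef_real. intros Z. apply Hn. rewrite conj_poly_real.
      apply (f_equal q0) in Z. simpl in Z. unfold q0, qreal in Z; simpl in Z. rewrite Z. reflexivity.
  - intros q [Dq _] Dl.
    apply (regular_left_quotient f E R0 r l b hf HE Hr Hr0 HbD); [|exact Dq|exact Dl].
    intros x Hx Dx. rewrite <- (emb_real J) in Dx.
    assert (S := Hb (RtoC x)). rewrite Cminus_0_r, Cmod_R in S. specialize (S Hx).
    assert (P := psum_slice r b J (RtoC x) HJ HbD). rewrite Cmod_R, Cminus_0_r in P.
    specialize (P Hx).
    rewrite <- (emb_real J). rewrite (is_series_quat_unique _ _ _ P S), (EG _ Dx), conj_poly_real.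
    rewrite emb_real. apply qmul_qreal_l.
Qed.

Theorem corollary6p2 (R0 : Rbar) (hR0 : Rbar_lt 0 R0) (f : pfun) (hf : regular f) :
  semiregular (qball R0) (restrict f (qball R0)) <->
  (forall r : R, 0 < r -> Rbar_lt r R0 -> in_L r (restrict f (qball r))).
Proof.
  split.
  - intros H r Hr Hr0. apply (in_L_of_semiregular R0); assumption.
  - apply semiregular_of_in_L; assumption.
Qed.
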